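(* Let $Y_h(x)=\sum_{n\ge0}y_{h,n}x^n$ ($h\ge0$) be a sequence of generating functions with nonnegative coefficients such that $y_{h,n}$ is nondecreasing in $h$ and (coefficientwise) $$\lim_{h\to\infty}Y_h(x)=Y(x)=\sum_{n\ge0}y_nx^n,$$ and let $X_n$ denote the sequence of random variables with support $\mathbb{N}_0$ defined by $\mathbb{P}(X_n\le h)=\frac{y_{h,n}}{y_n}$. Assume that each generating function $Y_h$ has a singularity at $\rho_h\in\mathbb{R}$ such that (1) $\rho_h=\rho(1+\kappa\zeta^{r^h}+o(\zeta^{r^h}))$ as $h\to\infty$ for some constants $\rho>0$, $\kappa>0$, $\zeta\in(0,1)$ and $r>1$. (2) $Y_h(x)$ can be continued analytically to the domain $$\{x\in\mathbb{C}: |x|\le(1+\delta)|\rho_h|,\ |\operatorname{Arg}(x/\rho_h-1)|>\phi\}$$ for some fixed $\delta>0$ and $\phi\in(0,\pi/2)$, and $$Y_h(x)=U_h(x)+A_h(1-x/\rho_h)^\alpha+o((1-x/\rho_h)^\alpha)$$ holds within this domain, uniformly in $h$, where $U_h(x)$ is analytic and uniformly bounded in $h$ within the aforementioned region, $\alpha\in\mathbb{R}\setminus\mathbb{N}_0$, and $A_h$ is a constant dependent on $h$ such that $\lim_{h\to\infty}A_h=A\neq0$. Finally, $$Y(x)=U(x)+A(1-x/\rho)^\alpha+o((1-x/\rho)^\alpha)$$ in the region $$\{x\in\mathbb{C}: |x|\le(1+\delta)|\rho|,\ |\operatorname{Arg}(x/\rho-1)|>\phi\}$$ for a function $U(x)$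 that is analytic within this region. Then the asymptotic formula $$\mathbb{P}(X_n\le h)=\frac{y_{h,n}}{y_n}=\exp\big(-\kappa n\zeta^{r^h}(1+o(1))+o(1)\big)$$ holds as $n\to\infty$ and $h=\log_r(\log_d(n))+O(1)$, where $d=\zeta^{-1}$ (i.e., for every constant $C$, uniformly over integers $h\ge0$ with $|h-\log_r(\log_d(n))|\le C$).
   Context: $\mathbb{N}_0$ is the set of nonnegative integers; $\operatorname{Arg}$ is the principal argument; powers $(1-x/\rho_h)^\alpha$ are principal branches. The $o$-terms in the expansions of $Y_h$ and $Y$ refer to $x\to\rho_h$ (respectively $x\to\rho$) within the stated domain, the estimate holding throughout the domain and, for $Y_h$, uniformly in $h$: there is a bounded function $\omega:(0,\infty)\to[0,\infty)$, independent of $h$, with $\omega(t)\to0$ as $t\to0^+$, such that the error term is at most $\omega(|1-x/\rho_h|)\,|1-x/\rho_h|^\alpha$ in absolute value for all $x$ in the domain (and analogously for $Y$).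
   Formalization: For alpha > 0, U_h is additionally assumed to be analytic and uniformly bounded on a disc |x − ρ_h| < η|ρ_h| with η > 0 independent of h; with U_h analytic and bounded only in the slit region the claim is false for alpha > 0. *)

(* Defs.v *)
From Stdlib Require Import Reals.
From mathcomp Require all_boot all_algebra all_classical all_reals all_analysis.
From mathcomp Require Rstruct Rstruct_topology.
From Coquelicot Require Import Coquelicot.

(* Only this part uses MathComp-Analysis, for its probability theory over the
   real numbers of the standard library. *)
Module NatVariable.
Import all_boot all_algebra all_classical all_reals all_analysis.
Import Rstruct Rstruct_topology.

Record nat_variable : Type := Build {
  display : measure_display;
  space : measurableType display;
  prob : probability space R;
  var : {RV prob >-> nat}
}.

Definition prob_le (X : nat_variable) (h : nat) : R :=
  fine (prob X [set w | (var X w <= h)%N]%classic).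

End NatVariable.

Notation nat_variable := NatVariable.nat_variable.
Notation prob_le := NatVariable.prob_le.

Local Open Scope R_scope.

(* Principal argument, in (-PI, PI]; the value at 0 is junk and never used. *)
Definition Carg (z : C) : R :=
  if Rle_dec 0 (Im z) then acos (Re z / Cmod z) else - acos (Re z / Cmod z).

(* Principal branch of z ^ a for z <> 0. *)
Definition Cpower (z : C) (a : R) : C :=
  (RtoC (Rpower (Cmod z) a) * (cos (a * Carg z), sin (a * Carg z)))%C.

(* The vertex x = rho, where the argument is undefined, is excluded. *)
Definition delta_domain (rho delta phi : R) (x : C) : Prop :=
  Cmod x <= (1 + delta) * Rabs rho /\ x <> RtoC rho /\
  phi < Rabs (Carg (x / RtoC rho - 1)%C).

(* Near z, the restriction of f to D is the restriction of a convergent power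
   series.  This is ordinary analyticity when z is interior to D; at a boundary
   point it asserts a local analytic extension beyond D, and the values of f
   outside D are irrelevant.  The point z need not belong to D. *)
Definition analytic_at (D : C -> Prop) (f : C -> C) (z : C) : Prop :=
  exists a : nat -> C,
    locally z (fun x : C => D x ->
      @is_pseries C_AbsRing C_NormedModule a (x - z)%C (f x)).

Definition analytic_on (D : C -> Prop) (f : C -> C) : Prop :=
  forall z : C, D z -> analytic_at D f z.

(* f is an analytic continuation to D of sum_n y_n x^n, which in particular has
   a positive radius of convergence. *)
Definition continues_series (y : nat -> R) (D : C -> Prop) (f : C -> C) : Prop :=
  analytic_on D f /\
  locally (RtoC 0) (fun x : C =>
    @is_pseries C_AbsRing C_NormedModule (fun n => RtoC (y n)) x (f x)).

(* For a limit point z of D: f has no analytic continuation from D to z. *)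
Definition singular_at (D : C -> Prop) (f : C -> C) (z : C) : Prop :=
  ~ analytic_at D f z.

(* A bounded nonnegative function on (0, oo) that tends to 0 at 0+. *)
Definition error_modulus (omega : R -> R) : Prop :=
  (exists M : R, forall t : R, 0 < t -> 0 <= omega t <= M) /\
  filterlim omega (at_right 0) (locally 0).

(* The expansion f = U + A (1 - x/rho)^alpha + o((1 - x/rho)^alpha) throughout D,
   with the o-term controlled by omega. *)
Definition singular_expansion (D : C -> Prop) (rho alpha : R) (omega : R -> R)
    (f U : C -> C) (A : C) : Prop :=
  forall x : C, D x ->
    let z := (1 - x / RtoC rho)%C in
    Cmod (f x - U x - A * Cpower z alpha)%C
      <= omega (Cmod z) * Rpower (Cmod z) alpha.

Definition logb (b x : R) : R := ln x / ln b.

Definition in_window (r d K : R) (n h : nat) : Prop :=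
  Rabs (INR h - logb r (logb d (INR n))) <= K.

(* e n h = o(1) as n -> oo, uniformly over the h with W n h. *)
Definition little_o1 (W : nat -> nat -> Prop) (e : nat -> nat -> R) : Prop :=
  forall eps : R, 0 < eps ->
    eventually (fun n => forall h : nat, W n h -> Rabs (e n h) < eps).

(* Main.v *)
Require Import Defs.
From Stdlib Require Import Reals Lra Lia Psatz ClassicalEpsilon.
From Coquelicot Require Import Coquelicot.
Local Open Scope R_scope.

(** The proof is singularity analysis made uniform in h. After the
    substitution x = rho_h v every Y_h has its singularity at v = 1, and the
    expansion there predicts
      y_{h,n} rho_h^n = A_h a_n + o(n^(-alpha-1)),
    where a_n, the n-th coefficient of (1 - v)^alpha, has modulus at least a
    constant times n^(-alpha-1) because alpha is not a natural number. The
    point is that the error is uniform in h. Letting h tend to infinity with n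
    fixed then gives y_n rho^n = A a_n + o(n^(-alpha-1)), since y_{h,n} -> y_n,
    rho_h -> rho and A_h -> A. Dividing,
      y_{h,n} / y_n = (rho / rho_h)^n (1 + o(1)),
    uniformly for large n and h. The expansion of rho_h gives
    ln (rho_h / rho) = kappa zeta^(r^h) (1 + o(1)), and h is large throughout the
    window once n is, so this is the asserted formula.

    The uniform error comes from Cauchy's formula. A contour that is a polar
    curve g(t) = radius(t) e^(it), 0 <= t <= 2 pi, can be shrunk to the origin
    by homotheties, so Cauchy's theorem reduces to differentiating the integral
    of P(s g) g'/g with respect to s (integral_scaling_invariant): the
    derivative is the integral of an exact derivative. Letting s tend to 0
    evaluates such integrals (integral_eq_limit_at_0) and identifies the
    integral of f(g) g^(-n) g'/g with 2 pi i times the n-th Taylor coefficient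
    of f (coef_taylor).

    The contour with radius 1 - 1/n + c sin(t/2), for a small fixed c > 0,
    replaces the usual Hankel contour: it passes at distance about 1/n from the
    singularity, stays inside the sector where Y_h is known
    (curve_in_sector), and along it, with s = sin(t/2), the distance to 1 is
    comparable to 1/n + s while the n-th power of the radius is at least a
    constant times exp(c n s / 2). Hence a function bounded by
    omega(|1-v|) |1-v|^alpha with omega -> 0 has n-th coefficient
    o(n^(-alpha-1)) (curve_integral_small).

    The functions U_h do not contribute. If alpha < 0, a bounded function is
    itself o((1-v)^alpha). If alpha > 0, U_h is analytic and bounded on a disc
    of radius greater than 1, so its coefficients are geometrically small. For
    (1 - v)^alpha, the same contour integrals satisfy the recursion of the a_n
    because (1 - v) f' = - alpha f (coef_Cpower). *)

(** * Moduli of complex numbers *)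

Lemma Cmod_minus_sym (x y : C) : Cmod (x - y) = Cmod (y - x).
Proof. rewrite <- Cmod_opp. f_equal. ring. Qed.

Lemma Cmod_minus_triangle (x y z : C) :
  Cmod (x - y) <= Cmod (x - z) + Cmod (y - z).
Proof.
  rewrite (Cmod_minus_sym y z).
  replace (x - y)%C with ((x - z) + (z - y))%C by ring. apply Cmod_triangle.
Qed.

Lemma Cmod_triangle_inv (x y : C) : Cmod x - Cmod y <= Cmod (x - y).
Proof.
  pose proof (Cmod_triangle (x - y) y) as H.
  replace (x - y + y)%C with x in H by ring. lra.
Qed.

Lemma im_le_Cmod (z : C) : Rabs (Im z) <= Cmod z.
Proof.
  apply Rle_trans with (2 := Rmax_Cmod z). apply Rmax_r.
Qed.

Lemma Cmod_le_re_im (z : C) : Cmod z <= Rabs (Re z) + Rabs (Im z).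
Proof.
  pose proof (Rabs_pos (Re z)). pose proof (Rabs_pos (Im z)).
  apply Rsqr_incr_0_var; [ | lra ].
  rewrite !Rsqr_pow2, Cmod2_alt, <- (pow2_abs (Re z)), <- (pow2_abs (Im z)). nra.
Qed.

(** * Strict complex differentiability *)

(** Differentiability at [z] with a remainder that is quadratic and controls all
    pairs of points near [z], not only pairs containing [z]. Power series, exp
    and log have it; it is stable under products, composition and inverse
    functions without any epsilon; and on an open set it makes the derivative continuous,
    which is what differentiation under the integral sign needs. *)
Definition strict_deriv (f : C -> C) (z l : C) : Prop :=
  exists K d : R, 0 < d /\ 0 <= K /\
    forall x y : C, Cmod (x - z) < d -> Cmod (y - z) < d ->
      Cmod (f x - f y - l * (x - y))
        <= K * Cmod (x - y) * (Cmod (x - z) + Cmod (y - z)).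

Definition holomorphic (O : C -> Prop) (f df : C -> C) : Prop :=
  forall z : C, O z -> strict_deriv f z (df z).

Definition near (z : C) (P : C -> Prop) : Prop :=
  exists d : R, 0 < d /\ forall x : C, Cmod (x - z) < d -> P x.

Definition is_open (O : C -> Prop) : Prop := forall z : C, O z -> near z O.

Lemma is_open_punctured (O : C -> Prop) :
  is_open O -> is_open (fun z => O z /\ z <> 0).
Proof.
  intros HO z [Hz Hz0]. destruct (HO z Hz) as (d & Hd & H).
  apply Cmod_gt_0 in Hz0.
  exists (Rmin d (Cmod z)). split; [ now apply Rmin_pos | ]. intros x Hx. split.
  - apply H. eapply Rlt_le_trans; [ apply Hx | apply Rmin_l ].
  - intros ->. rewrite Cmod_minus_sym in Hx.
    replace (z - 0)%C with z in Hx by ring. pose proof (Rmin_r d (Cmod z)). lra.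
Qed.

Lemma is_open_ball (r : R) : is_open (fun v => Cmod v < r).
Proof.
  intros v Hv. exists (r - Cmod v). split; [ lra | ]. intros x Hx.
  pose proof (Cmod_triangle_inv x v). lra.
Qed.

Lemma strict_deriv_lipschitz (f : C -> C) (z l : C) :
  strict_deriv f z l ->
  exists L d : R, 0 < d /\ 0 <= L /\
    forall x y : C, Cmod (x - z) < d -> Cmod (y - z) < d ->
      Cmod (f x - f y) <= L * Cmod (x - y).
Proof.
  intros (K & d & Hd & HK & H).
  exists (Cmod l + K * (d + d)), d.
  pose proof (Cmod_ge_0 l).
  split; [ assumption | split; [ nra | ] ].
  intros x y Hx Hy. specialize (H x y Hx Hy).
  pose proof (Cmod_ge_0 (x - y)).
  replace (f x - f y)%C with ((f x - f y - l * (x - y)) + l * (x - y))%C by ring.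
  eapply Rle_trans; [ apply Cmod_triangle | ]. rewrite Cmod_mult.
  assert (K * Cmod (x - y) * (Cmod (x - z) + Cmod (y - z))
          <= K * Cmod (x - y) * (d + d)).
  { apply Rmult_le_compat_l; [ | lra ]. now apply Rmult_le_pos. }
  lra.
Qed.

Lemma strict_deriv_continuous (f : C -> C) (z l : C) :
  strict_deriv f z l ->
  forall eps : R, 0 < eps -> near z (fun x => Cmod (f x - f z) < eps).
Proof.
  intros H eps He. destruct (strict_deriv_lipschitz _ _ _ H) as (L & d & Hd & HL & HH).
  assert (0 < eps / (L + 1)) by (apply Rdiv_lt_0_compat; lra).
  exists (Rmin d (eps / (L + 1))). split; [ now apply Rmin_pos | ].
  intros x Hx.
  assert (Cmod (z - z) < d).
  { replace (z - z)%C with (RtoC 0) by ring. now rewrite Cmod_0. }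
  eapply Rle_lt_trans; [ apply HH; auto | ].
  - eapply Rlt_le_trans; [ apply Hx | apply Rmin_l ].
  - assert (Hx' : Cmod (x - z) < eps / (L + 1))
      by (eapply Rlt_le_trans; [ apply Hx | apply Rmin_r ]).
    apply Rle_lt_trans with ((L + 1) * Cmod (x - z)).
    + pose proof (Cmod_ge_0 (x - z)). nra.
    + apply Rmult_lt_reg_r with (/ (L + 1)); [ apply Rinv_0_lt_compat; lra | ].
      replace ((L + 1) * Cmod (x - z) * / (L + 1)) with (Cmod (x - z)) by (field; lra).
      exact Hx'.
Qed.

Lemma strict_deriv_const (c z : C) : strict_deriv (fun _ => c) z 0.
Proof.
  exists 0, 1. repeat split; try lra. intros x y _ _.
  replace (c - c - 0 * (x - y))%C with (RtoC 0) by ring. rewrite Cmod_0. lra.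
Qed.

Lemma strict_deriv_id (z : C) : strict_deriv (fun x => x) z 1.
Proof.
  exists 0, 1. repeat split; try lra. intros x y _ _.
  replace (x - y - 1 * (x - y))%C with (RtoC 0) by ring. rewrite Cmod_0. lra.
Qed.

Lemma strict_deriv_plus (f g : C -> C) (z l m : C) :
  strict_deriv f z l -> strict_deriv g z m ->
  strict_deriv (fun x => f x + g x)%C z (l + m)%C.
Proof.
  intros (K & d & Hd & HK & H) (K' & d' & Hd' & HK' & H').
  exists (K + K'), (Rmin d d').
  split; [ now apply Rmin_pos | split; [ lra | ] ].
  intros x y Hx Hy.
  specialize (H x y (Rlt_le_trans _ _ _ Hx (Rmin_l _ _))
                    (Rlt_le_trans _ _ _ Hy (Rmin_l _ _))).
  specialize (H' x y (Rlt_le_trans _ _ _ Hx (Rmin_r _ _))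
                    (Rlt_le_trans _ _ _ Hy (Rmin_r _ _))).
  replace (f x + g x - (f y + g y) - (l + m) * (x - y))%C with
    ((f x - f y - l * (x - y)) + (g x - g y - m * (x - y)))%C by ring.
  eapply Rle_trans; [ apply Cmod_triangle | ]. lra.
Qed.

Lemma strict_deriv_mult (f g : C -> C) (z l m : C) :
  strict_deriv f z l -> strict_deriv g z m ->
  strict_deriv (fun x => f x * g x)%C z (l * g z + f z * m)%C.
Proof.
  intros Hf Hg.
  destruct (strict_deriv_lipschitz _ _ _ Hf) as (Lf & e & He & HLf & Lipf).
  destruct (strict_deriv_lipschitz _ _ _ Hg) as (Lg & e' & He' & HLg & Lipg).
  destruct Hf as (K & d & Hd & HK & H), Hg as (K' & d' & Hd' & HK' & H').
  set (D := Rmin (Rmin d d') (Rmin e e')).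
  assert (HD : D <= d /\ D <= d' /\ D <= e /\ D <= e').
  { unfold D. pose proof (Rmin_l (Rmin d d') (Rmin e e')).
    pose proof (Rmin_r (Rmin d d') (Rmin e e')).
    pose proof (Rmin_l d d'). pose proof (Rmin_r d d').
    pose proof (Rmin_l e e'). pose proof (Rmin_r e e'). lra. }
  assert (HDp : 0 < D) by (unfold D; repeat apply Rmin_pos; assumption).
  destruct HD as (D1 & D2 & D3 & D4).
  assert (Hzz : Cmod (z - z) = 0)
    by (replace (z - z)%C with (RtoC 0) by ring; apply Cmod_0).
  pose proof (Cmod_ge_0 l). pose proof (Cmod_ge_0 m).
  pose proof (Cmod_ge_0 (f z)). pose proof (Cmod_ge_0 (g z)).
  set (Mg := Cmod (g z) + Lg * D). set (Mf := Cmod (f z) + Lf * D).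
  assert (0 <= Lg * D) by nra. assert (0 <= Lf * D) by nra.
  exists (K * Mg + Cmod l * Lg + K' * Mf + Cmod m * Lf), D.
  split; [ assumption | split ].
  { unfold Mg, Mf.
    pose proof (Rmult_le_pos K (Cmod (g z) + Lg * D) ltac:(lra) ltac:(lra)).
    pose proof (Rmult_le_pos K' (Cmod (f z) + Lf * D) ltac:(lra) ltac:(lra)).
    pose proof (Rmult_le_pos (Cmod l) Lg ltac:(lra) ltac:(lra)).
    pose proof (Rmult_le_pos (Cmod m) Lf ltac:(lra) ltac:(lra)). lra. }
  intros x y Hx Hy.
  assert (Hgx := Lipg x z ltac:(lra) ltac:(lra)).
  assert (Hfy := Lipf y z ltac:(lra) ltac:(lra)).
  specialize (H x y ltac:(lra) ltac:(lra)). specialize (H' x y ltac:(lra) ltac:(lra)).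
  assert (Bg : Cmod (g x) <= Mg).
  { pose proof (Cmod_triangle_inv (g x) (g z)). unfold Mg.
    pose proof (Cmod_ge_0 (x - z)). nra. }
  assert (Bf : Cmod (f y) <= Mf).
  { pose proof (Cmod_triangle_inv (f y) (f z)). unfold Mf.
    pose proof (Cmod_ge_0 (y - z)). nra. }
  set (N := Cmod (x - z) + Cmod (y - z)) in *.
  pose proof (Cmod_ge_0 (x - z)). pose proof (Cmod_ge_0 (y - z)).
  pose proof (Cmod_ge_0 (x - y)). pose proof (Cmod_ge_0 (g x)). pose proof (Cmod_ge_0 (f y)).
  replace (f x * g x - f y * g y - (l * g z + f z * m) * (x - y))%C with
   ((f x - f y - l * (x - y)) * g x + l * (x - y) * (g x - g z)
     + ((g x - g y - m * (x - y)) * f y + m * (x - y) * (f y - f z)))%C by ring.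
  eapply Rle_trans; [ apply Cmod_triangle | ].
  eapply Rle_trans; [ apply Rplus_le_compat; apply Cmod_triangle | ].
  rewrite !Cmod_mult.
  assert (HN : 0 <= Cmod (x - y) * N) by (apply Rmult_le_pos; unfold N; lra).
  assert (E1 : Cmod (f x - f y - l * (x - y)) * Cmod (g x) <= K * Mg * (Cmod (x - y) * N)).
  { replace (K * Mg * (Cmod (x - y) * N)) with (K * Cmod (x - y) * N * Mg) by ring.
    apply Rmult_le_compat; auto using Cmod_ge_0. }
  assert (E2 : Cmod l * Cmod (x - y) * Cmod (g x - g z)
               <= Cmod l * Lg * (Cmod (x - y) * N)).
  { replace (Cmod l * Lg * (Cmod (x - y) * N)) with
      (Cmod l * Cmod (x - y) * (Lg * N)) by ring.
    apply Rmult_le_compat_l; [ apply Rmult_le_pos; lra | ].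
    eapply Rle_trans; [ apply Hgx | ]. apply Rmult_le_compat_l; unfold N; lra. }
  assert (E3 : Cmod (g x - g y - m * (x - y)) * Cmod (f y) <= K' * Mf * (Cmod (x - y) * N)).
  { replace (K' * Mf * (Cmod (x - y) * N)) with (K' * Cmod (x - y) * N * Mf) by ring.
    apply Rmult_le_compat; auto using Cmod_ge_0. }
  assert (E4 : Cmod m * Cmod (x - y) * Cmod (f y - f z)
               <= Cmod m * Lf * (Cmod (x - y) * N)).
  { replace (Cmod m * Lf * (Cmod (x - y) * N)) with
      (Cmod m * Cmod (x - y) * (Lf * N)) by ring.
    apply Rmult_le_compat_l; [ apply Rmult_le_pos; lra | ].
    eapply Rle_trans; [ apply Hfy | ]. apply Rmult_le_compat_l; unfold N; lra. }
  lra.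
Qed.

Lemma strict_deriv_comp (f g : C -> C) (z l m : C) :
  strict_deriv f (g z) l -> strict_deriv g z m ->
  strict_deriv (fun x => f (g x)) z (l * m)%C.
Proof.
  intros (K & d & Hd & HK & H) Hg.
  destruct (strict_deriv_lipschitz _ _ _ Hg) as (L & e & He & HL & Lip).
  destruct (strict_deriv_continuous _ _ _ Hg d Hd) as (e2 & He2 & Hc).
  destruct Hg as (K' & d' & Hd' & HK' & H').
  set (D := Rmin d' (Rmin e e2)).
  assert (HD : D <= d' /\ D <= e /\ D <= e2).
  { unfold D. pose proof (Rmin_l d' (Rmin e e2)). pose proof (Rmin_r d' (Rmin e e2)).
    pose proof (Rmin_l e e2). pose proof (Rmin_r e e2). lra. }
  destruct HD as (D1 & D2 & D3).
  assert (Hzz : Cmod (z - z) = 0)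
    by (replace (z - z)%C with (RtoC 0) by ring; apply Cmod_0).
  pose proof (Cmod_ge_0 l).
  exists (K * L * L + Cmod l * K'), D.
  split; [ unfold D; repeat apply Rmin_pos; assumption | split; [ | ] ].
  { pose proof (Rmult_le_pos (K * L) L ltac:(nra) ltac:(lra)). nra. }
  intros x y Hx Hy.
  specialize (H (g x) (g y) (Hc x ltac:(lra)) (Hc y ltac:(lra))).
  specialize (H' x y ltac:(lra) ltac:(lra)).
  assert (Lx := Lip x z ltac:(lra) ltac:(lra)).
  assert (Ly := Lip y z ltac:(lra) ltac:(lra)).
  assert (Lxy := Lip x y ltac:(lra) ltac:(lra)).
  set (N := Cmod (x - z) + Cmod (y - z)) in *.
  replace (f (g x) - f (g y) - l * m * (x - y))%C with
    ((f (g x) - f (g y) - l * (g x - g y)) + l * (g x - g y - m * (x - y)))%C by ring.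
  eapply Rle_trans; [ apply Cmod_triangle | ]. rewrite Cmod_mult.
  pose proof (Cmod_ge_0 (g x - g z)). pose proof (Cmod_ge_0 (g y - g z)).
  pose proof (Cmod_ge_0 (g x - g y)).
  assert (E1 : K * Cmod (g x - g y) * (Cmod (g x - g z) + Cmod (g y - g z))
     <= K * (L * Cmod (x - y)) * (L * N)).
  { apply Rmult_le_compat.
    - now apply Rmult_le_pos.
    - lra.
    - now apply Rmult_le_compat_l.
    - unfold N; lra. }
  assert (E2 : Cmod l * Cmod (g x - g y - m * (x - y))
          <= Cmod l * (K' * Cmod (x - y) * N)) by now apply Rmult_le_compat_l.
  lra.
Qed.

Lemma strict_deriv_inv (z : C) :
  z <> 0 -> strict_deriv Cinv z (- (/ z * / z))%C.
Proof.
  intros Hz. assert (Hm : 0 < Cmod z) by now apply Cmod_gt_0.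
  set (d := Cmod z / 2).
  assert (Hfar : forall x : C, Cmod (x - z) < d -> d < Cmod x /\ Cmod x < 3 * d).
  { intros x Hx. pose proof (Cmod_triangle_inv z x) as H.
    pose proof (Cmod_triangle_inv x z).
    rewrite (Cmod_minus_sym z x) in H. unfold d in *. lra. }
  assert (Hd : 0 < d) by (unfold d; lra).
  exists (3 * d * / (Cmod z * Cmod z * d * d)), d.
  assert (0 < Cmod z * Cmod z * d * d) by (repeat apply Rmult_lt_0_compat; lra).
  split; [ lra | split ].
  { apply Rmult_le_pos; [ lra | ]. apply Rlt_le, Rinv_0_lt_compat; lra. }
  intros x y Hx Hy.
  destruct (Hfar x Hx) as [Hx1 Hx2]. destruct (Hfar y Hy) as [Hy1 _].
  assert (x <> 0) by (apply Cmod_gt_0; lra).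
  assert (y <> 0) by (apply Cmod_gt_0; lra).
  replace (/ x - / y - - (/ z * / z) * (x - y))%C with
    ((x - y) * (((x - z) * y + z * (y - z)) * / (z * z * x * y)))%C
    by (field; auto).
  assert (z * z * x * y <> 0)%C by (repeat apply Cmult_neq_0; assumption).
  rewrite !Cmod_mult, Cmod_inv, !Cmod_mult by assumption.
  pose proof (Cmod_ge_0 (x - y)). pose proof (Cmod_ge_0 (x - z)). pose proof (Cmod_ge_0 (y - z)).
  replace (3 * d * / (Cmod z * Cmod z * d * d) * Cmod (x - y) * (Cmod (x - z) + Cmod (y - z)))
   with (Cmod (x - y) * ((3 * d * (Cmod (x - z) + Cmod (y - z))) * / (Cmod z * Cmod z * d * d)))
    by ring.
  apply Rmult_le_compat_l; [ assumption | ].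
  assert (Hy2 := proj2 (Hfar y Hy)).
  apply Rmult_le_compat.
  - apply Cmod_ge_0.
  - apply Rlt_le, Rinv_0_lt_compat. repeat apply Rmult_lt_0_compat; lra.
  - eapply Rle_trans; [ apply Cmod_triangle | ]. rewrite !Cmod_mult.
    assert (Cmod z = 2 * d) by (unfold d; field). nra.
  - apply Rinv_le_contravar; [ assumption | ].
    rewrite !Rmult_assoc. repeat apply Rmult_le_compat_l; try lra.
    apply Rmult_le_compat; lra.
Qed.

Lemma strict_deriv_ext_near (f g : C -> C) (z l : C) :
  near z (fun x => f x = g x) -> strict_deriv f z l -> strict_deriv g z l.
Proof.
  intros (e & He & Hfg) (K & d & Hd & HK & H).
  exists K, (Rmin d e). split; [ now apply Rmin_pos | split; [ assumption | ] ].
  intros x y Hx Hy.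
  rewrite <- (Hfg x), <- (Hfg y) by (eapply Rlt_le_trans; [ eassumption | apply Rmin_r ]).
  apply H; eapply Rlt_le_trans; try eassumption; apply Rmin_l.
Qed.

Lemma strict_deriv_ext (f g : C -> C) (z l : C) :
  (forall x, f x = g x) -> strict_deriv f z l -> strict_deriv g z l.
Proof.
  intros H. apply strict_deriv_ext_near. exists 1. split; [ lra | auto ].
Qed.

Lemma strict_deriv_scal (c : C) (f : C -> C) (z l : C) :
  strict_deriv f z l -> strict_deriv (fun x => c * f x)%C z (c * l)%C.
Proof.
  intros H. replace (c * l)%C with (0 * f z + c * l)%C by ring.
  apply (strict_deriv_mult (fun _ => c) f); [ apply strict_deriv_const | exact H ].
Qed.

Lemma strict_deriv_inv_pow (n : nat) (z : C) :
  z <> 0 ->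
  strict_deriv (fun x => (/ x) ^ n)%C z (- INR n * (/ z) ^ S n)%C.
Proof.
  intros Hz. induction n as [ | n IH ].
  - replace (- INR 0 * (/ z) ^ 1)%C with (RtoC 0) by (simpl; ring).
    apply (strict_deriv_const 1).
  - replace (- INR (S n) * (/ z) ^ S (S n))%C with
      (- (/ z * / z) * (/ z) ^ n + / z * (- INR n * (/ z) ^ S n))%C.
    + apply (strict_deriv_mult Cinv (fun x => (/ x) ^ n)%C); [ | exact IH ].
      now apply strict_deriv_inv.
    + rewrite S_INR, RtoC_plus, !Cpow_S. ring.
Qed.

(** The expansions at [z] and at a nearby [w] both describe the increments of
    [f] near [w], so their linear parts are close. *)
Lemma holomorphic_deriv_continuous (O : C -> Prop) (f df : C -> C) (z : C) :
  is_open O -> holomorphic O f df -> O z ->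
  forall eps : R, 0 < eps -> near z (fun x => Cmod (df x - df z) < eps).
Proof.
  intros HO Hf Hz eps Heps.
  destruct (HO z Hz) as (e & He & HOe).
  destruct (Hf z Hz) as (K & d & Hd & HK & H).
  set (D := Rmin e (Rmin d (eps / (4 * (K + 1))))).
  assert (Hq : 0 < eps / (4 * (K + 1))) by (apply Rdiv_lt_0_compat; lra).
  assert (HD : D <= e /\ D <= d /\ D <= eps / (4 * (K + 1))).
  { unfold D. pose proof (Rmin_l e (Rmin d (eps / (4 * (K + 1))))).
    pose proof (Rmin_r e (Rmin d (eps / (4 * (K + 1))))).
    pose proof (Rmin_l d (eps / (4 * (K + 1)))).
    pose proof (Rmin_r d (eps / (4 * (K + 1)))). lra. }
  assert (HDp : 0 < D) by (unfold D; repeat apply Rmin_pos; assumption).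
  destruct HD as (D1 & D2 & D3).
  exists D. split; [ assumption | ]. intros w Hw.
  destruct (Hf w (HOe w ltac:(lra))) as (K' & d' & Hd' & HK' & H').
  (* compare both first-order expansions on a small increment from w *)
  set (h := Rmin (d' / 2) (Rmin ((D - Cmod (w - z)) / 2) (eps / (4 * (K' + 1))))).
  assert (Hq' : 0 < eps / (4 * (K' + 1))) by (apply Rdiv_lt_0_compat; lra).
  assert (Hh : 0 < h) by (unfold h; repeat apply Rmin_pos; lra).
  assert (Hb : h <= d' / 2 /\ h <= (D - Cmod (w - z)) / 2 /\ h <= eps / (4 * (K' + 1))).
  { unfold h. pose proof (Rmin_l (d' / 2) (Rmin ((D - Cmod (w - z)) / 2) (eps / (4 * (K' + 1))))).
    pose proof (Rmin_r (d' / 2) (Rmin ((D - Cmod (w - z)) / 2) (eps / (4 * (K' + 1))))).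
    pose proof (Rmin_l ((D - Cmod (w - z)) / 2) (eps / (4 * (K' + 1)))).
    pose proof (Rmin_r ((D - Cmod (w - z)) / 2) (eps / (4 * (K' + 1)))). lra. }
  destruct Hb as (B1 & B2 & B3).
  set (x := (w + RtoC h)%C).
  assert (Exw : Cmod (x - w) = h).
  { replace (x - w)%C with (RtoC h) by (unfold x; ring).
    rewrite Cmod_R, Rabs_pos_eq; lra. }
  assert (Eww : Cmod (w - w) = 0)
    by (replace (w - w)%C with (RtoC 0) by ring; apply Cmod_0).
  assert (Exz : Cmod (x - z) <= h + Cmod (w - z)).
  { replace (x - z)%C with ((x - w) + (w - z))%C by ring. rewrite <- Exw at 1.
    apply Cmod_triangle. }
  specialize (H x w ltac:(lra) ltac:(lra)).
  specialize (H' x w ltac:(lra) ltac:(lra)).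
  rewrite Exw in H. rewrite Exw, Eww in H'.
  assert (Hfin : Cmod (df w - df z) * h <= h * (eps / 2 + eps / 4)).
  { rewrite <- Exw at 1. rewrite <- Cmod_mult.
    replace ((df w - df z) * (x - w))%C with
      ((f x - f w - df z * (x - w)) - (f x - f w - df w * (x - w)))%C by ring.
    eapply Rle_trans; [ apply Cmod_triangle | ]. rewrite Cmod_opp.
    assert (K * (h + 2 * Cmod (w - z)) <= eps / 2).
    { apply Rle_trans with ((K + 1) * (2 * D)); [ nra | ].
      apply Rle_trans with ((K + 1) * (2 * (eps / (4 * (K + 1))))); [ nra | ].
      right. field. lra. }
    assert (K' * h <= eps / 4).
    { apply Rle_trans with ((K' + 1) * (eps / (4 * (K' + 1)))); [ nra | ].
      right. field. lra. }
    assert (K * h * (Cmod (x - z) + Cmod (w - z)) <= h * (eps / 2)).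
    { replace (K * h * (Cmod (x - z) + Cmod (w - z))) with
        (h * (K * (Cmod (x - z) + Cmod (w - z)))) by ring.
      apply Rmult_le_compat_l; [ lra | ]. nra. }
    assert (K' * h * (h + 0) <= h * (eps / 4)).
    { replace (K' * h * (h + 0)) with (h * (K' * h)) by ring.
      apply Rmult_le_compat_l; lra. }
    lra. }
  apply Rle_lt_trans with (eps / 2 + eps / 4); [ | lra ].
  apply Rmult_le_reg_r with h; lra.
Qed.

Fixpoint taylor_poly (y : nat -> C) (n : nat) (z : C) : C :=
  match n with
  | 0%nat => y 0%nat
  | S m => (taylor_poly y m z + y (S m) * z ^ S m)%C
  end.

Lemma strict_deriv_pow (n : nat) (z : C) :
  strict_deriv (fun x => x ^ n)%C z (INR n * z ^ pred n)%C.
Proof.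
  induction n as [ | n IH ].
  - replace (INR 0 * z ^ pred 0)%C with (RtoC 0) by (simpl; ring).
    apply (strict_deriv_const 1).
  - replace (INR (S n) * z ^ pred (S n))%C with
      (1 * z ^ n + z * (INR n * z ^ pred n))%C.
    + apply (strict_deriv_mult (fun x => x) (fun x => x ^ n)%C);
        [ apply strict_deriv_id | exact IH ].
    + rewrite S_INR, RtoC_plus. simpl pred. destruct n; [ simpl; ring | ].
      simpl pred. rewrite Cpow_S. ring.
Qed.

Lemma taylor_poly_holomorphic (y : nat -> C) (n : nat) :
  exists dp, forall z, strict_deriv (taylor_poly y n) z (dp z).
Proof.
  induction n as [ | n [dp IH] ].
  - exists (fun _ => RtoC 0). intros z. apply strict_deriv_const.
  - exists (fun z => dp z + y (S n) * (INR (S n) * z ^ n))%C. intros z.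
    apply (strict_deriv_plus (taylor_poly y n)); [ apply IH | ].
    apply (strict_deriv_scal _ (fun x => x ^ S n)%C), strict_deriv_pow.
Qed.

(** * Complex-valued functions of a real variable *)

(** Limits of complex-valued functions along any filter; used for curves and for
    functions of the pair (scale, time). *)
Definition tends {T : Type} (F : (T -> Prop) -> Prop) (f : T -> C) (l : C) : Prop :=
  forall eps : R, 0 < eps -> F (fun x => Cmod (f x - l) < eps).

Lemma tends_mult {T : Type} (F : (T -> Prop) -> Prop) {FF : Filter F}
    (f g : T -> C) (l m : C) :
  tends F f l -> tends F g m -> tends F (fun x => f x * g x)%C (l * m)%C.
Proof.
  intros Hf Hg eps He.
  pose proof (Cmod_ge_0 l). pose proof (Cmod_ge_0 m).
  set (e := Rmin 1 (eps / (2 + Cmod l + Cmod m))).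
  assert (0 < eps / (2 + Cmod l + Cmod m)) by (apply Rdiv_lt_0_compat; lra).
  assert (Hep : 0 < e) by (apply Rmin_pos; lra).
  apply (filter_imp (fun x => Cmod (f x - l) < e /\ Cmod (g x - m) < e));
    [ | apply filter_and; auto ].
  intros x [Hx Hy].
  replace (f x * g x - l * m)%C with
    ((f x - l) * (g x - m) + ((f x - l) * m + l * (g x - m)))%C by ring.
  eapply Rle_lt_trans; [ apply Cmod_triangle | ].
  eapply Rle_lt_trans;
    [ apply Rplus_le_compat_l, Cmod_triangle | ]. rewrite !Cmod_mult.
  pose proof (Cmod_ge_0 (f x - l)). pose proof (Cmod_ge_0 (g x - m)).
  assert (e <= 1) by apply Rmin_l.
  assert (e * (2 + Cmod l + Cmod m) <= eps).
  { apply Rle_trans with (eps / (2 + Cmod l + Cmod m) * (2 + Cmod l + Cmod m)).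
    - apply Rmult_le_compat_r; [ lra | apply Rmin_r ].
    - right. field. lra. }
  assert (Cmod (f x - l) * Cmod (g x - m) <= e * 1) by (apply Rmult_le_compat; lra).
  assert (Cmod (f x - l) * Cmod m <= e * Cmod m) by (apply Rmult_le_compat; lra).
  assert (Cmod l * Cmod (g x - m) <= Cmod l * e) by (apply Rmult_le_compat; lra).
  nra.
Qed.

Lemma tends_comp {T : Type} (F : (T -> Prop) -> Prop) {FF : Filter F}
    (f : T -> C) (P : C -> C) (l m : C) :
  tends F f l ->
  (forall eps : R, 0 < eps -> near l (fun x => Cmod (P x - m) < eps)) ->
  tends F (fun x => P (f x)) m.
Proof.
  intros Hf HP eps He. destruct (HP eps He) as (d & Hd & H).
  apply (filter_imp (fun x => Cmod (f x - l) < d)); auto.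
Qed.

Lemma tends_Re {T : Type} (F : (T -> Prop) -> Prop) {FF : Filter F} (f : T -> C) (l : C) :
  tends F f l -> filterlim (fun x => Re (f x)) F (locally (Re l)).
Proof.
  intros H. apply filterlim_locally. intros eps.
  apply (filter_imp (fun x => Cmod (f x - l) < eps)); [ | apply H, cond_pos ].
  intros x Hx. eapply Rle_lt_trans; [ | apply Hx ].
  apply (re_le_Cmod (f x - l)).
Qed.

Lemma tends_Im {T : Type} (F : (T -> Prop) -> Prop) {FF : Filter F} (f : T -> C) (l : C) :
  tends F f l -> filterlim (fun x => Im (f x)) F (locally (Im l)).
Proof.
  intros H. apply filterlim_locally. intros eps.
  apply (filter_imp (fun x => Cmod (f x - l) < eps)); [ | apply H, cond_pos ].
  intros x Hx. eapply Rle_lt_trans; [ | apply Hx ].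
  apply (im_le_Cmod (f x - l)).
Qed.

Lemma tends_Re_Im {T : Type} (F : (T -> Prop) -> Prop) {FF : Filter F} (f : T -> C) (l : C) :
  filterlim (fun x => Re (f x)) F (locally (Re l)) ->
  filterlim (fun x => Im (f x)) F (locally (Im l)) -> tends F f l.
Proof.
  intros H1 H2 eps He.
  assert (He2 : 0 < eps / 2) by lra.
  pose proof (proj1 (filterlim_locally _ _) H1 (mkposreal _ He2)) as K1.
  pose proof (proj1 (filterlim_locally _ _) H2 (mkposreal _ He2)) as K2.
  generalize (filter_and _ _ K1 K2). apply filter_imp. intros x [A B].
  eapply Rle_lt_trans; [ apply Cmod_le_re_im | ].
  change (Rabs (Re (f x) - Re l) < eps / 2) in A.
  change (Rabs (Im (f x) - Im l) < eps / 2) in B.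
  change (Rabs (Re (f x) - Re l) + Rabs (Im (f x) - Im l) < eps). lra.
Qed.

Definition curve_deriv (c : R -> C) (t : R) (v : C) : Prop :=
  is_derive (fun u => Re (c u)) t (Re v) /\ is_derive (fun u => Im (c u)) t (Im v).

Lemma is_derive_eps (f : R -> R) (t l : R) :
  is_derive f t l <->
  (forall eps : R, 0 < eps -> exists d : R, 0 < d /\
    forall h : R, Rabs h < d -> Rabs (f (t + h) - f t - h * l) <= eps * Rabs h).
Proof.
  rewrite is_derive_Reals. split.
  - intros H eps He. destruct (H eps He) as (d & Hd).
    exists d. split; [ apply cond_pos | ]. intros h Hh.
    destruct (Req_dec h 0) as [-> | Hh0].
    + rewrite Rplus_0_r. replace (f t - f t - 0 * l) with 0 by ring.
      rewrite Rabs_R0. lra.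
    + specialize (Hd h Hh0 Hh).
      replace (f (t + h) - f t - h * l) with (((f (t + h) - f t) / h - l) * h)
        by (field; assumption).
      rewrite Rabs_mult. apply Rmult_le_compat_r; [ apply Rabs_pos | lra ].
  - intros H eps He. destruct (H (eps / 2) ltac:(lra)) as (d & Hd & HH).
    exists (mkposreal d Hd). intros h Hh0 Hh. specialize (HH h Hh).
    replace (f (t + h) - f t - h * l) with (((f (t + h) - f t) / h - l) * h) in HH
      by (field; assumption).
    rewrite Rabs_mult in HH. apply Rmult_le_reg_r in HH; [ lra | ].
    now apply Rabs_pos_lt.
Qed.

(** The bridge between derivatives of components, on which real integration
    works, and the complex form needed for the chain rule. *)
Lemma curve_deriv_eps (c : R -> C) (t : R) (v : C) :
  curve_deriv c t v <->
  (forall eps : R, 0 < eps -> exists d : R, 0 < d /\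
    forall h : R, Rabs h < d -> Cmod (c (t + h)%R - c t - h * v) <= eps * Rabs h).
Proof.
  assert (Hre : forall h, Re (c (t + h)%R - c t - h * v)%C
                = Re (c (t + h)) - Re (c t) - h * Re v).
  { intros h. unfold Re; simpl. ring. }
  assert (Him : forall h, Im (c (t + h)%R - c t - h * v)%C
                = Im (c (t + h)) - Im (c t) - h * Im v).
  { intros h. unfold Im; simpl. ring. }
  unfold curve_deriv. rewrite !is_derive_eps. split.
  - intros [H1 H2] eps He.
    destruct (H1 (eps / 2) ltac:(lra)) as (d1 & Hd1 & K1).
    destruct (H2 (eps / 2) ltac:(lra)) as (d2 & Hd2 & K2).
    exists (Rmin d1 d2). split; [ now apply Rmin_pos | ]. intros h Hh.
    eapply Rle_trans; [ apply Cmod_le_re_im | ]. rewrite Hre, Him.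
    specialize (K1 h (Rlt_le_trans _ _ _ Hh (Rmin_l _ _))).
    specialize (K2 h (Rlt_le_trans _ _ _ Hh (Rmin_r _ _))). lra.
  - intros H. split; intros eps He; destruct (H eps He) as (d & Hd & K);
      exists d; (split; [ assumption | intros h Hh; specialize (K h Hh) ]).
    + rewrite <- Hre. eapply Rle_trans; [ apply re_le_Cmod | exact K ].
    + rewrite <- Him. eapply Rle_trans; [ apply im_le_Cmod | exact K ].
Qed.

(** Chain rule for a holomorphic function along a differentiable curve. *)
Lemma curve_deriv_comp (P : C -> C) (c : R -> C) (t : R) (l v : C) :
  strict_deriv P (c t) l -> curve_deriv c t v ->
  curve_deriv (fun u => P (c u)) t (l * v)%C.
Proof.
  rewrite !curve_deriv_eps. intros (K & e & He & HK & HP) Hc eps Heps.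
  pose proof (Cmod_ge_0 l). pose proof (Cmod_ge_0 v).
  destruct (Hc 1 Rlt_0_1) as (d1 & Hd1 & H1).
  set (e2 := eps / (2 * (Cmod l + 1))).
  assert (He2 : 0 < e2) by (apply Rdiv_lt_0_compat; lra).
  destruct (Hc e2 He2) as (d2 & Hd2 & H2).
  set (V := Cmod v + 1).
  set (d3 := eps / (2 * (K * V * V + 1))).
  assert (HKV : 0 <= K * V * V) by (unfold V; repeat apply Rmult_le_pos; lra).
  assert (Hd3 : 0 < d3) by (apply Rdiv_lt_0_compat; lra).
  assert (HeV : 0 < e / V) by (apply Rdiv_lt_0_compat; unfold V; lra).
  exists (Rmin (Rmin d1 d2) (Rmin d3 (e / V))).
  split; [ repeat apply Rmin_pos; assumption | ]. intros h Hh.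
  assert (Hm : Rabs h < d1 /\ Rabs h < d2 /\ Rabs h < d3 /\ Rabs h < e / V).
  { pose proof (Rmin_l (Rmin d1 d2) (Rmin d3 (e / V))).
    pose proof (Rmin_r (Rmin d1 d2) (Rmin d3 (e / V))).
    pose proof (Rmin_l d1 d2). pose proof (Rmin_r d1 d2).
    pose proof (Rmin_l d3 (e / V)). pose proof (Rmin_r d3 (e / V)). lra. }
  destruct Hm as (B1 & B2 & B3 & B4).
  specialize (H1 h B1). specialize (H2 h B2).
  pose proof (Rabs_pos h).
  assert (Hdist : Cmod (c (t + h)%R - c t) <= V * Rabs h).
  { replace (c (t + h)%R - c t)%C with ((c (t + h)%R - c t - h * v) + h * v)%C by ring.
    eapply Rle_trans; [ apply Cmod_triangle | ]. rewrite Cmod_mult, Cmod_R.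
    unfold V. lra. }
  assert (V * Rabs h < e).
  { apply Rlt_le_trans with (V * (e / V)).
    - apply Rmult_lt_compat_l; [ unfold V; lra | assumption ].
    - right. field. unfold V; lra. }
  assert (E0 : Cmod (c t - c t) = 0)
    by (replace (c t - c t)%C with (RtoC 0) by ring; apply Cmod_0).
  specialize (HP (c (t + h)) (c t) ltac:(lra) ltac:(lra)).
  rewrite E0, Rplus_0_r in HP.
  replace (P (c (t + h)%R) - P (c t) - h * (l * v))%C with
    ((P (c (t + h)%R) - P (c t) - l * (c (t + h)%R - c t))
     + l * (c (t + h)%R - c t - h * v))%C by ring.
  eapply Rle_trans; [ apply Cmod_triangle | ]. rewrite Cmod_mult.
  pose proof (Cmod_ge_0 (c (t + h)%R - c t)).
  assert (Q1 : K * Cmod (c (t + h)%R - c t) * Cmod (c (t + h)%R - c t)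
     <= eps / 2 * Rabs h).
  { apply Rle_trans with (K * (V * Rabs h) * (V * Rabs h)).
    - apply Rmult_le_compat; [ now apply Rmult_le_pos | assumption | | assumption ].
      now apply Rmult_le_compat_l.
    - replace (K * (V * Rabs h) * (V * Rabs h)) with (K * V * V * Rabs h * Rabs h) by ring.
      apply Rmult_le_compat_r; [ assumption | ].
      apply Rle_trans with ((K * V * V + 1) * d3).
      + apply Rmult_le_compat; lra.
      + right. unfold d3. field. lra. }
  assert (Q2 : Cmod l * Cmod (c (t + h)%R - c t - h * v) <= eps / 2 * Rabs h).
  { apply Rle_trans with ((Cmod l + 1) * (e2 * Rabs h)).
    - apply Rmult_le_compat; try lra. apply Cmod_ge_0.
    - right. unfold e2. field. lra. }
  lra.
Qed.

Lemma curve_deriv_tends (c : R -> C) (t : R) (v : C) :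
  curve_deriv c t v -> tends (locally t) c (c t).
Proof.
  intros [H1 H2]. apply tends_Re_Im; [ typeclasses eauto | | ].
  - apply (ex_derive_continuous (fun u => Re (c u))). eexists; eassumption.
  - apply (ex_derive_continuous (fun u => Im (c u))). eexists; eassumption.
Qed.

Lemma curve_deriv_line (z : C) (t : R) : curve_deriv (fun u => RtoC u * z)%C t z.
Proof.
  split; unfold Re, Im; simpl; auto_derive; auto; ring.
Qed.

Lemma curve_deriv_mult_const (c : R -> C) (t : R) (v z : C) :
  curve_deriv c t v -> curve_deriv (fun u => c u * z)%C t (v * z)%C.
Proof.
  intros H. replace (v * z)%C with (z * v)%C by ring.
  apply (curve_deriv_comp (fun x => x * z)%C).
  - replace z with (1 * z + c t * 0)%C at 1 by ring.
    apply (strict_deriv_mult (fun x => x) (fun _ => z));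
      [ apply strict_deriv_id | apply strict_deriv_const ].
  - exact H.
Qed.

(** Componentwise, so that the real theorems on parametric integrals and on the
    fundamental theorem of calculus apply directly. *)
Definition CInt (f : R -> C) (a b : R) : C :=
  (RInt (fun t => Re (f t)) a b, RInt (fun t => Im (f t)) a b).

Lemma CInt_ext (f g : R -> C) (a b : R) :
  (forall t, Rmin a b < t < Rmax a b -> f t = g t) -> CInt f a b = CInt g a b.
Proof.
  intros H. unfold CInt. f_equal; apply RInt_ext; intros t Ht; now rewrite (H t Ht).
Qed.

Definition continuous_along (T : R) (f : R -> C) : Prop :=
  forall t, 0 <= t <= T -> tends (locally t) f (f t).

Lemma continuous_along_mult (T : R) (f h : R -> C) :
  continuous_along T f -> continuous_along T h ->
  continuous_along T (fun t => f t * h t)%C.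
Proof. intros H1 H2 t Ht. apply tends_mult; [ typeclasses eauto | auto | auto ]. Qed.

Lemma tends_const {X : Type} (F : (X -> Prop) -> Prop) {FF : Filter F} (z : C) :
  tends F (fun _ => z) z.
Proof.
  intros eps He. apply filter_forall. intros _.
  replace (z - z)%C with (RtoC 0) by ring. now rewrite Cmod_0.
Qed.

Lemma continuous_along_const (T : R) (z : C) : continuous_along T (fun _ => z).
Proof. intros t _. apply tends_const. typeclasses eauto. Qed.

Lemma tends_plus {X : Type} (F : (X -> Prop) -> Prop) {FF : Filter F}
    (f g : X -> C) (l m : C) :
  tends F f l -> tends F g m -> tends F (fun x => f x + g x)%C (l + m)%C.
Proof.
  intros Hf Hg eps He.
  assert (He2 : 0 < eps / 2) by lra.
  generalize (filter_and _ _ (Hf _ He2) (Hg _ He2)).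
  apply filter_imp. intros x [A B].
  replace (f x + g x - (l + m))%C with ((f x - l) + (g x - m))%C by ring.
  eapply Rle_lt_trans; [ apply Cmod_triangle | lra ].
Qed.

Lemma continuous_along_plus (T : R) (f h : R -> C) :
  continuous_along T f -> continuous_along T h ->
  continuous_along T (fun t => f t + h t)%C.
Proof. intros H1 H2 t Ht. apply tends_plus; [ typeclasses eauto | auto | auto ]. Qed.

Lemma continuous_along_comp (T : R) (f df : C -> C) (O : C -> Prop) (h : R -> C) :
  holomorphic O f df -> (forall t, 0 <= t <= T -> O (h t)) ->
  continuous_along T h -> continuous_along T (fun t => f (h t)).
Proof.
  intros Hf HO Hh t Ht.
  eapply tends_comp; [ typeclasses eauto | apply Hh, Ht | ].
  eapply strict_deriv_continuous. apply Hf. auto.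
Qed.

Lemma continuous_along_ex_RInt (T : R) (f : R -> C) :
  0 <= T -> continuous_along T f ->
  ex_RInt (fun t => Re (f t)) 0 T /\ ex_RInt (fun t => Im (f t)) 0 T.
Proof.
  intros HT H.
  split; apply (ex_RInt_continuous (V := R_CompleteNormedModule));
    rewrite Rmin_left, Rmax_right by assumption; intros t Ht.
  - apply (tends_Re (locally t) f), H, Ht.
  - apply (tends_Im (locally t) f), H, Ht.
Qed.

Lemma CInt_plus (T : R) (f h : R -> C) :
  0 <= T -> continuous_along T f -> continuous_along T h ->
  CInt (fun t => f t + h t)%C 0 T = (CInt f 0 T + CInt h 0 T)%C.
Proof.
  intros HT Hf Hh.
  destruct (continuous_along_ex_RInt T f HT Hf) as [F1 F2].
  destruct (continuous_along_ex_RInt T h HT Hh) as [H1 H2].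
  unfold CInt, Cplus; simpl.
  f_equal; apply (RInt_plus (V := R_CompleteNormedModule)); assumption.
Qed.

Lemma CInt_scal (T : R) (z : C) (f : R -> C) :
  0 <= T -> continuous_along T f ->
  CInt (fun t => z * f t)%C 0 T = (z * CInt f 0 T)%C.
Proof.
  intros HT Hf.
  destruct (continuous_along_ex_RInt T f HT Hf) as [F1 F2].
  apply injective_projections; simpl.
  - etransitivity;
      [ | apply f_equal2; apply (RInt_scal (V := R_CompleteNormedModule)); eassumption ].
    apply (RInt_minus (V := R_CompleteNormedModule) (fun t => scal (fst z) (Re (f t)))
             (fun t => scal (snd z) (Im (f t))));
      now apply (ex_RInt_scal (V := R_CompleteNormedModule)).
  - etransitivity;
      [ | apply f_equal2; apply (RInt_scal (V := R_CompleteNormedModule)); eassumption ].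
    apply (RInt_plus (V := R_CompleteNormedModule) (fun t => scal (fst z) (Im (f t)))
             (fun t => scal (snd z) (Re (f t))));
      now apply (ex_RInt_scal (V := R_CompleteNormedModule)).
Qed.

(** The factor 2 comes from bounding the two components separately; only the
    order of magnitude of integrals matters below. *)
Lemma CInt_bound (T : R) (f : R -> C) (phi : R -> R) (I : R) :
  0 <= T -> continuous_along T f ->
  (forall t, 0 <= t <= T -> Cmod (f t) <= phi t) -> is_RInt phi 0 T I ->
  Cmod (CInt f 0 T) <= 2 * I.
Proof.
  intros HT Hf Hb HI.
  destruct (continuous_along_ex_RInt T f HT Hf) as [F1 F2].
  eapply Rle_trans; [ apply Cmod_le_re_im | ].
  assert (B1 : Rabs (RInt (fun t => Re (f t)) 0 T) <= I).
  { apply (norm_RInt_le (V := R_NormedModule) (fun t => Re (f t)) phi 0 T); auto.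
    - intros t Ht. eapply Rle_trans; [ apply re_le_Cmod | now apply Hb ].
    - now apply (RInt_correct (V := R_CompleteNormedModule)). }
  assert (B2 : Rabs (RInt (fun t => Im (f t)) 0 T) <= I).
  { apply (norm_RInt_le (V := R_NormedModule) (fun t => Im (f t)) phi 0 T); auto.
    - intros t Ht. eapply Rle_trans; [ apply im_le_Cmod | now apply Hb ].
    - now apply (RInt_correct (V := R_CompleteNormedModule)). }
  unfold CInt, Re, Im in *; simpl. lra.
Qed.

(** * Invariance of contour integrals under scaling *)

Section Scaling.

Variables (O : C -> Prop) (P dP : C -> C) (g dg q : R -> C) (b T : R).
Hypothesis O_open : is_open O.
Hypothesis P_hol : holomorphic O P dP.
Hypothesis g_deriv : forall t, curve_deriv g t (dg t).
Hypothesis dg_cont : forall t, tends (locally t) dg (dg t).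
Hypothesis q_cont : forall t, tends (locally t) q (q t).
Hypothesis q_log : forall t, (g t * q t = dg t)%C.
Hypothesis T_pos : 0 < T.
Hypothesis g_in : forall s t, 0 < s < b -> 0 <= t <= T -> O (RtoC s * g t)%C.

Lemma scaled_curve_deriv (s t : R) :
  O (RtoC s * g t)%C ->
  curve_deriv (fun v => P (RtoC s * g v)%C) t (RtoC s * (dP (RtoC s * g t)%C * dg t))%C.
Proof.
  intros Ho.
  replace (RtoC s * (dP (RtoC s * g t)%C * dg t))%C
    with (dP (RtoC s * g t)%C * (dg t * RtoC s))%C by ring.
  apply (curve_deriv_comp P (fun v => RtoC s * g v)%C); [ now apply P_hol | ].
  pose proof (curve_deriv_mult_const g t (dg t) (RtoC s) (g_deriv t)) as H.
  destruct H as [H1 H2]. split; eapply is_derive_ext; try eassumption;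
    intros u; cbv beta; now rewrite Cmult_comm.
Qed.

Lemma integrand_deriv (s t : R) :
  O (RtoC s * g t)%C ->
  curve_deriv (fun u => P (RtoC u * g t) * q t)%C s (dP (RtoC s * g t)%C * dg t)%C.
Proof.
  intros Ho. rewrite <- q_log.
  replace (dP (RtoC s * g t) * (g t * q t))%C with (dP (RtoC s * g t)%C * g t * q t)%C by ring.
  apply curve_deriv_mult_const.
  apply (curve_deriv_comp P (fun u => RtoC u * g t)%C); [ now apply P_hol | ].
  apply curve_deriv_line.
Qed.

Lemma scaled_tends (s t : R) :
  tends (locally (s, t)) (fun p : R * R => RtoC (fst p) * g (snd p))%C (RtoC s * g t)%C.
Proof.
  apply tends_mult; [ typeclasses eauto | | ].
  - intros eps He. exists (mkposreal eps He). intros [u v] [Hu _].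
    simpl. rewrite <- RtoC_minus, Cmod_R. exact Hu.
  - intros eps He. destruct (curve_deriv_tends _ _ _ (g_deriv t) eps He) as (d & Hd).
    exists d. intros [u v] [_ Hv]. now apply Hd.
Qed.

Lemma scaled_near (s t : R) :
  O (RtoC s * g t)%C -> locally (s, t) (fun p : R * R => O (RtoC (fst p) * g (snd p))%C).
Proof.
  intros Ho. destruct (O_open _ Ho) as (d & Hd & H).
  generalize (scaled_tends s t d Hd). apply filter_imp. auto.
Qed.

Lemma deriv_tends (s t : R) :
  O (RtoC s * g t)%C ->
  tends (locally (s, t)) (fun p : R * R => dP (RtoC (fst p) * g (snd p)) * dg (snd p))%C
        (dP (RtoC s * g t) * dg t)%C.
Proof.
  intros Ho. apply tends_mult; [ typeclasses eauto | | ].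
  - eapply tends_comp; [ typeclasses eauto | apply scaled_tends | ].
    now apply holomorphic_deriv_continuous with O P.
  - intros eps He. destruct (dg_cont t eps He) as (d & Hd).
    exists d. intros [u v] [_ Hv]. now apply Hd.
Qed.

Lemma slice_tends (f : R * R -> C) (s t : R) (l : C) :
  tends (locally (s, t)) f l -> tends (locally t) (fun v => f (s, v)) l.
Proof.
  intros H eps He. destruct (H eps He) as (d & Hd). exists d.
  intros v Hv. apply Hd. split; [ apply ball_center | exact Hv ].
Qed.

Lemma integrand_tends (s t : R) :
  O (RtoC s * g t)%C -> tends (locally t) (fun v => P (RtoC s * g v) * q v)%C
    (P (RtoC s * g t) * q t)%C.
Proof.
  intros Ho. apply tends_mult; [ typeclasses eauto | | apply q_cont ].
  eapply tends_comp with (f := fun v => (RtoC s * g v)%C);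
    [ typeclasses eauto | | eapply strict_deriv_continuous; now apply P_hol ].
  apply (slice_tends (fun p => RtoC (fst p) * g (snd p))%C), scaled_tends.
Qed.

Lemma scaling_interval (s : R) : 0 < s < b -> locally s (fun u => 0 < u < b).
Proof.
  intros Hs. apply filter_and; [ apply (open_gt 0) | apply (open_lt b) ]; lra.
Qed.

(** With [g * q = dg], both d/ds (P (s g) q) and (1/s) d/dt (P (s g)) equal
    P'(s g) g'. So the derivative of the integral is (1/s) times the increment
    of P (s g) along the curve, which vanishes when the curve is closed. *)
Lemma component_constant (pr : C -> R) (Hpr : pr = Re \/ pr = Im) :
  g T = g 0 ->
  forall s, 0 < s < b ->
  is_derive (fun u => RInt (fun t => pr (P (RtoC u * g t) * q t)%C) 0 T) s 0.
Proof.
  intros Hclosed s Hs.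
  assert (Hmm : Rmin 0 T = 0 /\ Rmax 0 T = T)
    by (split; [ apply Rmin_left | apply Rmax_right ]; lra).
  destruct Hmm as [Hmin Hmax].
  assert (Hd : forall u t, O (RtoC u * g t)%C ->
    is_derive (fun w => pr (P (RtoC w * g t) * q t)%C) u
              (pr (dP (RtoC u * g t) * dg t)%C)).
  { intros u t Ho. destruct (integrand_deriv u t Ho) as [H1 H2].
    destruct Hpr as [-> | ->]; assumption. }
  assert (Hlim : forall (X : Type) (F : (X -> Prop) -> Prop), Filter F ->
     forall f l, tends F f l -> filterlim (fun x => pr (f x)) F (locally (pr l))).
  { intros X F FF f l. destruct Hpr as [-> | ->];
      [ now apply tends_Re | now apply tends_Im ]. }
  assert (Hzero : RInt (fun t => Derive (fun u => pr (P (RtoC u * g t) * q t)%C) s) 0 T = 0).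
  { rewrite (RInt_ext _ (fun t => / s * (s * pr (dP (RtoC s * g t) * dg t)%C))).
    2: { intros t Ht. rewrite Hmin, Hmax in Ht.
         etransitivity; [ apply is_derive_unique, Hd, g_in; lra | ].
         match goal with |- ?x = ?y => change (@eq R x y) end. field. lra. }
    assert (HI : is_RInt (fun t => s * pr (dP (RtoC s * g t) * dg t)%C) 0 T 0).
    { replace 0 with (minus (pr (P (RtoC s * g T)%C)) (pr (P (RtoC s * g 0)%C))) at 2
        by (rewrite Hclosed; apply (minus_eq_zero (G := R_AbelianGroup))).
      apply (is_RInt_derive (fun t => pr (P (RtoC s * g t)%C))); rewrite Hmin, Hmax; intros t Ht.
      - destruct (scaled_curve_deriv s t (g_in s t Hs Ht)) as [H1 H2].
        destruct Hpr as [-> | ->].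
        + replace (s * Re (dP (RtoC s * g t) * dg t)%C) with
            (Re (RtoC s * (dP (RtoC s * g t) * dg t))%C); [ exact H1 | ].
          unfold Re; simpl. ring.
        + replace (s * Im (dP (RtoC s * g t) * dg t)%C) with
            (Im (RtoC s * (dP (RtoC s * g t) * dg t))%C); [ exact H2 | ].
          unfold Im; simpl. ring.
      - apply (continuous_scal_r s (fun t => pr (dP (RtoC s * g t) * dg t)%C)).
        apply Hlim; [ typeclasses eauto | ].
        apply (slice_tends (fun p => dP (RtoC (fst p) * g (snd p)) * dg (snd p))%C).
        apply deriv_tends. now apply g_in. }
    apply is_RInt_unique.
    replace 0 with (/ s * 0) at 2 by ring.
    now apply (is_RInt_scal (V := R_NormedModule)). }
  eapply (eq_rect _ (fun l => is_derive _ s l)); [ | exact Hzero ].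
  apply (is_derive_RInt_param (fun u t => pr (P (RtoC u * g t) * q t)%C)).
  - generalize (scaling_interval s Hs). apply filter_imp.
    intros u Hu t Ht. rewrite Hmin, Hmax in Ht.
    eexists. apply Hd. now apply g_in.
  - intros t Ht. rewrite Hmin, Hmax in Ht.
    pose proof (g_in s t Hs Ht) as Ho.
    apply continuity_2d_pt_ext_loc with (fun u v => pr (dP (RtoC u * g v) * dg v)%C).
    + apply locally_2d_locally.
      generalize (scaled_near s t Ho). apply filter_imp. intros [u v] Huv.
      symmetry. apply is_derive_unique. now apply Hd.
    + apply continuity_2d_pt_filterlim.
      apply (Hlim _ (locally (s, t)) _
        (fun p : R * R => dP (RtoC (fst p) * g (snd p)) * dg (snd p))%C).
      now apply deriv_tends.
  - generalize (scaling_interval s Hs). apply filter_imp. intros u Hu.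
    apply (ex_RInt_continuous (V := R_CompleteNormedModule)).
    rewrite Hmin, Hmax. intros t Ht.
    apply Hlim; [ typeclasses eauto | ]. apply integrand_tends. now apply g_in.
Qed.

(** Cauchy's theorem for the homotheties of a closed curve; for [P z = z F z] it
    says that the integral of F(z) dz over s g does not depend on s. *)
Lemma integral_scaling_invariant :
  g T = g 0 ->
  forall s1 s2, 0 < s1 -> s1 <= s2 -> s2 < b ->
  CInt (fun t => P (RtoC s1 * g t) * q t)%C 0 T
  = CInt (fun t => P (RtoC s2 * g t) * q t)%C 0 T.
Proof.
  intros Hc s1 s2 H1 H12 H2.
  destruct (Rle_lt_or_eq_dec _ _ H12) as [Hlt | <-]; [ | reflexivity ].
  unfold CInt. f_equal.
  - apply (eq_is_derive (V := R_NormedModule)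
       (fun u => RInt (fun t => Re (P (RtoC u * g t) * q t)%C) 0 T) s1 s2); auto.
    intros t Ht. apply (component_constant Re); auto. lra.
  - apply (eq_is_derive (V := R_NormedModule)
       (fun u => RInt (fun t => Im (P (RtoC u * g t) * q t)%C) 0 T) s1 s2); auto.
    intros t Ht. apply (component_constant Im); auto. lra.
Qed.

End Scaling.

(** * Coefficients as integrals over star-shaped curves *)

Section Polar.

Variables a c : R.
Hypothesis c_ge0 : 0 <= c.
Hypothesis c_lt_a : c < a.

(** On [0, 2 pi] the factor sin(t/2) is smooth, vanishes only at the two ends,
    where the curve crosses the positive axis, and is comparable to the angle to
    that axis; [c = 0] gives circles. *)
Definition radius (t : R) : R := a + c * sin (t / 2).
Definition polar (t : R) : C := (radius t * cos t, radius t * sin t).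
(** The logarithmic derivative of [polar], that is (radius'/radius) + i. *)
Definition polar_log (t : R) : C := (c / 2 * cos (t / 2) / radius t, 1).

Lemma radius_pos (t : R) : 0 < radius t.
Proof. unfold radius. pose proof (SIN_bound (t / 2)). nra. Qed.

Lemma polar_deriv (t : R) : curve_deriv polar t (polar t * polar_log t)%C.
Proof.
  pose proof (radius_pos t) as Hr. unfold radius in Hr.
  split; unfold polar, polar_log, radius, Re, Im; simpl; auto_derive; auto.
  all: change (t * / 2) with (t / 2); field; lra.
Qed.

Lemma continuous_pair (f1 f2 : R -> R) (t : R) :
  continuous f1 t -> continuous f2 t ->
  tends (locally t) (fun u => (f1 u, f2 u)) (f1 t, f2 t).
Proof.
  intros H1 H2. apply tends_Re_Im; [ typeclasses eauto | exact H1 | exact H2 ].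
Qed.

Lemma polar_log_cont (t : R) : tends (locally t) polar_log (polar_log t).
Proof.
  pose proof (radius_pos t) as Hr. unfold radius in Hr.
  apply (continuous_pair (fun t => c / 2 * cos (t / 2) / radius t) (fun _ => 1)).
  - apply (ex_derive_continuous (fun t => c / 2 * cos (t / 2) / radius t)).
    unfold radius. auto_derive. change (t * / 2) with (t / 2). lra.
  - apply continuous_const.
Qed.

Lemma polar_cont (t : R) : tends (locally t) polar (polar t).
Proof. eapply curve_deriv_tends, polar_deriv. Qed.

Lemma polar_closed : polar (2 * PI) = polar 0.
Proof.
  unfold polar, radius. rewrite cos_2PI, sin_2PI, cos_0, sin_0.
  replace (2 * PI / 2) with PI by field. replace (0 / 2) with 0 by field.
  now rewrite sin_PI, sin_0.
Qed.

Lemma Cmod_polar (t : R) : Cmod (polar t) = radius t.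
Proof.
  pose proof (radius_pos t) as Hr.
  unfold polar, Cmod; simpl fst; simpl snd.
  replace ((radius t * cos t) ^ 2 + (radius t * sin t) ^ 2) with (Rsqr (radius t)).
  - apply sqrt_Rsqr. lra.
  - pose proof (sin2_cos2 t) as E. unfold Rsqr in *.
    transitivity (radius t * radius t * (sin t * sin t + cos t * cos t));
      [ rewrite E; ring | ring ].
Qed.

Lemma polar_neq0 (t : R) : polar t <> 0.
Proof. apply Cmod_gt_0. rewrite Cmod_polar. apply radius_pos. Qed.

(** The logarithm of the radius returns to its initial value and the argument
    increases by 2 pi, so the value is 2 pi i. *)
Lemma CInt_polar_log : CInt polar_log 0 (2 * PI) = (0, 2 * PI).
Proof.
  unfold CInt, polar_log, Re, Im; simpl. f_equal.
  - apply is_RInt_unique.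
    replace 0 with (minus (ln (radius (2 * PI))) (ln (radius 0))) at 2.
    2: { unfold radius. replace (2 * PI / 2) with PI by field.
         replace (0 / 2) with 0 by field. rewrite sin_PI, sin_0.
         apply (minus_eq_zero (G := R_AbelianGroup)). }
    apply (is_RInt_derive (fun t => ln (radius t))); intros t _;
      pose proof (radius_pos t) as Hr; unfold radius in *.
    + auto_derive; change (t * / 2) with (t / 2); [ lra | field; lra ].
    + apply (ex_derive_continuous (fun t => c / 2 * cos (t / 2) / (a + c * sin (t / 2)))).
      auto_derive. change (t * / 2) with (t / 2). lra.
  - rewrite RInt_const. unfold scal; simpl; unfold mult; simpl. lra.
Qed.

Lemma radius_ge (t : R) : 0 <= t <= 2 * PI -> a <= radius t.
Proof.
  intros Ht. unfold radius.
  assert (0 <= sin (t / 2)) by (apply sin_ge_0; lra). nra.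
Qed.

Lemma Cmod_polar_log (t : R) : 0 <= t <= 2 * PI -> Cmod (polar_log t) <= c / a + 1.
Proof.
  intros Ht. eapply Rle_trans; [ apply Cmod_le_re_im | ].
  unfold polar_log, Re, Im; simpl. rewrite Rabs_R1.
  apply Rplus_le_compat_r.
  pose proof (radius_ge t Ht).
  unfold Rdiv at 1. rewrite Rabs_mult, (Rabs_pos_eq (/ radius t))
    by (apply Rlt_le, Rinv_0_lt_compat; lra).
  apply Rmult_le_compat.
  - apply Rabs_pos.
  - apply Rlt_le, Rinv_0_lt_compat; lra.
  - rewrite Rabs_mult, (Rabs_pos_eq (c / 2)) by lra.
    pose proof (COS_bound (t / 2)).
    assert (Rabs (cos (t / 2)) <= 1) by (apply Rabs_le; lra). nra.
  - apply Rinv_le_contravar; lra.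
Qed.

Lemma continuous_along_polar : continuous_along (2 * PI) polar.
Proof. intros t _. apply polar_cont. Qed.

Lemma continuous_along_polar_log : continuous_along (2 * PI) polar_log.
Proof. intros t _. apply polar_log_cont. Qed.

Variables (O : C -> Prop) (b : R).
Hypothesis O_open : is_open O.
Hypothesis b_gt1 : 1 < b.
Hypothesis curve_in : forall s t, 0 < s < b -> 0 <= t <= 2 * PI -> O (RtoC s * polar t)%C.

Let two_pi_pos : 0 < 2 * PI.
Proof. pose proof PI_RGT_0. lra. Qed.

Lemma polar_in (t : R) : 0 <= t <= 2 * PI -> O (polar t).
Proof.
  intros Ht. rewrite <- (Cmult_1_l (polar t)). apply curve_in; lra.
Qed.

(** The scaled integrals are all equal, and as the scale tends to 0 the integrand
    tends uniformly to [l * polar_log]. This is the residue theorem for P(z)/z. *)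
Lemma integral_eq_limit_at_0 (P dP : C -> C) (l : C) :
  holomorphic (fun z => O z /\ z <> 0) P dP ->
  (forall eps : R, 0 < eps -> near 0 (fun z => z <> 0 -> Cmod (P z - l) < eps)) ->
  CInt (fun t => P (polar t) * polar_log t)%C 0 (2 * PI) = (l * (0, 2 * PI)%R)%C.
Proof.
  intros HP Hl.
  set (O' := fun z => O z /\ z <> 0).
  assert (O'_open : is_open O') by now apply is_open_punctured.
  assert (curve_in' : forall s t, 0 < s < b -> 0 <= t <= 2 * PI -> O' (RtoC s * polar t)%C).
  { intros s t Hs Ht. split; [ now apply curve_in | ].
    apply Cmult_neq_0; [ | apply polar_neq0 ].
    intros E. apply RtoC_inj in E. lra. }
  assert (Hinv : forall s, 0 < s <= 1 ->
    CInt (fun t => P (polar t) * polar_log t)%C 0 (2 * PI)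
    = CInt (fun t => P (RtoC s * polar t) * polar_log t)%C 0 (2 * PI)).
  { intros s Hs. symmetry.
    rewrite (integral_scaling_invariant O' P dP polar (fun t => polar t * polar_log t)%C
       polar_log b (2 * PI)) with (s2 := 1); auto; try lra.
    - apply CInt_ext. intros t _. now rewrite Cmult_1_l.
    - apply polar_deriv.
    - intros t. apply tends_mult; [ typeclasses eauto | apply polar_cont | apply polar_log_cont ].
    - apply polar_log_cont.
    - apply polar_closed. }
  rewrite <- CInt_polar_log.
  rewrite <- CInt_scal by (try lra; apply continuous_along_polar_log).
  set (D := (CInt (fun t => P (polar t) * polar_log t)%C 0 (2 * PI)
     + (- (1)) * CInt (fun t => l * polar_log t)%C 0 (2 * PI))%C).
  assert (Dz : D = 0).
  { apply Cmod_eq_0.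
    destruct (Rle_lt_or_eq_dec 0 (Cmod D) (Cmod_ge_0 D)) as [Hlt | E]; [ exfalso | auto ].
    set (Q := c / a + 1).
    assert (HQ : 0 < Q).
    { unfold Q. assert (0 <= c / a) by (apply Rdiv_le_0_compat; lra). lra. }
    (* this accuracy would bound the modulus of D by half of itself *)
    set (eps := Cmod D / (8 * PI * Q)).
    assert (Hpi := PI_RGT_0).
    assert (He : 0 < eps).
    { apply Rdiv_lt_0_compat; [ assumption | ]. apply Rmult_lt_0_compat; lra. }
    destruct (Hl eps He) as (d & Hd & Hnear).
    (* the curve lies in the disc of radius a + c *)
    set (s := Rmin 1 (d / (2 * (a + c)))).
    assert (Hs : 0 < s <= 1).
    { split; [ apply Rmin_pos; [ lra | ] | apply Rmin_l ].
      apply Rdiv_lt_0_compat; lra. }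
    assert (Hcont : continuous_along (2 * PI) (fun t => P (RtoC s * polar t))%C).
    { apply (continuous_along_comp (2 * PI) P dP O' (fun t => RtoC s * polar t)%C HP).
      - intros t Ht. apply curve_in'; lra.
      - apply continuous_along_mult;
          [ apply continuous_along_const | apply continuous_along_polar ]. }
    assert (ED : D = CInt (fun t => (P (RtoC s * polar t) + - (1) * l) * polar_log t)%C 0 (2 * PI)).
    { unfold D. rewrite (Hinv s Hs).
      rewrite <- (CInt_scal _ (- (1))%C).
      2: lra.
      2: { apply continuous_along_mult;
             [ apply continuous_along_const | apply continuous_along_polar_log ]. }
      rewrite <- CInt_plus.
      - apply CInt_ext. intros t _. ring.
      - lra.
      - apply continuous_along_mult; [ exact Hcont | apply continuous_along_polar_log ].
      - repeat apply continuous_along_mult;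
          try apply continuous_along_const; apply continuous_along_polar_log. }
    assert (HB : Cmod D <= 2 * ((2 * PI - 0) * (eps * Q))).
    { rewrite ED.
      apply (CInt_bound (2 * PI) _ (fun _ => eps * Q)).
      - lra.
      - apply continuous_along_mult; [ | apply continuous_along_polar_log ].
        apply continuous_along_plus; [ exact Hcont | apply continuous_along_const ].
      - intros t Ht. rewrite Cmod_mult.
        apply Rmult_le_compat; try apply Cmod_ge_0; [ | now apply Cmod_polar_log ].
        replace (P (RtoC s * polar t) + - (1) * l)%C with (P (RtoC s * polar t) - l)%C by ring.
        apply Rlt_le, Hnear; [ | apply curve_in'; lra ].
        replace (RtoC s * polar t - 0)%C with (RtoC s * polar t)%C by ring.
        rewrite Cmod_mult, Cmod_R, Cmod_polar, Rabs_pos_eq by lra.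
        apply Rle_lt_trans with (d / (2 * (a + c)) * (a + c)).
        + apply Rmult_le_compat; [ lra | apply Rlt_le, radius_pos | apply Rmin_r | ].
          unfold radius. pose proof (SIN_bound (t / 2)). nra.
        + replace (d / (2 * (a + c)) * (a + c)) with (d / 2) by (field; lra). lra.
      - apply (is_RInt_const (V := R_NormedModule)). }
    assert (2 * ((2 * PI - 0) * (eps * Q)) = Cmod D / 2).
    { unfold eps. field. split; lra. }
    lra. }
  unfold D in Dz.
  replace (CInt (fun t => P (polar t) * polar_log t)%C 0 (2 * PI)) with
    (CInt (fun t => P (polar t) * polar_log t)%C 0 (2 * PI)
     + (- (1)) * CInt (fun t => l * polar_log t)%C 0 (2 * PI)
     + CInt (fun t => l * polar_log t)%C 0 (2 * PI))%C by ring.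
  rewrite Dz. ring.
Qed.

(** The fundamental theorem of calculus on a closed curve. *)
Lemma integral_deriv_eq_0 (H dH : C -> C) :
  holomorphic (fun z => O z /\ z <> 0) H dH ->
  CInt (fun t => dH (polar t) * (polar t * polar_log t))%C 0 (2 * PI) = 0.
Proof.
  intros HH.
  assert (O'_open := is_open_punctured O O_open).
  assert (Hd : forall t, 0 <= t <= 2 * PI ->
    curve_deriv (fun u => H (polar u)) t (dH (polar t) * (polar t * polar_log t))%C).
  { intros t Ht. apply curve_deriv_comp; [ | apply polar_deriv ].
    apply HH. split; [ now apply polar_in | apply polar_neq0 ]. }
  assert (Hc : forall t, 0 <= t <= 2 * PI ->
    tends (locally t) (fun t => dH (polar t) * (polar t * polar_log t))%C
       (dH (polar t) * (polar t * polar_log t))%C).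
  { intros t Ht. apply tends_mult; [ typeclasses eauto | | ].
    - eapply tends_comp; [ typeclasses eauto | apply polar_cont | ].
      apply (holomorphic_deriv_continuous (fun z => O z /\ z <> 0) H); auto.
      split; [ now apply polar_in | apply polar_neq0 ].
    - apply tends_mult; [ typeclasses eauto | apply polar_cont | apply polar_log_cont ]. }
  assert (Hmm : Rmin 0 (2 * PI) = 0 /\ Rmax 0 (2 * PI) = 2 * PI)
    by (split; [ apply Rmin_left | apply Rmax_right ]; lra).
  destruct Hmm as [Hmin Hmax].
  unfold CInt, RtoC. f_equal; apply is_RInt_unique.
  - replace 0 with (minus (Re (H (polar (2 * PI)))) (Re (H (polar 0)))) at 2
      by (rewrite polar_closed; apply (minus_eq_zero (G := R_AbelianGroup))).
    apply (is_RInt_derive (fun t => Re (H (polar t)))); rewrite Hmin, Hmax; intros t Ht.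
    + apply (Hd t Ht).
    + apply (tends_Re (locally t) (fun t => dH (polar t) * (polar t * polar_log t))%C), Hc, Ht.
  - replace 0 with (minus (Im (H (polar (2 * PI)))) (Im (H (polar 0)))) at 2
      by (rewrite polar_closed; apply (minus_eq_zero (G := R_AbelianGroup))).
    apply (is_RInt_derive (fun t => Im (H (polar t)))); rewrite Hmin, Hmax; intros t Ht.
    + apply (Hd t Ht).
    + apply (tends_Im (locally t) (fun t => dH (polar t) * (polar t * polar_log t))%C), Hc, Ht.
Qed.

(** Cauchy's integral for the [n]-th Taylor coefficient, without the factor
    1/(2 pi i). *)
Definition coef (n : nat) (f : C -> C) : C :=
  CInt (fun t => f (polar t) * ((/ polar t) ^ n * polar_log t))%C 0 (2 * PI).

Lemma continuous_along_kernel (n : nat) :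
  continuous_along (2 * PI) (fun t => (/ polar t) ^ n * polar_log t)%C.
Proof.
  apply continuous_along_mult; [ | apply continuous_along_polar_log ].
  apply (continuous_along_comp (2 * PI) (fun z => (/ z) ^ n)%C
     (fun z => - INR n * (/ z) ^ S n)%C (fun z => z <> 0)).
  - intros z Hz. now apply strict_deriv_inv_pow.
  - intros t _. apply polar_neq0.
  - apply continuous_along_polar.
Qed.

Lemma continuous_along_integrand (n : nat) (f df : C -> C) :
  holomorphic O f df ->
  continuous_along (2 * PI) (fun t => f (polar t) * ((/ polar t) ^ n * polar_log t))%C.
Proof.
  intros Hf. apply continuous_along_mult; [ | apply continuous_along_kernel ].
  eapply continuous_along_comp; [ apply Hf | apply polar_in | apply continuous_along_polar ].
Qed.

Lemma coef_plus (n : nat) (f df h dh : C -> C) :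
  holomorphic O f df -> holomorphic O h dh ->
  coef n (fun z => f z + h z)%C = (coef n f + coef n h)%C.
Proof.
  intros Hf Hh. unfold coef.
  rewrite <- CInt_plus; try lra; try (eapply continuous_along_integrand; eassumption).
  apply CInt_ext. intros t _. ring.
Qed.

Lemma coef_scal (n : nat) (z : C) (f df : C -> C) :
  holomorphic O f df -> coef n (fun x => z * f x)%C = (z * coef n f)%C.
Proof.
  intros Hf. unfold coef.
  rewrite <- CInt_scal; try lra; try (eapply continuous_along_integrand; eassumption).
  apply CInt_ext. intros t _. ring.
Qed.

(** For k < n the integrand z^(k-n-1) dz has a primitive off the origin. *)
Lemma coef_lower_power (n k : nat) : (k < n)%nat -> coef n (fun z => z ^ k)%C = 0.
Proof.
  intros Hk. unfold coef.
  set (m := (n - k)%nat).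
  assert (Hm : INR m <> 0) by (apply not_0_INR; unfold m; lia).
  pose proof (integral_deriv_eq_0 (fun z => (- / INR m) * (/ z) ^ m)%C
    (fun z => (- / INR m) * (- INR m * (/ z) ^ S m))%C) as H.
  rewrite <- H.
  - apply CInt_ext. intros t _.
    replace n with (k + m)%nat by (unfold m; lia).
    rewrite Cpow_add_r, Cpow_S.
    assert (E : (polar t ^ k * (/ polar t) ^ k = 1)%C).
    { rewrite <- Cpow_mult_l, Cinv_r, Cpow_1_l; [ reflexivity | apply polar_neq0 ]. }
    transitivity ((polar t ^ k * (/ polar t) ^ k) * ((/ polar t) ^ m * polar_log t))%C;
      [ ring | rewrite E ].
    field. split; [ apply polar_neq0 | ]. intros E2. apply RtoC_inj in E2. auto.
  - intros z [_ Hz].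
    apply (strict_deriv_scal _ (fun z => (/ z) ^ m)%C).
    now apply strict_deriv_inv_pow.
Qed.

Lemma coef_top_power (n : nat) : coef n (fun z => z ^ n)%C = (0, 2 * PI)%R.
Proof.
  rewrite <- CInt_polar_log. unfold coef. apply CInt_ext. intros t _.
  transitivity ((polar t ^ n * (/ polar t) ^ n) * polar_log t)%C; [ ring | ].
  rewrite <- Cpow_mult_l, Cinv_r, Cpow_1_l; [ ring | apply polar_neq0 ].
Qed.

Lemma coef_poly_lower (y : nat -> C) (n k : nat) :
  (k < n)%nat -> coef n (taylor_poly y k) = 0.
Proof.
  induction k as [ | k IH ]; intros Hk.
  - transitivity (coef n (fun z => y 0%nat * z ^ 0)%C).
    + unfold coef. apply CInt_ext. intros t _. simpl. ring.
    + rewrite (coef_scal n _ (fun z => z ^ 0)%C (fun z => INR 0 * z ^ 0)%C).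
      * rewrite coef_lower_power by assumption. ring.
      * intros z _. apply strict_deriv_pow.
  - destruct (taylor_poly_holomorphic y k) as [dp Hp].
    transitivity (coef n (fun z => taylor_poly y k z + y (S k) * z ^ S k)%C); [ reflexivity | ].
    rewrite (coef_plus n (taylor_poly y k) dp (fun z => y (S k) * z ^ S k)%C
       (fun z => y (S k) * (INR (S k) * z ^ k))%C).
    + rewrite IH by lia.
      rewrite (coef_scal n _ (fun z => z ^ S k)%C (fun z => INR (S k) * z ^ k)%C).
      * rewrite coef_lower_power by assumption. ring.
      * intros z _. apply strict_deriv_pow.
    + intros z _. apply Hp.
    + intros z _. apply (strict_deriv_scal _ (fun z => z ^ S k)%C), strict_deriv_pow.
Qed.

Lemma coef_poly (y : nat -> C) (n : nat) :
  coef n (taylor_poly y n) = (y n * (0, 2 * PI)%R)%C.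
Proof.
  destruct n as [ | k ].
  - transitivity (coef 0 (fun z => y 0%nat * z ^ 0)%C).
    + unfold coef. apply CInt_ext. intros t _. simpl. ring.
    + rewrite (coef_scal 0 _ (fun z => z ^ 0)%C (fun z => INR 0 * z ^ 0)%C).
      * now rewrite coef_top_power.
      * intros z _. apply strict_deriv_pow.
  - destruct (taylor_poly_holomorphic y k) as [dp Hp].
    transitivity (coef (S k) (fun z => taylor_poly y k z + y (S k) * z ^ S k)%C); [ reflexivity | ].
    rewrite (coef_plus (S k) (taylor_poly y k) dp (fun z => y (S k) * z ^ S k)%C
       (fun z => y (S k) * (INR (S k) * z ^ k))%C).
    + rewrite coef_poly_lower by lia.
      rewrite (coef_scal (S k) _ (fun z => z ^ S k)%C (fun z => INR (S k) * z ^ k)%C).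
      * rewrite coef_top_power. ring.
      * intros z _. apply strict_deriv_pow.
    + intros z _. apply Hp.
    + intros z _. apply (strict_deriv_scal _ (fun z => z ^ S k)%C), strict_deriv_pow.
Qed.

(** Subtract the Taylor polynomial of degree [n]: what remains, divided by z^n,
    tends to 0 at the origin, so its integral vanishes, and of the polynomial
    only the term of degree [n] survives. *)
Lemma coef_taylor (n : nat) (y : nat -> C) (f df : C -> C) :
  holomorphic O f df ->
  (exists K, near 0 (fun z => Cmod (f z - taylor_poly y n z) <= K * Cmod z ^ S n)) ->
  coef n f = (y n * (0, 2 * PI)%R)%C.
Proof.
  intros Hf (K & d & Hd & HK).
  destruct (taylor_poly_holomorphic y n) as [dp Hp].
  assert (Hdiff : holomorphic O (fun z => f z + - (1) * taylor_poly y n z)%C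
      (fun z => df z + - (1) * dp z)%C).
  { intros z Hz. apply (strict_deriv_plus f); [ now apply Hf | ].
    apply strict_deriv_scal, Hp. }
  assert (H0 : coef n (fun z => f z + - (1) * taylor_poly y n z)%C = 0).
  { pose proof (integral_eq_limit_at_0
      (fun z => (f z + - (1) * taylor_poly y n z) * (/ z) ^ n)%C
      (fun z => (df z + - (1) * dp z) * (/ z) ^ n
          + (f z + - (1) * taylor_poly y n z) * (- INR n * (/ z) ^ S n))%C 0) as H.
    replace (0 * (0, 2 * PI)%R)%C with (RtoC 0) in H by ring.
    rewrite <- H.
    - unfold coef. apply CInt_ext. intros t _. ring.
    - intros z [Hz Hz0].
      apply (strict_deriv_mult (fun z => f z + - (1) * taylor_poly y n z)%C (fun z => (/ z) ^ n)%C);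
        [ now apply Hdiff | now apply strict_deriv_inv_pow ].
    - intros eps He.
      assert (0 < eps / (Rabs K + 1))
        by (pose proof (Rabs_pos K); apply Rdiv_lt_0_compat; lra).
      exists (Rmin d (eps / (Rabs K + 1))). split; [ now apply Rmin_pos | ].
      intros z Hz Hz0.
      assert (Hz1 := HK z (Rlt_le_trans _ _ _ Hz (Rmin_l _ _))).
      replace (z - 0)%C with z in Hz by ring.
      assert (Hz2 := Rlt_le_trans _ _ _ Hz (Rmin_r _ _)).
      assert (Hzp := proj1 (Cmod_gt_0 z) Hz0).
      replace ((f z + - (1) * taylor_poly y n z) * (/ z) ^ n - 0)%C with
        ((f z - taylor_poly y n z) * (/ z) ^ n)%C by ring.
      rewrite Cmod_mult, Cmod_pow, Cmod_inv by assumption.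
      pose proof (pow_lt _ n Hzp) as Hpn.
      apply Rle_lt_trans with (K * Cmod z ^ S n * (/ Cmod z) ^ n).
      + apply Rmult_le_compat_r; [ | exact Hz1 ].
        apply pow_le, Rlt_le, Rinv_0_lt_compat; lra.
      + replace (K * Cmod z ^ S n * (/ Cmod z) ^ n) with (K * Cmod z).
        2: { rewrite pow_inv. simpl. field. lra. }
        pose proof (Rle_abs K). pose proof (Rabs_pos K).
        apply Rle_lt_trans with ((Rabs K + 1) * Cmod z); [ nra | ].
        apply Rlt_le_trans with ((Rabs K + 1) * (eps / (Rabs K + 1))).
        * apply Rmult_lt_compat_l; lra.
        * right. field. lra. }
  rewrite <- coef_poly.
  transitivity (coef n (fun z => (f z + - (1) * taylor_poly y n z) + taylor_poly y n z)%C).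
  - unfold coef. apply CInt_ext. intros t _. ring.
  - rewrite (coef_plus n _ _ (taylor_poly y n) dp Hdiff) by (intros z _; apply Hp).
    rewrite H0. ring.
Qed.

End Polar.

(** * Functions given locally by power series *)

Lemma pow_n_Cpow (z : C) (n : nat) : @pow_n C_AbsRing z n = (z ^ n)%C.
Proof.
  induction n as [ | n IH ]; [ reflexivity | ].
  simpl pow_n. rewrite IH. reflexivity.
Qed.

Lemma sum_n_poly (a : nat -> C) (z : C) (n : nat) :
  sum_n (fun k => @scal C_AbsRing C_NormedModule (@pow_n C_AbsRing z k) (a k)) n
  = taylor_poly a n z.
Proof.
  induction n as [ | n IH ].
  - rewrite sum_O. rewrite pow_n_Cpow. simpl.
    change (1 * a 0%nat = a 0%nat)%C. ring.
  - rewrite sum_Sn, IH, pow_n_Cpow.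
    change (taylor_poly a n z + z ^ S n * a (S n) = taylor_poly a (S n) z)%C.
    cbn [taylor_poly]. ring.
Qed.

Lemma pseries_partial_sums (a : nat -> C) (z l : C) :
  @is_pseries C_AbsRing C_NormedModule a z l ->
  forall eps : R, 0 < eps ->
    exists N : nat, forall n, (N <= n)%nat -> Cmod (taylor_poly a n z - l) < eps.
Proof.
  intros H eps He.
  destruct (proj1 (filterlim_locally_ball_norm _ _) H (mkposreal eps He)) as [N HN].
  exists N. intros n Hn. rewrite <- sum_n_poly. exact (HN n Hn).
Qed.

Lemma eventually_bounded (u : nat -> R) (B : R) (N : nat) :
  (forall k, (N <= k)%nat -> u k <= B) -> exists M, forall k, u k <= M.
Proof.
  revert B. induction N as [ | N IH ]; intros B H.
  - exists B. intros k. apply H. lia.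
  - apply (IH (Rmax B (u N))). intros k Hk.
    destruct (Nat.eq_dec k N) as [-> | Hne]; [ apply Rmax_r | ].
    eapply Rle_trans; [ apply H; lia | apply Rmax_l ].
Qed.

(** The terms of a convergent series are bounded; this replaces the radius of
    convergence. *)
Lemma pseries_coefficient_bound (a : nat -> C) (z l : C) :
  @is_pseries C_AbsRing C_NormedModule a z l ->
  exists M : R, 0 <= M /\ forall k, Cmod (a k) * Cmod z ^ k <= M.
Proof.
  intros H. destruct (pseries_partial_sums a z l H 1 Rlt_0_1) as [N HN].
  destruct (eventually_bounded (fun k => Cmod (a k) * Cmod z ^ k) 2 (S N)) as [M HM].
  - intros k Hk. destruct k as [ | k ]; [ lia | ].
    pose proof (HN k ltac:(lia)) as H1. pose proof (HN (S k) ltac:(lia)) as H2.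
    rewrite <- Cmod_pow, <- Cmod_mult.
    replace (a (S k) * z ^ S k)%C with ((taylor_poly a (S k) z - l) - (taylor_poly a k z - l))%C
      by (cbn [taylor_poly]; ring).
    eapply Rle_trans; [ apply Cmod_triangle | ]. rewrite Cmod_opp. lra.
  - exists M. split; [ | exact HM ].
    eapply Rle_trans; [ | apply (HM 0%nat) ].
    apply Rmult_le_pos; [ apply Cmod_ge_0 | apply pow_le, Cmod_ge_0 ].
Qed.

Lemma Cpow_diff_bound (x y : C) (m : R) (k : nat) :
  Cmod x <= m -> Cmod y <= m ->
  Cmod (x ^ S k - y ^ S k) <= INR (S k) * Cmod (x - y) * m ^ k.
Proof.
  intros Hx Hy. pose proof (Cmod_ge_0 x). pose proof (Cmod_ge_0 (x - y)).
  induction k as [ | k IH ].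
  - rewrite !Cpow_1_r. simpl. lra.
  - replace (x ^ S (S k) - y ^ S (S k))%C with
      (x * (x ^ S k - y ^ S k) + (x - y) * y ^ S k)%C by (rewrite !(Cpow_S _ (S k)); ring).
    eapply Rle_trans; [ apply Cmod_triangle | ].
    rewrite !Cmod_mult, Cmod_pow.
    assert (E1 : Cmod x * Cmod (x ^ S k - y ^ S k) <= m * (INR (S k) * Cmod (x - y) * m ^ k))
      by (apply Rmult_le_compat; auto using Cmod_ge_0).
    assert (E2 : Cmod (x - y) * Cmod y ^ S k <= Cmod (x - y) * m ^ S k).
    { apply Rmult_le_compat_l; [ assumption | ]. apply pow_incr.
      split; [ apply Cmod_ge_0 | assumption ]. }
    rewrite (S_INR (S k)). simpl pow in *. lra.
Qed.

Lemma INR_le_pow2 (k : nat) : INR k <= 2 ^ k.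
Proof.
  induction k as [ | k IH ]; [ simpl; lra | ].
  rewrite S_INR. simpl. pose proof (pow_R1_Rle 2 k ltac:(lra)). lra.
Qed.

(** The terms of degree k >= 2 are bounded by k m^(k-1) |x - y| times the
    coefficient, with m = |x| + |y| at most R0/4; the resulting series is
    dominated by a geometric one of ratio 1/2, whose partial sums give the last
    factor and make the induction work. *)
Lemma poly_strict_bound (a : nat -> C) (R0 M : R) (x y : C) (n : nat) :
  0 < R0 -> (forall k, Cmod (a k) * R0 ^ k <= M) ->
  Cmod x + Cmod y <= R0 / 4 ->
  Cmod (taylor_poly a (S n) x - taylor_poly a (S n) y - a 1%nat * (x - y))
  <= 16 * M / R0 ^ 2 * Cmod (x - y) * (Cmod x + Cmod y) * (1 - / 2 ^ S n).
Proof.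
  intros HR HM Hm.
  assert (HM0 : 0 <= M).
  { eapply Rle_trans; [ | apply (HM 0%nat) ].
    apply Rmult_le_pos; [ apply Cmod_ge_0 | apply pow_le; lra ]. }
  pose proof (Cmod_ge_0 x). pose proof (Cmod_ge_0 y). pose proof (Cmod_ge_0 (x - y)).
  set (m := Cmod x + Cmod y) in *.
  assert (HMR : 0 <= 16 * M / R0 ^ 2).
  { apply Rdiv_le_0_compat; [ lra | apply pow_lt; lra ]. }
  assert (HB : 0 <= 16 * M / R0 ^ 2 * Cmod (x - y) * m).
  { apply Rmult_le_pos; [ | unfold m; lra ]. now apply Rmult_le_pos. }
  induction n as [ | n IH ].
  - replace (taylor_poly a 1 x - taylor_poly a 1 y - a 1%nat * (x - y))%C with (RtoC 0)
      by (simpl; ring).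
    rewrite Cmod_0. apply Rmult_le_pos; [ assumption | simpl; lra ].
  - replace (taylor_poly a (S (S n)) x - taylor_poly a (S (S n)) y - a 1%nat * (x - y))%C with
      ((taylor_poly a (S n) x - taylor_poly a (S n) y - a 1%nat * (x - y))
        + a (S (S n)) * (x ^ S (S n) - y ^ S (S n)))%C
      by (change (taylor_poly a (S (S n)) x) with (taylor_poly a (S n) x + a (S (S n)) * x ^ S (S n))%C;
          change (taylor_poly a (S (S n)) y) with (taylor_poly a (S n) y + a (S (S n)) * y ^ S (S n))%C;
          ring).
    eapply Rle_trans; [ apply Cmod_triangle | ]. rewrite Cmod_mult.
    assert (T : Cmod (a (S (S n))) * Cmod (x ^ S (S n) - y ^ S (S n))
        <= 16 * M / R0 ^ 2 * Cmod (x - y) * m * / 2 ^ S (S n)).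
    { pose proof (Cpow_diff_bound x y m (S n) ltac:(unfold m; lra) ltac:(unfold m; lra)) as HP.
      pose proof (INR_le_pow2 (S (S n))) as Hi.
      assert (Hmn : m ^ S n <= m * (R0 / 4) ^ n).
      { simpl. apply Rmult_le_compat_l; [ unfold m; lra | ].
        apply pow_incr. unfold m in *; lra. }
      assert (HRn : 0 < R0 ^ n) by (apply pow_lt; lra).
      assert (Ha : Cmod (a (S (S n))) <= M / R0 ^ S (S n)).
      { assert (0 < R0 ^ S (S n)) by (apply pow_lt; lra).
        apply Rmult_le_reg_r with (R0 ^ S (S n)); [ assumption | ].
        replace (M / R0 ^ S (S n) * R0 ^ S (S n)) with M by (field; lra). apply HM. }
      apply Rle_trans with
        (M / R0 ^ S (S n) * (2 ^ S (S n) * Cmod (x - y) * (m * (R0 / 4) ^ n))).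
      - apply Rmult_le_compat; auto using Cmod_ge_0.
        eapply Rle_trans; [ apply HP | ].
        apply Rmult_le_compat; try assumption.
        + apply Rmult_le_pos; [ apply pos_INR | assumption ].
        + apply pow_le. unfold m; lra.
        + now apply Rmult_le_compat_r.
      - right. unfold Rdiv. rewrite Rpow_mult_distr, pow_inv.
        replace 4 with (2 * 2) by ring. rewrite Rpow_mult_distr.
        assert (0 < 2 ^ n) by (apply pow_lt; lra).
        simpl. field. repeat split; lra. }
    replace (1 - / 2 ^ S (S n)) with (1 - / 2 ^ S n + / 2 ^ S (S n)).
    + lra.
    + assert (0 < 2 ^ n) by (apply pow_lt; lra). simpl. field. lra.
Qed.

(** Geometric domination of the terms of degree larger than [n]; the last factor
    is the partial sum that makes the induction on [j] work. *)
Lemma poly_tail_bound (a : nat -> C) (R0 M : R) (x : C) (n j : nat) :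
  0 < R0 -> (forall k, Cmod (a k) * R0 ^ k <= M) ->
  Cmod x <= R0 / 2 ->
  Cmod (taylor_poly a (n + j) x - taylor_poly a n x)
  <= 2 * M / R0 ^ S n * Cmod x ^ S n * (1 - / 2 ^ j).
Proof.
  intros HR HM Hx. pose proof (Cmod_ge_0 x).
  induction j as [ | j IH ].
  - rewrite Nat.add_0_r. replace (taylor_poly a n x - taylor_poly a n x)%C with (RtoC 0) by ring.
    rewrite Cmod_0. simpl. lra.
  - replace (n + S j)%nat with (S (n + j)) by lia. cbn [taylor_poly].
    replace (taylor_poly a (n + j) x + a (S (n + j)) * x ^ S (n + j) - taylor_poly a n x)%C with
     ((taylor_poly a (n + j) x - taylor_poly a n x) + a (S (n + j)) * x ^ S (n + j))%C by ring.
    eapply Rle_trans; [ apply Cmod_triangle | ]. rewrite Cmod_mult, Cmod_pow.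
    assert (T : Cmod (a (S (n + j))) * Cmod x ^ S (n + j)
      <= 2 * M / R0 ^ S n * Cmod x ^ S n * / 2 ^ S j).
    { assert (0 < R0 ^ S n) by (apply pow_lt; lra).
      assert (0 < R0 ^ j) by (apply pow_lt; lra).
      replace (S (n + j)) with (S n + j)%nat by lia. rewrite pow_add.
      apply Rle_trans with (M / (R0 ^ S n * R0 ^ j) * (Cmod x ^ S n * (R0 / 2) ^ j)).
      - apply Rmult_le_compat.
        + apply Cmod_ge_0.
        + apply Rmult_le_pos; apply pow_le; assumption.
        + apply Rmult_le_reg_r with (R0 ^ S n * R0 ^ j); [ now apply Rmult_lt_0_compat | ].
          replace (M / (R0 ^ S n * R0 ^ j) * (R0 ^ S n * R0 ^ j)) with M
            by (field; split; lra).
          rewrite <- pow_add. apply HM.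
        + apply Rmult_le_compat_l; [ now apply pow_le | ]. now apply pow_incr.
      - right. unfold Rdiv. rewrite Rpow_mult_distr, pow_inv.
        assert (0 < 2 ^ j) by (apply pow_lt; lra).
        change (2 ^ S j) with (2 * 2 ^ j). field. repeat split; lra. }
    replace (1 - / 2 ^ S j) with (1 - / 2 ^ j + / 2 ^ S j).
    + lra.
    + assert (0 < 2 ^ j) by (apply pow_lt; lra). simpl. field. lra.
Qed.

Lemma locally_near (z : C) (P : C -> Prop) : locally z P <-> near z P.
Proof.
  split.
  - intros [e He]. exists e. split; [ apply cond_pos | ].
    intros x Hx. apply He. apply C_NormedModule_mixin_compat1. exact Hx.
  - intros (d & Hd & H).
    assert (Hd2 : 0 < d / sqrt 2).
    { apply Rdiv_lt_0_compat; [ assumption | ]. apply sqrt_lt_R0; lra. }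
    exists (mkposreal _ Hd2). intros x Hx. apply H.
    pose proof (C_NormedModule_mixin_compat2 z x (mkposreal _ Hd2) Hx) as Hlt. simpl in Hlt.
    replace (sqrt 2 * (d / sqrt 2)) with d in Hlt.
    + exact Hlt.
    + field. apply Rgt_not_eq, sqrt_lt_R0; lra.
Qed.

(** All that is used of a power series expansion: geometric bounds on the
    coefficients and convergence of the partial sums on a disc. *)
Lemma analytic_at_expansion (D : C -> Prop) (f : C -> C) (z : C) (a : nat -> C) :
  near z D ->
  locally z (fun x : C => D x ->
      @is_pseries C_AbsRing C_NormedModule a (x - z)%C (f x)) ->
  exists R0 M : R, 0 < R0 /\ (forall k, Cmod (a k) * R0 ^ k <= M) /\
    forall x, Cmod (x - z) < R0 -> forall eps, 0 < eps ->
      exists N : nat, forall n, (N <= n)%nat -> Cmod (taylor_poly a n (x - z) - f x) < eps.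
Proof.
  intros (d & Hd & HD) Hloc. apply locally_near in Hloc.
  destruct Hloc as (e & He & HP).
  set (r := Rmin d e / 2).
  assert (Hm : 0 < Rmin d e) by now apply Rmin_pos.
  pose proof (Rmin_l d e). pose proof (Rmin_r d e).
  assert (Hser : forall x, Cmod (x - z) <= r ->
     @is_pseries C_AbsRing C_NormedModule a (x - z)%C (f x)).
  { intros x Hx. unfold r in Hx. apply HP; [ | apply HD ]; lra. }
  destruct (pseries_coefficient_bound a (z + RtoC r - z)%C (f (z + RtoC r)%C)) as (M & HM & Hb).
  - apply Hser. replace (z + r - z)%C with (RtoC r) by ring.
    rewrite Cmod_R, Rabs_pos_eq; unfold r; lra.
  - exists r, M. split; [ unfold r; lra | split ].
    + replace (z + r - z)%C with (RtoC r) in Hb by ring.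
      rewrite Cmod_R, Rabs_pos_eq in Hb by (unfold r; lra). exact Hb.
    + intros x Hx. apply pseries_partial_sums, Hser. lra.
Qed.

Lemma Rle_of_eps (x y : R) : (forall eps, 0 < eps -> x <= y + eps) -> x <= y.
Proof.
  intros H. destruct (Rle_lt_dec x y) as [ | Hlt ]; [ assumption | ].
  specialize (H ((x - y) / 2) ltac:(lra)). lra.
Qed.

Lemma analytic_at_strict_deriv (D : C -> Prop) (f : C -> C) (z : C) :
  near z D -> analytic_at D f z -> exists l, strict_deriv f z l.
Proof.
  intros HD [a Ha].
  destruct (analytic_at_expansion D f z a HD Ha) as (R0 & M & HR & HM & Hlim).
  assert (HM0 : 0 <= M).
  { eapply Rle_trans; [ | apply (HM 0%nat) ].
    apply Rmult_le_pos; [ apply Cmod_ge_0 | apply pow_le; lra ]. }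
  assert (HK : 0 <= 16 * M / R0 ^ 2)
    by (apply Rdiv_le_0_compat; [ lra | apply pow_lt; lra ]).
  exists (a 1%nat), (16 * M / R0 ^ 2), (R0 / 8).
  split; [ lra | split; [ assumption | ] ].
  intros x y Hx Hy. apply Rle_of_eps. intros eps He.
  destruct (Hlim x ltac:(lra) (eps / 2) ltac:(lra)) as [N1 H1].
  destruct (Hlim y ltac:(lra) (eps / 2) ltac:(lra)) as [N2 H2].
  set (n := Nat.max N1 N2).
  specialize (H1 (S n) ltac:(lia)). specialize (H2 (S n) ltac:(lia)).
  pose proof (poly_strict_bound a R0 M (x - z) (y - z) n HR HM ltac:(lra)) as HB.
  replace (x - z - (y - z))%C with (x - y)%C in HB by ring.
  set (p := taylor_poly a (S n) (x - z)) in *. set (p' := taylor_poly a (S n) (y - z)) in *.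
  replace (f x - f y - a 1%nat * (x - y))%C with
    ((p - p' - a 1%nat * (x - y)) + (- (p - f x) + (p' - f y)))%C by ring.
  eapply Rle_trans; [ apply Cmod_triangle | ].
  eapply Rle_trans; [ apply Rplus_le_compat_l, Cmod_triangle | ]. rewrite Cmod_opp.
  assert (0 < / 2 ^ S n) by (apply Rinv_0_lt_compat, pow_lt; lra).
  pose proof (Cmod_ge_0 (x - y)). pose proof (Cmod_ge_0 (x - z)). pose proof (Cmod_ge_0 (y - z)).
  assert (0 <= 16 * M / R0 ^ 2 * Cmod (x - y) * (Cmod (x - z) + Cmod (y - z))).
  { apply Rmult_le_pos; [ now apply Rmult_le_pos | lra ]. }
  nra.
Qed.

Lemma analytic_at_taylor (D : C -> Prop) (f : C -> C) (a : nat -> C) (n : nat) :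
  near 0 D ->
  locally (RtoC 0) (fun x : C => D x ->
      @is_pseries C_AbsRing C_NormedModule a (x - 0)%C (f x)) ->
  exists K, near 0 (fun x => Cmod (f x - taylor_poly a n x) <= K * Cmod x ^ S n).
Proof.
  intros HD Ha.
  destruct (analytic_at_expansion D f 0 a HD Ha) as (R0 & M & HR & HM & Hlim).
  assert (HM0 : 0 <= M).
  { eapply Rle_trans; [ | apply (HM 0%nat) ].
    apply Rmult_le_pos; [ apply Cmod_ge_0 | apply pow_le; lra ]. }
  assert (HK : 0 <= 2 * M / R0 ^ S n)
    by (apply Rdiv_le_0_compat; [ lra | apply pow_lt; lra ]).
  exists (2 * M / R0 ^ S n), (R0 / 2). split; [ lra | ].
  intros x Hx. apply Rle_of_eps. intros eps He.
  destruct (Hlim x ltac:(lra) eps He) as [N HN].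
  specialize (HN (n + N)%nat ltac:(lia)).
  replace (x - 0)%C with x in * by ring.
  pose proof (poly_tail_bound a R0 M x n N HR HM ltac:(lra)) as HB.
  replace (f x - taylor_poly a n x)%C with
    (- (taylor_poly a (n + N) x - f x) + (taylor_poly a (n + N) x - taylor_poly a n x))%C by ring.
  eapply Rle_trans; [ apply Cmod_triangle | ]. rewrite Cmod_opp.
  assert (0 < / 2 ^ N) by (apply Rinv_0_lt_compat, pow_lt; lra).
  assert (0 <= 2 * M / R0 ^ S n * Cmod x ^ S n).
  { apply Rmult_le_pos; [ assumption | apply pow_le, Cmod_ge_0 ]. }
  nra.
Qed.

(** * The principal branch of the power *)

Definition Cexp (z : C) : C := (exp (Re z) * cos (Im z), exp (Re z) * sin (Im z)).

Lemma Cexp_plus (z w : C) : Cexp (z + w) = (Cexp z * Cexp w)%C.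
Proof.
  unfold Cexp, Re, Im, Cmult; simpl. rewrite exp_plus, cos_plus, sin_plus.
  f_equal; ring.
Qed.

Lemma exp_quadratic (a : R) : Rabs a <= 1 / 2 -> Rabs (exp a - 1 - a) <= 2 * a ^ 2.
Proof.
  intros Ha. apply Rabs_le_between in Ha.
  pose proof (exp_ineq1_le a) as H1. pose proof (exp_ineq1_le (- a)) as H.
  rewrite exp_Ropp in H. pose proof (exp_pos a).
  assert (exp a * (1 - a) <= 1).
  { apply Rmult_le_compat_l with (r := exp a) in H; [ | lra ].
    rewrite Rinv_r in H; lra. }
  apply Rabs_le. split; nra.
Qed.

Lemma sin_cos_quadratic (b : R) :
  Rabs (sin b) <= Rabs b /\ Rabs (cos b - 1) <= b ^ 2 /\
  (Rabs b <= 1 / 2 -> Rabs (sin b - b) <= b ^ 2).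
Proof.
  assert (Hpos : forall x, 0 <= x -> Rabs (sin x) <= x).
  { intros x Hx. destruct (Rle_lt_dec x 1) as [Hx1 | Hx1].
    - pose proof PI2_1. rewrite Rabs_pos_eq by (apply sin_ge_0; lra).
      destruct Hx as [Hx | <-]; [ | rewrite sin_0; lra ].
      apply Rlt_le, sin_lt_x. assumption.
    - pose proof (SIN_bound x). apply Rabs_le. lra. }
  assert (Hs : forall x, Rabs (sin x) <= Rabs x).
  { intros x. destruct (Rle_lt_dec 0 x) as [Hx | Hx].
    - rewrite (Rabs_pos_eq x Hx). now apply Hpos.
    - rewrite (Rabs_left x Hx), <- (Rabs_Ropp (sin x)), <- sin_neg.
      apply Hpos. lra. }
  split; [ apply Hs | split ].
  - replace b with (2 * (b / 2)) at 1 by field. rewrite cos_2a_sin.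
    replace (1 - 2 * sin (b / 2) * sin (b / 2) - 1) with (- (2 * (sin (b / 2)) ^ 2)) by ring.
    rewrite Rabs_Ropp, Rabs_pos_eq by (pose proof (pow2_ge_0 (sin (b / 2))); lra).
    rewrite <- (pow2_abs (sin (b / 2))).
    assert (Rabs (sin (b / 2)) ^ 2 <= Rabs (b / 2) ^ 2)
      by (apply pow_incr; split; [ apply Rabs_pos | apply Hs ]).
    rewrite (pow2_abs (b / 2)) in H. pose proof (pow2_ge_0 b). nra.
  - assert (Hq : forall x, 0 <= x <= 1 / 2 -> Rabs (sin x - x) <= x ^ 2).
    { intros x Hx. pose proof PI2_1.
      destruct (sin_bound x 0 ltac:(lra) ltac:(lra)) as [Hl _].
      unfold sin_approx, sin_term in Hl. simpl in Hl.
      assert (sin x <= x).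
      { pose proof (Hpos x ltac:(lra)). pose proof (Rle_abs (sin x)). lra. }
      apply Rabs_le. split; nra. }
    intros Hb. apply Rabs_le_between in Hb.
    destruct (Rle_lt_dec 0 b) as [H0 | H0]; [ apply Hq; lra | ].
    replace (b ^ 2) with ((- b) ^ 2) by ring.
    replace (sin b - b) with (- (sin (- b) - (- b))) by (rewrite sin_neg; ring).
    rewrite Rabs_Ropp. apply Hq. lra.
Qed.

(** The second-order remainder of exp near 0; together with the functional
    equation it yields the derivative everywhere. *)
Lemma Cexp_quadratic (h : C) :
  Cmod h <= 1 / 2 -> Cmod (Cexp h - 1 - h) <= 8 * Cmod h ^ 2.
Proof.
  intros Hh.
  pose proof (re_le_Cmod h) as Ha. pose proof (im_le_Cmod h) as Hb.
  set (a := Re h) in *. set (b := Im h) in *.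
  destruct (sin_cos_quadratic b) as (S1 & C1 & S2).
  specialize (S2 ltac:(lra)). pose proof (exp_quadratic a ltac:(lra)) as E1.
  assert (Ha2 : a ^ 2 <= Cmod h ^ 2)
    by (rewrite <- pow2_abs; apply pow_incr; split; [ apply Rabs_pos | assumption ]).
  assert (Hb2 : b ^ 2 <= Cmod h ^ 2)
    by (rewrite <- pow2_abs; apply pow_incr; split; [ apply Rabs_pos | assumption ]).
  assert (Hea : Rabs (exp a - 1) <= 2 * Cmod h).
  { replace (exp a - 1) with ((exp a - 1 - a) + a) by ring.
    eapply Rle_trans; [ apply Rabs_triang | ]. pose proof (Cmod_ge_0 h).
    assert (Cmod h ^ 2 <= Cmod h * (1 / 2)) by (simpl; nra). lra. }
  assert (Hexp : Rabs (exp a) <= 2).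
  { replace (exp a) with ((exp a - 1) + 1) by ring.
    eapply Rle_trans; [ apply Rabs_triang | ]. rewrite Rabs_R1. lra. }
  eapply Rle_trans; [ apply Cmod_le_re_im | ].
  replace (Re (Cexp h - 1 - h)%C) with ((exp a - 1 - a) + exp a * (cos b - 1))
    by (unfold Cexp, a, b, Re, Im; simpl; ring).
  replace (Im (Cexp h - 1 - h)%C) with ((exp a - 1) * sin b + (sin b - b))
    by (unfold Cexp, a, b, Re, Im; simpl; ring).
  assert (T1 : Rabs (exp a * (cos b - 1)) <= 2 * Cmod h ^ 2).
  { rewrite Rabs_mult. apply Rmult_le_compat; try apply Rabs_pos; lra. }
  assert (T2 : Rabs ((exp a - 1) * sin b) <= 2 * Cmod h * Cmod h).
  { rewrite Rabs_mult. apply Rmult_le_compat; try apply Rabs_pos; lra. }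
  pose proof (Rabs_triang (exp a - 1 - a) (exp a * (cos b - 1))).
  pose proof (Rabs_triang ((exp a - 1) * sin b) (sin b - b)).
  simpl in *. nra.
Qed.

Lemma strict_deriv_Cexp (z : C) : strict_deriv Cexp z (Cexp z).
Proof.
  pose proof (Cmod_ge_0 (Cexp z)) as Hz.
  set (E := Cmod (Cexp z)) in *.
  exists (48 * E + 6 * E), (1 / 4).
  split; [ lra | split; [ lra | ] ].
  intros x y Hx Hy.
  assert (Hxy : Cmod (x - y) <= Cmod (x - z) + Cmod (y - z)) by apply Cmod_minus_triangle.
  assert (Hsmall : forall h : C, Cmod h <= 1 / 2 -> Cmod (Cexp h - 1) <= 5 * Cmod h).
  { intros h Hh. replace (Cexp h - 1)%C with ((Cexp h - 1 - h) + h)%C by ring.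
    eapply Rle_trans; [ apply Cmod_triangle | ].
    pose proof (Cexp_quadratic h Hh). pose proof (Cmod_ge_0 h). simpl in *. nra. }
  assert (Ey : Cexp y = (Cexp z * Cexp (y - z))%C).
  { rewrite <- Cexp_plus. f_equal. ring. }
  assert (Ex : Cexp x = (Cexp y * Cexp (x - y))%C).
  { rewrite <- Cexp_plus. f_equal. ring. }
  replace (Cexp x - Cexp y - Cexp z * (x - y))%C with
    (Cexp y * (Cexp (x - y) - 1 - (x - y)) + Cexp z * (Cexp (y - z) - 1) * (x - y))%C
    by (rewrite Ex, Ey; ring).
  assert (Hy1 : Cmod (Cexp y) <= 3 * E).
  { rewrite Ey, Cmod_mult.
    replace (3 * E) with (E * 3) by ring. apply Rmult_le_compat_l; [ assumption | ].
    replace (Cexp (y - z)) with ((Cexp (y - z) - 1) + 1)%C by ring.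
    eapply Rle_trans; [ apply Cmod_triangle | ]. rewrite Cmod_1.
    pose proof (Hsmall (y - z)%C ltac:(lra)). lra. }
  eapply Rle_trans; [ apply Cmod_triangle | ]. rewrite !Cmod_mult.
  pose proof (Cmod_ge_0 (x - y)). pose proof (Cmod_ge_0 (x - z)). pose proof (Cmod_ge_0 (y - z)).
  set (N := Cmod (x - z) + Cmod (y - z)) in *.
  assert (T1 : Cmod (Cexp y) * Cmod (Cexp (x - y) - 1 - (x - y))
            <= 3 * E * (8 * Cmod (x - y) ^ 2)).
  { apply Rmult_le_compat; try apply Cmod_ge_0; [ assumption | ].
    apply Cexp_quadratic. unfold N in *; lra. }
  assert (T2 : E * Cmod (Cexp (y - z) - 1) * Cmod (x - y) <= E * (5 * N) * Cmod (x - y)).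
  { apply Rmult_le_compat_r; [ assumption | ]. apply Rmult_le_compat_l; [ assumption | ].
    eapply Rle_trans; [ apply Hsmall; lra | unfold N; lra ]. }
  assert (T3 : 3 * E * (8 * Cmod (x - y) ^ 2) <= 24 * E * Cmod (x - y) * N).
  { replace (3 * E * (8 * Cmod (x - y) ^ 2)) with (24 * E * Cmod (x - y) * Cmod (x - y)) by ring.
    apply Rmult_le_compat_l; [ | assumption ].
    apply Rmult_le_pos; lra. }
  assert (0 <= E * Cmod (x - y) * N).
  { repeat apply Rmult_le_pos; unfold N; lra. }
  fold E. nra.
Qed.

(** A continuous right inverse of a function with nonzero derivative is
    differentiable: near [z] the linear part of [f] dominates its quadratic
    remainder, so [g] is Lipschitz, and the remainder of [f] transports to [g]. *)
Lemma strict_deriv_inverse (f g : C -> C) (z l : C) :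
  l <> 0 -> strict_deriv f (g z) l ->
  (forall eps : R, 0 < eps -> near z (fun x => Cmod (g x - g z) < eps)) ->
  near z (fun x => f (g x) = x) ->
  strict_deriv g z (/ l).
Proof.
  intros Hl (K & d & Hd & HK & H) Hc (e & He & Hfg).
  assert (Hlm := proj1 (Cmod_gt_0 l) Hl). set (m := Cmod l) in *.
  (* close enough to z, the linear part dominates the quadratic error *)
  set (d' := Rmin d (m / (4 * (K + 1)))).
  assert (Hq : 0 < m / (4 * (K + 1))) by (apply Rdiv_lt_0_compat; lra).
  assert (Hd' : 0 < d') by now apply Rmin_pos.
  destruct (Hc d' Hd') as (e' & He' & Hg).
  exists (K * / m * (2 / m) * (2 / m)), (Rmin e e').
  assert (Him : 0 < / m) by (apply Rinv_0_lt_compat; lra).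
  assert (H2m : 0 < 2 / m) by (apply Rdiv_lt_0_compat; lra).
  split; [ now apply Rmin_pos | split ].
  { repeat apply Rmult_le_pos; lra. }
  assert (Hmm : d' <= d /\ K * (2 * d') <= m / 2).
  { split; [ apply Rmin_l | ].
    apply Rle_trans with ((K + 1) * (2 * (m / (4 * (K + 1))))).
    - apply Rmult_le_compat; try lra. pose proof (Rmin_r d (m / (4 * (K + 1)))).
      fold d' in H0. lra.
    - right. field. lra. }
  destruct Hmm as [Hdd HKd].
  assert (Hlip : forall x y, Cmod (x - z) < Rmin e e' -> Cmod (y - z) < Rmin e e' ->
     Cmod (x - y - l * (g x - g y)) <= K * Cmod (g x - g y) * (Cmod (g x - g z) + Cmod (g y - g z))
     /\ Cmod (g x - g y) <= 2 / m * Cmod (x - y)).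
  { intros x y Hx Hy. pose proof (Rmin_l e e'). pose proof (Rmin_r e e').
    pose proof (Hg x ltac:(lra)) as Gx. pose proof (Hg y ltac:(lra)) as Gy.
    pose proof (H (g x) (g y) ltac:(lra) ltac:(lra)) as HH.
    rewrite (Hfg x), (Hfg y) in HH by lra. split; [ exact HH | ].
    pose proof (Cmod_triangle_inv (l * (g x - g y)) (x - y)) as HT.
    rewrite (Cmod_minus_sym (l * (g x - g y))), Cmod_mult in HT. fold m in HT.
    pose proof (Cmod_ge_0 (g x - g y)).
    assert (K * Cmod (g x - g y) * (Cmod (g x - g z) + Cmod (g y - g z))
       <= m / 2 * Cmod (g x - g y)).
    { replace (K * Cmod (g x - g y) * (Cmod (g x - g z) + Cmod (g y - g z))) with
       (K * (Cmod (g x - g z) + Cmod (g y - g z)) * Cmod (g x - g y)) by ring.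
      apply Rmult_le_compat_r; [ assumption | ]. nra. }
    apply Rmult_le_reg_l with (m / 2); [ lra | ].
    replace (m / 2 * (2 / m * Cmod (x - y))) with (Cmod (x - y)) by (field; lra). lra. }
  assert (Ezz : Cmod (z - z) < Rmin e e').
  { replace (z - z)%C with (RtoC 0) by ring. rewrite Cmod_0. now apply Rmin_pos. }
  intros x y Hx Hy.
  destruct (Hlip x y Hx Hy) as [Q1 Q2].
  destruct (Hlip x z Hx Ezz) as [_ Q3]. destruct (Hlip y z Hy Ezz) as [_ Q4].
  replace (g x - g y - / l * (x - y))%C with (- (/ l) * (x - y - l * (g x - g y)))%C
    by (field; assumption).
  rewrite Cmod_mult, Cmod_opp, Cmod_inv by assumption. fold m.
  pose proof (Cmod_ge_0 (x - y)). pose proof (Cmod_ge_0 (g x - g y)).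
  pose proof (Cmod_ge_0 (g x - g z)). pose proof (Cmod_ge_0 (g y - g z)).
  pose proof (Cmod_ge_0 (x - z)). pose proof (Cmod_ge_0 (y - z)).
  replace (K * / m * (2 / m) * (2 / m) * Cmod (x - y) * (Cmod (x - z) + Cmod (y - z))) with
    (/ m * (K * (2 / m * Cmod (x - y)) * (2 / m * Cmod (x - z) + 2 / m * Cmod (y - z)))) by ring.
  apply Rmult_le_compat_l; [ lra | ].
  eapply Rle_trans; [ exact Q1 | ].
  apply Rmult_le_compat; [ now apply Rmult_le_pos | lra | | lra ].
  now apply Rmult_le_compat_l.
Qed.

(** The plane cut along the closed negative half-line. *)
Definition slit (z : C) : Prop := 0 < Cmod z + Re z.

Definition Clog (z : C) : C := (ln (Cmod z), Carg z).

Lemma slit_neq0 (z : C) : slit z -> z <> 0.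
Proof.
  intros H ->. unfold slit in H. rewrite Cmod_0 in H. unfold Re in H; simpl in H. lra.
Qed.

Lemma Re_div_Cmod (z : C) : z <> 0 -> -1 <= Re z / Cmod z <= 1.
Proof.
  intros Hz. apply Cmod_gt_0 in Hz. pose proof (re_le_Cmod z) as H.
  apply Rabs_le_between in H.
  split.
  - apply Rmult_le_reg_r with (Cmod z); [ assumption | ].
    replace (Re z / Cmod z * Cmod z) with (Re z) by (field; lra). lra.
  - apply Rmult_le_reg_r with (Cmod z); [ assumption | ].
    replace (Re z / Cmod z * Cmod z) with (Re z) by (field; lra). lra.
Qed.

Lemma cos_Carg (z : C) : z <> 0 -> cos (Carg z) = Re z / Cmod z.
Proof.
  intros Hz. unfold Carg. destruct (Rle_dec 0 (Im z)); rewrite ?cos_neg;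
    now apply cos_acos, Re_div_Cmod.
Qed.

Lemma sin_Carg (z : C) : z <> 0 -> sin (Carg z) = Im z / Cmod z.
Proof.
  intros Hz. pose proof (proj1 (Cmod_gt_0 z) Hz).
  assert (E : sin (acos (Re z / Cmod z)) = Rabs (Im z) / Cmod z).
  { rewrite sin_acos by now apply Re_div_Cmod.
    rewrite <- sqrt_Rsqr by (apply Rdiv_le_0_compat; [ apply Rabs_pos | assumption ]).
    f_equal. unfold Rsqr.
    pose proof (Cmod2_alt z) as H2. pose proof (pow2_abs (Im z)) as H3.
    replace (Rabs (Im z) / Cmod z * (Rabs (Im z) / Cmod z)) with
      (Rabs (Im z) ^ 2 / Cmod z ^ 2) by (field; lra).
    rewrite H3. replace (Im z ^ 2) with (Cmod z ^ 2 - Re z ^ 2) by (rewrite H2; ring).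
    field. lra. }
  unfold Carg. destruct (Rle_dec 0 (Im z)) as [Hi | Hi].
  - rewrite E, Rabs_pos_eq; auto.
  - rewrite sin_neg, E, Rabs_left by lra. field. lra.
Qed.

Lemma Cexp_Clog (z : C) : z <> 0 -> Cexp (Clog z) = z.
Proof.
  intros Hz. pose proof (proj1 (Cmod_gt_0 z) Hz).
  unfold Cexp, Clog, Re at 1 2, Im at 1 2; simpl.
  rewrite exp_ln, cos_Carg, sin_Carg by assumption.
  apply injective_projections; simpl; unfold Re, Im; field; lra.
Qed.

(** The half-angle formula, in which continuity across the positive axis is
    visible: there the definition by arccosine changes branch. *)
Lemma Carg_slit (z : C) : slit z -> Carg z = 2 * atan (Im z / (Cmod z + Re z)).
Proof.
  intros Hs. pose proof (slit_neq0 z Hs) as Hz.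
  pose proof (proj1 (Cmod_gt_0 z) Hz) as Hm. unfold slit in Hs.
  set (k := Im z / (Cmod z + Re z)).
  pose proof (atan_bound k) as Hb.
  assert (Hcos : cos (2 * atan k) = Re z / Cmod z).
  { rewrite cos_2a_cos, cos_atan.
    assert (Hk : 0 < 1 + k²) by (pose proof (Rle_0_sqr k); lra).
    assert (Hsq : sqrt (1 + k²) * sqrt (1 + k²) = 1 + k²) by (apply sqrt_sqrt; lra).
    assert (sqrt (1 + k²) <> 0) by (apply Rgt_not_eq, sqrt_lt_R0; lra).
    replace (2 * (1 / sqrt (1 + k²)) * (1 / sqrt (1 + k²)) - 1)
      with (2 / (sqrt (1 + k²) * sqrt (1 + k²)) - 1) by (field; assumption).
    rewrite Hsq. unfold k, Rsqr.
    pose proof (Cmod2_alt z) as H2.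
    assert (HI : Im z ^ 2 = Cmod z ^ 2 - Re z ^ 2) by (rewrite H2; ring).
    replace (1 + Im z / (Cmod z + Re z) * (Im z / (Cmod z + Re z))) with
      (((Cmod z + Re z) ^ 2 + Im z ^ 2) / (Cmod z + Re z) ^ 2) by (field; lra).
    rewrite HI.
    replace ((Cmod z + Re z) ^ 2 + (Cmod z ^ 2 - Re z ^ 2)) with
      (2 * Cmod z * (Cmod z + Re z)) by ring.
    field. split; lra. }
  unfold Carg. rewrite <- Hcos.
  destruct (Rle_dec 0 (Im z)) as [Hi | Hi].
  - assert (0 <= k) by (unfold k; apply Rdiv_le_0_compat; lra).
    assert (0 <= atan k).
    { rewrite <- atan_0. destruct H as [H | <-]; [ | lra ].
      apply Rlt_le, atan_increasing, H. }
    apply acos_cos. lra.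
  - assert (k < 0).
    { unfold k, Rdiv. assert (0 < / (Cmod z + Re z)) by (apply Rinv_0_lt_compat; lra). nra. }
    assert (atan k < 0) by (rewrite <- atan_0; now apply atan_increasing).
    rewrite <- cos_neg, acos_cos by lra. ring.
Qed.

Lemma Cmod_continuous (z : C) : continuous Cmod z.
Proof.
  apply filterlim_locally. intros eps. apply locally_near.
  exists eps. split; [ apply cond_pos | ]. intros x Hx.
  change (Rabs (Cmod x - Cmod z) < eps).
  pose proof (Cmod_triangle_inv x z). pose proof (Cmod_triangle_inv z x) as H'.
  rewrite Cmod_minus_sym in H'. apply Rabs_lt_between. lra.
Qed.

Lemma slit_open : is_open slit.
Proof.
  intros z Hz. apply locally_near.
  assert (Hc : continuous (fun x : C => Cmod x + Re x) z).
  { apply (continuous_plus Cmod Re); [ apply Cmod_continuous | ].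
    apply (continuous_fst (U := R_UniformSpace) (V := R_UniformSpace)). }
  apply (Hc (fun r => 0 < r)). apply (open_gt 0). exact Hz.
Qed.

Lemma Clog_continuous (z : C) :
  slit z -> forall eps : R, 0 < eps -> near z (fun x => Cmod (Clog x - Clog z) < eps).
Proof.
  intros Hz eps He.
  pose proof (proj1 (Cmod_gt_0 z) (slit_neq0 z Hz)) as Hm.
  assert (H : tends (locally z) Clog (Clog z)).
  { apply tends_Re_Im; [ typeclasses eauto | | ].
    - apply (continuous_comp Cmod ln); [ apply Cmod_continuous | now apply continuous_ln ].
    - assert (Hc : continuous (fun x : C => 2 * atan (Im x / (Cmod x + Re x))) z).
      { apply (continuous_scal_r 2 (fun x : C => atan (Im x / (Cmod x + Re x)))).
        apply (continuous_comp (fun x : C => Im x / (Cmod x + Re x)) atan).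
        - apply (continuous_mult Im (fun x => / (Cmod x + Re x))).
          + apply (continuous_snd (U := R_UniformSpace) (V := R_UniformSpace)).
          + apply (continuous_comp (fun x : C => Cmod x + Re x) Rinv).
            * apply (continuous_plus Cmod Re); [ apply Cmod_continuous | ].
              apply (continuous_fst (U := R_UniformSpace) (V := R_UniformSpace)).
            * apply continuous_Rinv. unfold slit in Hz. lra.
        - apply continuity_pt_filterlim, derivable_continuous_pt, derivable_pt_atan. }
      unfold continuous in Hc. rewrite <- Carg_slit in Hc by assumption.
      apply filterlim_ext_loc with (2 := Hc).
      apply locally_near. destruct (slit_open z Hz) as (d & Hd & HO).
      exists d. split; [ assumption | ]. intros x Hx. symmetry. apply Carg_slit; auto. }
  apply locally_near. exact (H eps He).
Qed.

Lemma strict_deriv_Clog (z : C) : slit z -> strict_deriv Clog z (/ z).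
Proof.
  intros Hz. pose proof (slit_neq0 z Hz) as Hz0.
  apply (strict_deriv_inverse Cexp); auto.
  - rewrite <- (Cexp_Clog z Hz0) at 2. apply strict_deriv_Cexp.
  - now apply Clog_continuous.
  - destruct (slit_open z Hz) as (d & Hd & HO). exists d. split; [ assumption | ].
    intros x Hx. now apply Cexp_Clog, slit_neq0, HO.
Qed.

Lemma Cpower_Cexp (z : C) (alpha : R) : Cpower z alpha = Cexp (RtoC alpha * Clog z).
Proof.
  unfold Cpower, Cexp, Clog, Rpower, Re, Im, Cmult, RtoC; simpl.
  replace (alpha * ln (Cmod z) - 0 * Carg z) with (alpha * ln (Cmod z)) by ring.
  replace (alpha * Carg z + 0 * ln (Cmod z)) with (alpha * Carg z) by ring.
  f_equal; ring.
Qed.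

Lemma Cpower_1 (alpha : R) : Cpower 1 alpha = 1.
Proof.
  rewrite Cpower_Cexp. unfold Clog. rewrite Cmod_1, ln_1.
  replace (Carg 1) with 0.
  - unfold Cexp, Re, Im; simpl. replace (alpha * 0 - 0 * 0) with 0 by ring.
    replace (alpha * 0 + 0 * 0) with 0 by ring. rewrite exp_0, cos_0, sin_0.
    unfold RtoC. f_equal; ring.
  - unfold Carg. rewrite Cmod_1. unfold Re, Im; simpl.
    replace (1 / 1) with 1 by field. rewrite acos_1.
    destruct (Rle_dec 0 0); lra.
Qed.

Lemma strict_deriv_Cpower_1_minus (alpha : R) (z : C) :
  slit (1 - z)%C ->
  strict_deriv (fun x => Cpower (1 - x) alpha) z
    (- RtoC alpha * Cpower (1 - z) alpha * / (1 - z))%C.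
Proof.
  intros Hz.
  apply strict_deriv_ext with (fun x => Cexp (RtoC alpha * Clog (1 - x)))%C.
  { intros x. now rewrite Cpower_Cexp. }
  replace (- RtoC alpha * Cpower (1 - z) alpha * / (1 - z))%C with
    (Cexp (RtoC alpha * Clog (1 - z)) * (RtoC alpha * (/ (1 - z) * - (1))))%C
    by (rewrite Cpower_Cexp; ring).
  apply (strict_deriv_comp Cexp (fun x => RtoC alpha * Clog (1 - x))%C);
    [ apply strict_deriv_Cexp | ].
  apply (strict_deriv_scal (RtoC alpha) (fun x => Clog (1 - x))).
  apply (strict_deriv_comp Clog (fun x => 1 - x)%C); [ now apply strict_deriv_Clog | ].
  replace (- (1))%C with (0 + - (1) * 1)%C by ring.
  apply strict_deriv_ext with (fun x => 1 + - (1) * x)%C; [ intros x; ring | ].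
  apply (strict_deriv_plus (fun _ => RtoC 1)); [ apply strict_deriv_const | ].
  apply (strict_deriv_scal _ (fun x => x)), strict_deriv_id.
Qed.

(** * The sector and the contour inside it *)

(** The delta-domain in the variable v = x/rho_h, without its boundary:
    |Arg (v - 1)| > phi means that the cosine of the argument is below cos phi. *)
Definition sector (delta phi : R) (v : C) : Prop :=
  Cmod v < 1 + delta /\ Re v - 1 < cos phi * Cmod (v - 1).

Lemma delta_domain_scaled (rho delta phi : R) (v : C) :
  0 < rho -> 0 < phi < PI / 2 -> sector delta phi v ->
  delta_domain rho delta phi (RtoC rho * v)%C.
Proof.
  intros Hr Hphi [H1 H2].
  assert (Hr0 : RtoC rho <> 0) by (intros E; apply RtoC_inj in E; lra).
  assert (Hv1 : (v - 1)%C <> 0).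
  { intros E. rewrite E, Cmod_0 in H2.
    replace (Re v - 1) with (Re (v - 1)%C) in H2 by (unfold Re; simpl; ring).
    rewrite E in H2. unfold Re in H2; simpl in H2. lra. }
  split; [ | split ].
  - rewrite Cmod_mult, Cmod_R, Rmult_comm.
    apply Rmult_le_compat_r; [ apply Rabs_pos | lra ].
  - intros E. apply Hv1.
    replace (v - 1)%C with ((RtoC rho * v - RtoC rho) / RtoC rho)%C by (field; exact Hr0).
    rewrite E. field. exact Hr0.
  - replace (RtoC rho * v / RtoC rho - 1)%C with (v - 1)%C by (field; exact Hr0).
    assert (E : Rabs (Carg (v - 1)) = acos (Re (v - 1)%C / Cmod (v - 1))).
    { pose proof (acos_bound (Re (v - 1)%C / Cmod (v - 1))) as B.
      unfold Carg. destruct (Rle_dec 0 (Im (v - 1)%C));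
        rewrite ?Rabs_Ropp; apply Rabs_pos_eq; lra. }
    rewrite E.
    pose proof (acos_bound (Re (v - 1)%C / Cmod (v - 1))) as B.
    destruct (Rlt_le_dec phi (acos (Re (v - 1)%C / Cmod (v - 1)))) as [ | Hle ];
      [ assumption | exfalso ].
    pose proof PI_RGT_0.
    apply cos_decr_1 in Hle; try lra.
    rewrite cos_acos in Hle by now apply Re_div_Cmod.
    apply Cmod_gt_0 in Hv1.
    apply Rmult_le_compat_r with (r := Cmod (v - 1)) in Hle; [ | lra ].
    replace (Re (v - 1)%C / Cmod (v - 1) * Cmod (v - 1)) with (Re (v - 1)%C) in Hle
      by (field; lra).
    replace (Re (v - 1)%C) with (Re v - 1) in Hle by (unfold Re; simpl; ring). lra.
Qed.

Lemma sector_open (delta phi : R) : is_open (sector delta phi).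
Proof.
  intros v [H1 H2]. apply locally_near.
  assert (Hre : continuous (fun x : C => Re x) v)
    by apply (continuous_fst (U := R_UniformSpace) (V := R_UniformSpace)).
  assert (Hm1 : continuous (fun x : C => Cmod (x - 1)) v).
  { apply filterlim_locally. intros eps. apply locally_near.
    exists eps. split; [ apply cond_pos | ]. intros x Hx.
    change (Rabs (Cmod (x - 1) - Cmod (v - 1)) < eps).
    pose proof (Cmod_triangle_inv (x - 1) (v - 1)) as T1.
    pose proof (Cmod_triangle_inv (v - 1) (x - 1)) as T2.
    replace (x - 1 - (v - 1))%C with (x - v)%C in T1 by ring.
    replace (v - 1 - (x - 1))%C with (v - x)%C in T2 by ring.
    rewrite (Cmod_minus_sym v x) in T2. apply Rabs_lt_between. lra. }
  apply filter_and.
  - apply (Cmod_continuous v (fun r => r < 1 + delta)). apply (open_lt (1 + delta)). exact H1.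
  - assert (Hc : continuous (fun x : C => cos phi * Cmod (x - 1) + (1 - Re x)) v).
    { apply (continuous_plus (fun x : C => cos phi * Cmod (x - 1)) (fun x : C => 1 - Re x)).
      - now apply (continuous_scal_r (cos phi) (fun x : C => Cmod (x - 1))).
      - apply (continuous_minus (fun _ : C => 1) (fun x : C => Re x));
          [ apply continuous_const | exact Hre ]. }
    assert (Hp : locally v (fun x : C => 0 < cos phi * Cmod (x - 1) + (1 - Re x))).
    { apply (Hc (fun r => 0 < r)). apply (open_gt 0).
      assert (H0 : 0 < cos phi * Cmod (v - 1) + (1 - Re v)) by lra. exact H0. }
    generalize Hp. apply filter_imp. intros x Hx. lra.
Qed.

Lemma sector_slit (delta phi : R) (v : C) : sector delta phi v -> slit (1 - v)%C.
Proof.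
  intros [_ H]. unfold slit. rewrite (Cmod_minus_sym 1 v).
  replace (Re (1 - v)%C) with (1 - Re v) by (unfold Re; simpl; ring).
  pose proof (COS_bound phi). pose proof (Cmod_ge_0 (v - 1)). nra.
Qed.

(** |R0 e^(it) - 1|^2 = R0^2 - 2 R0 cos t + 1, written in terms of sin(t/2). *)
Lemma Cmod_circle_minus_1 (R0 t : R) :
  Cmod ((R0 * cos t, R0 * sin t)%R - 1)%C ^ 2 = (R0 - 1) ^ 2 + 4 * R0 * sin (t / 2) ^ 2.
Proof.
  rewrite Cmod2_alt. unfold Re, Im; simpl.
  pose proof (sin2_cos2 t) as E. unfold Rsqr in E.
  assert (E2 : cos t = 1 - 2 * sin (t / 2) * sin (t / 2)).
  { rewrite <- cos_2a_sin. f_equal. field. }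
  assert (E3 : sin (t / 2) * sin (t / 2) = (1 - cos t) / 2) by (rewrite E2; field).
  transitivity (R0 * R0 * (sin t * sin t + cos t * cos t) - 2 * R0 * cos t + 1); [ ring | ].
  rewrite E.
  replace (sin (t / 2) * (sin (t / 2) * 1)) with ((1 - cos t) / 2) by (rewrite <- E3; ring).
  field.
Qed.

(** The contour meets the positive axis at distance 1/n from the singularity. *)
Definition inner_radius (n : nat) : R := 1 - / INR n.

(** The contour moves outwards at rate [c] in sin(t/2). It stays within radius
    1 + delta if c <= delta/2, and it stays above the ray of angle phi at 1 if
    c <= cos phi; the bound 1/4 keeps the curve away from the origin and the
    estimates explicit. *)
Definition admissible_slope (delta phi c : R) : Prop :=
  0 < c /\ c <= 1 / 4 /\ c <= delta / 2 /\ c <= cos phi.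

Lemma exists_admissible_slope (delta phi : R) :
  0 < delta -> 0 < phi < PI / 2 -> exists c, admissible_slope delta phi c.
Proof.
  intros Hd Hphi. assert (0 < cos phi) by (apply cos_gt_0; lra).
  exists (Rmin (1 / 4) (Rmin (delta / 2) (cos phi))).
  split; [ repeat apply Rmin_pos; lra | split; [ apply Rmin_l | split ] ];
    (eapply Rle_trans; [ apply Rmin_r | ]); [ apply Rmin_l | apply Rmin_r ].
Qed.

Section Curve.

Variables (delta phi c : R) (n : nat).
Hypothesis phi_range : 0 < phi < PI / 2.
Hypothesis c_adm : admissible_slope delta phi c.
Hypothesis n_ge2 : (2 <= n)%nat.

Lemma INR_n_ge2 : 2 <= INR n.
Proof. apply (le_INR 2), n_ge2. Qed.

Lemma inv_n_bounds : 0 < / INR n <= / 2.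
Proof.
  pose proof INR_n_ge2. split; [ apply Rinv_0_lt_compat; lra | ].
  apply Rinv_le_contravar; lra.
Qed.

Lemma slope_lt_inner_radius : c < inner_radius n.
Proof.
  destruct c_adm as (? & ? & ? & ?). pose proof inv_n_bounds. unfold inner_radius. lra.
Qed.

Lemma sin_half_bounds (t : R) : 0 <= t <= 2 * PI -> 0 <= sin (t / 2) <= 1.
Proof.
  intros Ht. split; [ apply sin_ge_0; lra | apply SIN_bound ].
Qed.

(** A point of radius R0 < 1 has real part below 1 and lies in the sector. If
    R0 >= 1 then R0 - 1 < 2 c sin(t/2), whereas the distance to 1 is at least
    2 sin(t/2). The scale may exceed 1 a little, since Cauchy's theorem needs the
    contour itself inside an open interval of scales. *)
Lemma curve_in_sector (s t : R) :
  0 < s < 1 + / INR n -> 0 <= t <= 2 * PI ->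
  sector delta phi (RtoC s * polar (inner_radius n) c t)%C.
Proof.
  intros Hs Ht.
  destruct c_adm as (Hc0 & Hc1 & Hc2 & Hc3).
  pose proof inv_n_bounds as Hn. pose proof (sin_half_bounds t Ht) as Hsin.
  set (sg := sin (t / 2)) in *.
  pose proof (radius_pos _ _ (Rlt_le _ _ Hc0) slope_lt_inner_radius t) as Hrp.
  set (R0 := s * radius (inner_radius n) c t).
  assert (HR0 : 0 < R0) by (apply Rmult_lt_0_compat; lra).
  assert (Hv : (RtoC s * polar (inner_radius n) c t)%C = (R0 * cos t, R0 * sin t)).
  { unfold polar, R0, RtoC, Cmult; simpl. f_equal; ring. }
  assert (HRlt : R0 < 1 + 2 * c * sg).
  { unfold R0, radius, inner_radius. fold sg.
    assert (s * (1 - / INR n) < 1) by nra.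
    assert (s * (c * sg) <= 2 * (c * sg)) by (apply Rmult_le_compat_r; nra). lra. }
  rewrite Hv. split.
  - assert (E : Cmod (R0 * cos t, R0 * sin t)%R = R0).
    { rewrite <- Hv, Cmod_mult, Cmod_R, (Cmod_polar _ _ (Rlt_le _ _ Hc0) slope_lt_inner_radius).
      rewrite Rabs_pos_eq by lra. reflexivity. }
    rewrite E. nra.
  - unfold Re at 1; simpl fst.
    assert (Hcos : 0 < cos phi) by (apply cos_gt_0; lra).
    pose proof (Cmod_ge_0 ((R0 * cos t, R0 * sin t)%R - 1)%C) as HC.
    pose proof (Cmod_circle_minus_1 R0 t) as HM. fold sg in HM.
    set (w := Cmod ((R0 * cos t, R0 * sin t)%R - 1)%C) in *.
    pose proof (COS_bound t).
    assert (Hre : R0 * cos t - 1 <= R0 - 1) by nra.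
    destruct (Rlt_le_dec R0 1) as [Hlt | Hge].
    + pose proof (Rmult_le_pos _ _ (Rlt_le _ _ Hcos) HC). lra.
    + assert (Hsg : 0 < sg) by nra.
      assert (Hw : 2 * sg <= w).
      { apply Rsqr_incr_0_var; [ | assumption ]. unfold Rsqr. simpl in HM. nra. }
      apply Rle_lt_trans with (R0 - 1); [ assumption | ].
      apply Rlt_le_trans with (2 * c * sg); [ lra | ].
      replace (2 * c * sg) with (c * (2 * sg)) by ring.
      apply Rmult_le_compat; lra.
Qed.

(** The squared distance is (c s - 1/n)^2 + 4 radius s^2 with s = sin(t/2); as c is
    small, the two parts cannot cancel. *)
Lemma curve_distance_bounds (t : R) :
  0 <= t <= 2 * PI ->
  (/ INR n + sin (t / 2)) / 2 <= Cmod (1 - polar (inner_radius n) c t)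
    <= 3 * (/ INR n + sin (t / 2)).
Proof.
  intros Ht.
  destruct c_adm as (Hc0 & Hc1 & Hc2 & Hc3).
  pose proof inv_n_bounds as Hn. pose proof (sin_half_bounds t Ht) as Hsin.
  rewrite Cmod_minus_sym. unfold polar.
  pose proof (Cmod_circle_minus_1 (radius (inner_radius n) c t) t) as HM.
  set (w := Cmod ((radius (inner_radius n) c t * cos t, radius (inner_radius n) c t * sin t)%R - 1)%C) in *.
  assert (Hw : 0 <= w) by apply Cmod_ge_0.
  unfold radius, inner_radius in HM. set (sg := sin (t / 2)) in *.
  set (i := / INR n) in *.
  replace (1 - i + c * sg - 1) with (c * sg - i) in HM by ring.
  assert (Hcs : 0 <= c * sg <= sg / 4) by (split; nra).
  assert (H1 : 2 * sg ^ 2 <= 4 * (1 - i + c * sg) * sg ^ 2 <= 5 * sg ^ 2).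
  { pose proof (pow2_ge_0 sg). split; apply Rmult_le_compat_r; lra. }
  simpl in *. split; apply Rsqr_incr_0_var; unfold Rsqr; nra.
Qed.

(** The radius is at least (1 - 1/n)(1 + c sin(t/2)); the n-th power of the first
    factor stays above exp(-2), and that of the second grows exponentially. *)
Lemma curve_power_bound (t : R) :
  0 <= t <= 2 * PI ->
  / radius (inner_radius n) c t ^ n
    <= exp 2 * exp (- (c / 2 * (INR n * sin (t / 2)))).
Proof.
  intros Ht.
  destruct c_adm as (Hc0 & Hc1 & Hc2 & Hc3).
  pose proof inv_n_bounds as Hn. pose proof (sin_half_bounds t Ht) as Hsin.
  pose proof INR_n_ge2 as Hn2. unfold radius, inner_radius.
  set (sg := sin (t / 2)) in *.
  assert (H1 : exp (- (2 * / INR n)) <= 1 - / INR n).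
  { rewrite exp_Ropp.
    apply Rmult_le_reg_l with (exp (2 * / INR n)); [ apply exp_pos | ].
    rewrite Rinv_r by (apply Rgt_not_eq, exp_pos).
    pose proof (exp_ineq1_le (2 * / INR n)).
    apply Rle_trans with ((1 + 2 * / INR n) * (1 - / INR n)); [ nra | ].
    apply Rmult_le_compat_r; lra. }
  assert (H2 : exp (c * sg / 2) <= 1 + c * sg).
  { pose proof (exp_ineq1_le (- (c * sg / 2))) as H. rewrite exp_Ropp in H.
    assert (0 <= c * sg <= 1 / 4) by (split; nra).
    apply Rmult_le_reg_l with (/ exp (c * sg / 2)); [ apply Rinv_0_lt_compat, exp_pos | ].
    rewrite Rinv_l by (apply Rgt_not_eq, exp_pos).
    apply Rle_trans with ((1 + - (c * sg / 2)) * (1 + c * sg)); [ nra | ].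
    apply Rmult_le_compat_r; lra. }
  assert (Hpow : forall x, exp (INR n * x) = exp x ^ n).
  { intros x. rewrite <- Rpower_pow by apply exp_pos.
    unfold Rpower. now rewrite ln_exp. }
  assert (H3 : exp (-2 + c / 2 * (INR n * sg)) <= (1 - / INR n + c * sg) ^ n).
  { replace (-2 + c / 2 * (INR n * sg)) with
      (INR n * (- (2 * / INR n) + c * sg / 2)) by (field; lra).
    rewrite Hpow. apply pow_incr. split; [ apply Rlt_le, exp_pos | ].
    rewrite exp_plus.
    apply Rle_trans with ((1 - / INR n) * (1 + c * sg)).
    - apply Rmult_le_compat; try apply Rlt_le, exp_pos; assumption.
    - assert (0 <= c * sg) by nra. nra. }
  rewrite <- exp_plus.
  replace (2 + - (c / 2 * (INR n * sg))) with (- (-2 + c / 2 * (INR n * sg))) by ring.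
  rewrite exp_Ropp. apply Rinv_le_contravar; [ apply exp_pos | exact H3 ].
Qed.

End Curve.

(** * Decay of the remainder integrals *)

(** From ln (1 + x) <= ln T + (1 + x)/T with T > |beta| / b. *)
Lemma Rpower_le_exp (beta b : R) :
  0 < b -> exists K, 0 < K /\ forall x, 0 <= x -> Rpower (1 + x) beta <= K * exp (b * x).
Proof.
  intros Hb.
  (* the bound on |beta| ln (1 + x) then has slope |beta| / T <= b *)
  set (T := Rabs beta / b + 1).
  assert (HT : 1 <= T).
  { unfold T. assert (0 <= Rabs beta / b) by (apply Rdiv_le_0_compat; [ apply Rabs_pos | lra ]).
    lra. }
  exists (exp (Rabs beta * ln T + b)). split; [ apply exp_pos | ].
  intros x Hx. unfold Rpower. rewrite <- exp_plus.
  assert (Hln : ln (1 + x) <= ln T + (1 + x) / T).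
  { assert (E : ln (1 + x) = ln T + ln ((1 + x) / T)).
    { rewrite <- ln_mult; [ f_equal; field; lra | lra | apply Rdiv_lt_0_compat; lra ]. }
    rewrite E. apply Rplus_le_compat_l.
    assert (0 < (1 + x) / T) by (apply Rdiv_lt_0_compat; lra).
    pose proof (exp_ineq1_le (ln ((1 + x) / T))) as H1.
    rewrite exp_ln in H1; lra. }
  assert (Hln0 : 0 <= ln (1 + x)).
  { rewrite <- ln_1. destruct Hx as [Hx | <-].
    - apply Rlt_le, ln_increasing; lra.
    - rewrite Rplus_0_r. lra. }
  assert (Hexp : beta * ln (1 + x) <= Rabs beta * ln T + b + b * x).
  { pose proof (Rle_abs beta). pose proof (Rabs_pos beta).
    apply Rle_trans with (Rabs beta * (ln T + (1 + x) / T)).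
    - apply Rle_trans with (Rabs beta * ln (1 + x)).
      + now apply Rmult_le_compat_r.
      + now apply Rmult_le_compat_l.
    - assert (Rabs beta * ((1 + x) / T) <= b * (1 + x)).
      { replace (Rabs beta * ((1 + x) / T)) with (Rabs beta / T * (1 + x)) by (field; lra).
        apply Rmult_le_compat_r; [ lra | ].
        apply Rmult_le_reg_r with T; [ lra | ].
        replace (Rabs beta / T * T) with (Rabs beta) by (field; lra).
        unfold T. replace (b * (Rabs beta / b + 1)) with (Rabs beta + b) by (field; lra). lra. }
      lra. }
  destruct Hexp as [Hexp | Hexp].
  - apply Rlt_le, exp_increasing. exact Hexp.
  - rewrite Hexp. lra.
Qed.

Lemma exp_le_mono (x y : R) : x <= y -> exp x <= exp y.
Proof. intros [H | ->]; [ apply Rlt_le, exp_increasing, H | lra ]. Qed.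

Lemma sin_half_lower (t : R) :
  0 <= t <= 2 * PI -> t / 6 <= sin (t / 2) \/ (2 * PI - t) / 6 <= sin (t / 2).
Proof.
  intros Ht.
  assert (H : forall x, 0 <= x <= PI / 2 -> x / 3 <= sin x).
  { intros x Hx. pose proof PI_4. pose proof PI_RGT_0.
    destruct (sin_bound x 0 ltac:(lra) ltac:(lra)) as [Hl _].
    unfold sin_approx, sin_term in Hl. simpl in Hl.
    assert (x * x <= 4) by nra. nra. }
  destruct (Rle_lt_dec t PI) as [Hle | Hlt].
  - left. pose proof (H (t / 2) ltac:(lra)). lra.
  - right. pose proof (H (PI - t / 2) ltac:(lra)) as HH. rewrite sin_PI_x in HH. lra.
Qed.

(** One of the two exponentials dominates on each half of the interval, and both
    have explicit primitives. *)
Lemma exp_sin_half_bound (b t : R) :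
  0 < b -> 0 <= t <= 2 * PI ->
  exp (- (b * sin (t / 2))) <= exp (- (b / 6) * t) + exp (- (b / 6) * (2 * PI - t)).
Proof.
  intros Hb Ht.
  pose proof (exp_pos (- (b / 6) * t)). pose proof (exp_pos (- (b / 6) * (2 * PI - t))).
  destruct (sin_half_lower t Ht) as [H1 | H1].
  - assert (exp (- (b * sin (t / 2))) <= exp (- (b / 6) * t)) by (apply exp_le_mono; nra). lra.
  - assert (exp (- (b * sin (t / 2))) <= exp (- (b / 6) * (2 * PI - t)))
      by (apply exp_le_mono; nra). lra.
Qed.

Lemma exp_sin_half_integral (K b : R) :
  0 <= K -> 0 < b ->
  exists I, is_RInt (fun t => K * (exp (- (b / 6) * t) + exp (- (b / 6) * (2 * PI - t)))) 0 (2 * PI) I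
    /\ I <= K * (12 / b).
Proof.
  intros HK Hb.
  set (F := fun t => K * (6 / b * (exp (- (b / 6) * (2 * PI - t)) - exp (- (b / 6) * t)))).
  exists (minus (F (2 * PI)) (F 0)). split.
  - apply (is_RInt_derive F); intros t _.
    + unfold F. auto_derive; [ auto | ].
      change (2 * PI + - t) with (2 * PI - t). field. lra.
    + apply (ex_derive_continuous
        (fun t => K * (exp (- (b / 6) * t) + exp (- (b / 6) * (2 * PI - t))))).
      auto_derive. auto.
  - change (F (2 * PI) - F 0 <= K * (12 / b)). unfold F.
    replace (- (b / 6) * (2 * PI - 2 * PI)) with 0 by ring.
    replace (- (b / 6) * 0) with 0 by ring. rewrite Rminus_0_r, exp_0.
    set (e := exp (- (b / 6) * (2 * PI))).
    assert (0 < e) by apply exp_pos.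
    rewrite <- Rmult_minus_distr_l. apply Rmult_le_compat_l; [ assumption | ].
    assert (0 < 6 / b) by (apply Rdiv_lt_0_compat; lra).
    replace (12 / b) with (6 / b * 2) by (field; lra). nra.
Qed.

Lemma Rpower_comparable (alpha x u : R) :
  0 < u -> u / 2 <= x <= 3 * u ->
  Rpower x alpha <= Rpower 3 (Rabs alpha) * Rpower u alpha.
Proof.
  intros Hu Hx. unfold Rpower. rewrite <- exp_plus. apply exp_le_mono.
  assert (H3 : 0 < ln 3) by (rewrite <- ln_1; apply ln_increasing; lra).
  assert (E : Rabs (ln x - ln u) <= ln 3).
  { assert (U : ln x <= ln 3 + ln u) by (rewrite <- ln_mult by lra; apply ln_le; lra).
    assert (L : ln u <= ln 3 + ln x) by (rewrite <- ln_mult by lra; apply ln_le; lra).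
    apply Rabs_le. lra. }
  assert (Rabs (alpha * (ln x - ln u)) <= Rabs alpha * ln 3).
  { rewrite Rabs_mult. apply Rmult_le_compat_l; [ apply Rabs_pos | exact E ]. }
  pose proof (Rle_abs (alpha * (ln x - ln u))). lra.
Qed.

(** The range up to 6 covers the distances from 1 to the points of the contour. A
    bound on all positive reals would exclude the term M x^(-alpha) that absorbs
    U_h when alpha < 0. *)
Definition small_at_0 (omega : R -> R) : Prop :=
  (exists M, forall x, 0 < x <= 6 -> 0 <= omega x <= M) /\
  (forall eps, 0 < eps -> exists eta, 0 < eta /\ forall x, 0 < x < eta -> omega x <= eps).

(** On the contour the integrand is at most a constant times
    n^(-alpha) omega(|1-v|) (1 + n s)^alpha exp(- c n s / 2), with s = sin(t/2).
    A quarter of the exponential rate c n absorbs the power, an eighth turns the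
    bounded omega into a small constant, and the last eighth is integrated, which
    gives the extra factor 1/n. *)
Lemma curve_integral_small (delta phi c alpha : R) (omega : R -> R) :
  0 < delta -> 0 < phi < PI / 2 -> admissible_slope delta phi c -> small_at_0 omega ->
  forall eps, 0 < eps -> exists N, forall n, (N <= n)%nat -> forall f df : C -> C,
    holomorphic (sector delta phi) f df ->
    (forall v, sector delta phi v ->
       Cmod (f v) <= omega (Cmod (1 - v)) * Rpower (Cmod (1 - v)) alpha) ->
    Cmod (coef (inner_radius n) c n f) <= eps * Rpower (INR n) (- alpha - 1).
Proof.
  intros Hdelta Hphi Hadm [[M HM] Hsmall] eps Heps.
  pose proof Hadm as (Hc0 & Hc1 & Hc2 & Hc3).
  destruct (Rpower_le_exp alpha (c / 4) ltac:(lra)) as (K & HK & HKb).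
  set (P := Rpower 3 (Rabs alpha)).
  assert (HP : 0 < P) by apply exp_pos.
  assert (HM0 : 0 <= M) by (destruct (HM 1 ltac:(lra)); lra).
  pose proof (exp_pos 2) as He2.
  set (B := P * K * exp 2 * 2).
  assert (HB : 0 < B) by (unfold B; apply Rmult_lt_0_compat; [ apply Rmult_lt_0_compat; [ now apply Rmult_lt_0_compat | assumption ] | lra ]).
  set (e1 := eps * c / (192 * B)).
  assert (He1 : 0 < e1).
  { unfold e1. apply Rdiv_lt_0_compat; [ now apply Rmult_lt_0_compat | lra ]. }
  destruct (Hsmall e1 He1) as (eta & Heta & Homega).
  destruct (INR_unbounded (Rmax (6 / eta) (48 * M / (c * eta * e1)))) as [N HN].
  exists (Nat.max 2 N). intros n Hn f df Hf Hbound.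
  assert (Hn2 : (2 <= n)%nat) by lia.
  pose proof (INR_n_ge2 n Hn2) as Hn2r.
  pose proof (inv_n_bounds n Hn2) as Hinv.
  assert (HnN : Rmax (6 / eta) (48 * M / (c * eta * e1)) < INR n).
  { eapply Rlt_le_trans; [ apply HN | apply le_INR; lia ]. }
  pose proof (Rmax_l (6 / eta) (48 * M / (c * eta * e1))) as HN1.
  pose proof (Rmax_r (6 / eta) (48 * M / (c * eta * e1))) as HN2.
  assert (HnE : 6 < INR n * eta).
  { apply Rmult_lt_reg_r with (/ eta); [ now apply Rinv_0_lt_compat | ].
    replace (INR n * eta * / eta) with (INR n) by (field; lra).
    change (6 / eta < INR n). lra. }
  pose proof (slope_lt_inner_radius delta phi c n Hadm Hn2) as Hca.
  set (g := polar (inner_radius n) c).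
  pose proof (curve_in_sector delta phi c n Hphi Hadm Hn2) as Hin.
  set (nn := INR n) in *.
  (* the modulus is small near 1, and the exponential beats it elsewhere *)
  assert (Hmod : forall t, 0 <= t <= 2 * PI ->
     0 < Cmod (1 - g t) /\
     omega (Cmod (1 - g t)) * exp (- (c / 8 * (nn * sin (t / 2)))) <= e1).
  { intros t Ht.
    pose proof (curve_distance_bounds delta phi c n Hadm Hn2 t Ht) as Hd.
    pose proof (sin_half_bounds t Ht) as Hs.
    fold g in Hd. fold nn in Hd. set (sg := sin (t / 2)) in *. set (x := Cmod (1 - g t)) in *.
    assert (Hx : 0 < x <= 6) by lra. split; [ lra | ].
    assert (Hexp1 : exp (- (c / 8 * (nn * sg))) <= 1).
    { rewrite <- exp_0. apply exp_le_mono.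
      assert (0 <= nn * sg) by nra. nra. }
    pose proof (exp_pos (- (c / 8 * (nn * sg)))) as Hexp0.
    pose proof (HM x Hx) as HMx.
    destruct (Rlt_le_dec x eta) as [Hlt | Hge].
    - pose proof (Homega x ltac:(lra)). nra.
    - assert (Hns : nn * eta / 6 <= nn * sg).
      { assert (nn * eta <= nn * (3 * (/ nn + sg))) by (apply Rmult_le_compat_l; lra).
        replace (nn * (3 * (/ nn + sg))) with (3 + 3 * (nn * sg)) in H by (field; lra). lra. }
      set (y := c / 8 * (nn * sg)) in *.
      assert (Hy : c * eta * nn / 48 <= y) by (unfold y; nra).
      assert (Hy0 : 0 < c * eta * nn / 48).
      { assert (0 < c * eta) by now apply Rmult_lt_0_compat.
        assert (0 < c * eta * nn) by (apply Rmult_lt_0_compat; lra). lra. }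
      apply Rle_trans with (M * / y).
      + apply Rmult_le_compat; try lra.
        rewrite exp_Ropp. apply Rinv_le_contravar; [ lra | ].
        pose proof (exp_ineq1_le y). lra.
      + apply Rmult_le_reg_r with y; [ lra | ].
        replace (M * / y * y) with M by (field; lra).
        apply Rle_trans with (e1 * (c * eta * nn / 48)); [ | apply Rmult_le_compat_l; lra ].
        assert (HH : 48 * M / (c * eta * e1) < nn) by lra.
        assert (0 < c * eta * e1).
        { apply Rmult_lt_0_compat; [ now apply Rmult_lt_0_compat | assumption ]. }
        apply Rmult_lt_compat_r with (r := c * eta * e1) in HH; [ | assumption ].
        replace (48 * M / (c * eta * e1) * (c * eta * e1)) with (48 * M) in HH by (field; lra).
        lra. }
  destruct (exp_sin_half_integral (B * Rpower nn (- alpha) * e1) (c / 8 * nn)) as (I & HI & HIle).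
  { apply Rmult_le_pos; [ | lra ]. apply Rmult_le_pos; [ lra | apply Rlt_le, exp_pos ]. }
  { apply Rmult_lt_0_compat; lra. }
  apply Rle_trans with (2 * I).
  - unfold coef.
    eapply (CInt_bound (2 * PI)); [ pose proof PI_RGT_0; lra | | | exact HI ].
    + apply (continuous_along_integrand (inner_radius n) c (Rlt_le _ _ Hc0) Hca
        (sector delta phi) (1 + / nn) ltac:(lra) Hin n f df Hf).
    + intros t Ht.
      destruct (Hmod t Ht) as [Hx0 Hom].
      pose proof (curve_distance_bounds delta phi c n Hadm Hn2 t Ht) as Hd.
      pose proof (sin_half_bounds t Ht) as Hs.
      pose proof (curve_power_bound delta phi c n Hadm Hn2 t Ht) as Hpw.
      pose proof (Cmod_polar_log (inner_radius n) c (Rlt_le _ _ Hc0) Hca t Ht) as Hlog.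
      pose proof (exp_sin_half_bound (c / 8 * nn) t ltac:(apply Rmult_lt_0_compat; lra) Ht) as Hes.
      assert (Hg : sector delta phi (g t)).
      { unfold g. rewrite <- (Cmult_1_l (polar _ _ t)). apply Hin; [ lra | exact Ht ]. }
      pose proof (Hbound (g t) Hg) as Hfb.
      fold g in Hd. fold nn in Hd, Hpw. fold g.
      set (sg := sin (t / 2)) in *. set (x := Cmod (1 - g t)) in *.
      pose proof (HM x ltac:(lra)) as HMx.
      assert (Hpow : Rpower x alpha <= P * (Rpower nn (- alpha) * (K * exp (c / 4 * (nn * sg))))).
      { eapply Rle_trans; [ apply (Rpower_comparable alpha x (/ nn + sg)); lra | ].
        apply Rmult_le_compat_l; [ lra | ].
        replace (/ nn + sg) with (/ nn * (1 + nn * sg)) by (field; lra).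
        assert (0 <= nn * sg) by nra.
        rewrite <- Rpower_mult_distr by lra.
        rewrite Rpower_Ropp.
        replace (/ Rpower nn alpha) with (Rpower (/ nn) alpha).
        - apply Rmult_le_compat_l; [ apply Rlt_le, exp_pos | apply HKb; assumption ].
        - unfold Rpower. rewrite ln_Rinv by lra. rewrite <- exp_Ropp. f_equal. ring. }
      assert (Hlog2 : Cmod (polar_log (inner_radius n) c t) <= 2).
      { eapply Rle_trans; [ exact Hlog | ].
        assert (c / inner_radius n <= 1).
        { apply Rmult_le_reg_r with (inner_radius n); [ lra | ].
          replace (c / inner_radius n * inner_radius n) with c by (field; lra). lra. }
        lra. }
      rewrite !Cmod_mult, Cmod_pow, Cmod_inv by
        (apply polar_neq0; lra).
      unfold g at 2. rewrite (Cmod_polar _ _ (Rlt_le _ _ Hc0) Hca), pow_inv.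
      set (E4 := exp (c / 4 * (nn * sg))) in *.
      assert (HE : exp (- (c / 2 * (nn * sg)))
         = / E4 * exp (- (c / 8 * (nn * sg))) * exp (- (c / 8 * nn * sg))).
      { unfold E4. rewrite <- exp_Ropp, <- !exp_plus. f_equal. field. }
      set (X := exp (- (c / 8 * (nn * sg)))) in *.
      assert (HX : 0 < X) by apply exp_pos.
      assert (HE4 : 0 < E4) by apply exp_pos.
      set (Y := exp (- (c / 8 * nn * sg))) in *.
      assert (HY : 0 < Y) by apply exp_pos.
      set (Q := Rpower nn (- alpha)) in *.
      assert (HQ : 0 < Q) by apply exp_pos.
      assert (Hrad : 0 < radius (inner_radius n) c t) by (apply radius_pos; lra).
      apply Rle_trans with
        ((omega x * (P * (Q * (K * E4)))) * ((exp 2 * (/ E4 * X * Y)) * 2)).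
      * apply Rmult_le_compat.
        -- apply Cmod_ge_0.
        -- apply Rmult_le_pos; [ | apply Cmod_ge_0 ].
           apply Rlt_le, Rinv_0_lt_compat, pow_lt, Hrad.
        -- eapply Rle_trans; [ exact Hfb | ]. apply Rmult_le_compat_l; [ lra | exact Hpow ].
        -- apply Rmult_le_compat.
           ++ apply Rlt_le, Rinv_0_lt_compat, pow_lt, Hrad.
           ++ apply Cmod_ge_0.
           ++ rewrite <- HE. exact Hpw.
           ++ exact Hlog2.
      * replace (omega x * (P * (Q * (K * E4))) * (exp 2 * (/ E4 * X * Y) * 2)) with
          ((B * Q) * ((omega x * X) * Y)) by (unfold B; field; lra).
        replace (B * Q * e1 * (exp (- (c / 8 * nn / 6) * t) + exp (- (c / 8 * nn / 6) * (2 * PI - t))))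
          with ((B * Q) * (e1 * (exp (- (c / 8 * nn / 6) * t) + exp (- (c / 8 * nn / 6) * (2 * PI - t)))))
          by ring.
        apply Rmult_le_compat_l; [ apply Rmult_le_pos; lra | ].
        apply Rmult_le_compat; try lra. apply Rmult_le_pos; lra.
  - replace (Rpower nn (- alpha - 1)) with (Rpower nn (- alpha) * / nn).
    2: { unfold Rminus. rewrite Rpower_plus, (Rpower_Ropp nn 1), Rpower_1 by lra. reflexivity. }
    apply Rle_trans with (2 * (B * Rpower nn (- alpha) * e1 * (12 / (c / 8 * nn)))); [ lra | ].
    right. unfold e1. field. repeat split; lra.
Qed.

(** * Coefficients of the power *)

(** The coefficients of (1 - v)^alpha. *)
Fixpoint power_coef (alpha : R) (n : nat) : R :=
  match n with
  | 0%nat => 1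
  | S m => power_coef alpha m * ((INR m - alpha) / INR (S m))
  end.

Lemma sector_0 (delta phi : R) : 0 < delta -> 0 < phi < PI / 2 -> sector delta phi 0.
Proof.
  intros Hd Hphi. assert (0 < cos phi) by (apply cos_gt_0; lra).
  split; [ rewrite Cmod_0; lra | ].
  replace (0 - 1)%C with (- (1))%C by ring. rewrite Cmod_opp, Cmod_1.
  unfold Re; simpl. lra.
Qed.

(** For f(z) = (1 - z)^alpha one has (1 - z) f' = - alpha f, so the derivative of
    f(z) (1 - z) z^(-n-1) is (n - alpha) f z^(-n-1) - (n + 1) f z^(-n-2). Its
    integral vanishes, which is the recursion of [power_coef]. *)
Lemma coef_Cpower (delta phi a c b alpha : R) (n : nat) :
  0 < delta -> 0 < phi < PI / 2 -> 0 <= c -> c < a -> 1 < b ->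
  (forall s t, 0 < s < b -> 0 <= t <= 2 * PI -> sector delta phi (RtoC s * polar a c t)%C) ->
  coef a c n (fun v => Cpower (1 - v) alpha) = (RtoC (power_coef alpha n) * (0, 2 * PI)%R)%C.
Proof.
  intros Hd Hphi Hc Hca Hb Hin.
  set (f := fun v => Cpower (1 - v) alpha).
  set (df := fun v => (- RtoC alpha * Cpower (1 - v) alpha * / (1 - v))%C).
  assert (Hf : holomorphic (sector delta phi) f df).
  { intros v Hv. apply strict_deriv_Cpower_1_minus. eapply sector_slit; eassumption. }
  assert (Hpi := PI_RGT_0).
  induction n as [ | n IH ].
  - rewrite Cmult_1_l.
    transitivity (CInt (fun t => f (polar a c t) * polar_log a c t)%C 0 (2 * PI)).
    { unfold coef. apply CInt_ext. intros t _. simpl. ring. }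
    rewrite (integral_eq_limit_at_0 a c Hc Hca (sector delta phi) b
       (sector_open delta phi) Hb Hin f df 1).
    + ring.
    + intros v [Hv _]. now apply Hf.
    + intros eps He.
      destruct (strict_deriv_continuous f 0 (df 0)
        (Hf 0 (sector_0 delta phi Hd Hphi)) eps He) as (d & Hdp & H).
      exists d. split; [ assumption | ]. intros z Hz _.
      replace (RtoC 1) with (f 0); [ now apply H | ].
      unfold f. replace (1 - 0)%C with (RtoC 1) by ring. apply Cpower_1.
  - pose proof (integral_deriv_eq_0 a c Hc Hca (sector delta phi) b
       (sector_open delta phi) Hb Hin
       (fun z => f z * (1 - z) * (/ z) ^ S n)%C
       (fun z => (df z * (1 - z) + f z * - (1)) * (/ z) ^ S n
          + (f z * (1 - z)) * (- INR (S n) * (/ z) ^ S (S n)))%C) as H.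
    assert (HH : (RtoC (INR n - alpha) * coef a c n f
                  + - RtoC (INR (S n)) * coef a c (S n) f)%C = 0).
    { rewrite <- H.
      - unfold coef. rewrite <- !CInt_scal, <- CInt_plus; try lra.
        + apply CInt_ext. rewrite Rmin_left, Rmax_right by lra. intros t Ht.
          assert (Hs : slit (1 - polar a c t)%C).
          { apply (sector_slit delta phi). rewrite <- (Cmult_1_l (polar a c t)).
            apply Hin; lra. }
          assert (Hs0 := slit_neq0 _ Hs).
          assert (Hg := polar_neq0 a c Hc Hca t).
          unfold df. fold (f (polar a c t)). rewrite !(Cpow_S (/ polar a c t)).
          rewrite S_INR, !RtoC_plus, RtoC_minus. field. split; assumption.
        + apply (continuous_along_mult _ (fun _ => _)); [ apply continuous_along_const | ].
          eapply (continuous_along_integrand a c Hc Hca (sector delta phi) b Hb Hin); exact Hf.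
        + apply (continuous_along_mult _ (fun _ => _)); [ apply continuous_along_const | ].
          eapply (continuous_along_integrand a c Hc Hca (sector delta phi) b Hb Hin); exact Hf.
        + eapply (continuous_along_integrand a c Hc Hca (sector delta phi) b Hb Hin); exact Hf.
        + eapply (continuous_along_integrand a c Hc Hca (sector delta phi) b Hb Hin); exact Hf.
      - intros z [Hz Hz0].
        apply (strict_deriv_mult (fun z => f z * (1 - z))%C (fun z => (/ z) ^ S n)%C);
          [ | now apply strict_deriv_inv_pow ].
        apply (strict_deriv_mult f (fun z => 1 - z)%C); [ now apply Hf | ].
        replace (- (1))%C with (0 + - (1) * 1)%C by ring.
        apply strict_deriv_ext with (fun x => 1 + - (1) * x)%C; [ intros x; ring | ].
        apply (strict_deriv_plus (fun _ => RtoC 1)); [ apply strict_deriv_const | ].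
        apply (strict_deriv_scal _ (fun x => x)), strict_deriv_id. }
    assert (Hn : RtoC (INR (S n)) <> 0).
    { intros E. apply RtoC_inj in E. apply (not_0_INR (S n)); [ lia | exact E ]. }
    rewrite IH in HH.
    cbn [power_coef]. rewrite RtoC_mult, RtoC_div.
    2: { apply not_0_INR. lia. }
    transitivity (/ RtoC (INR (S n)) * (RtoC (INR n - alpha) *
        (RtoC (power_coef alpha n) * (0, 2 * PI)%R)
       - (RtoC (INR n - alpha) * (RtoC (power_coef alpha n) * (0, 2 * PI)%R)
           + - RtoC (INR (S n)) * coef a c (S n) f)))%C.
    + field. exact Hn.
    + rewrite HH. field. exact Hn.
Qed.

Lemma ln_le_sub_1 (y : R) : 0 < y -> ln y <= y - 1.
Proof.
  intros Hy. pose proof (exp_ineq1_le (ln y)) as H. rewrite exp_ln in H; lra.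
Qed.

(** The ratio of consecutive moduli is 1 - beta/(n+1) with beta = alpha + 1, and
    it differs from (n/(n+1))^beta by a factor 1 + O(1/n^2). The logarithm of the
    normalised modulus n^beta |a_n| therefore decreases by at most D/(n(n+1)) at
    each step, and these losses telescope. No factor vanishes, as alpha is not a
    natural number. *)
Lemma power_coef_lower_bound (alpha : R) :
  (forall k : nat, alpha <> INR k) ->
  exists C0 N, 0 < C0 /\ forall n, (N <= n)%nat ->
    C0 * Rpower (INR n) (- alpha - 1) <= Rabs (power_coef alpha n).
Proof.
  intros Halpha.
  set (beta := alpha + 1). set (D := 2 * beta ^ 2 + Rabs beta).
  assert (Hfac : forall n, (INR n - alpha) / INR (S n) <> 0).
  { intros n. apply Rmult_integral_contrapositive_currified.
    - pose proof (Halpha n). lra.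
    - apply Rinv_neq_0_compat, not_0_INR. lia. }
  assert (Hne : forall n, power_coef alpha n <> 0).
  { induction n as [ | n IH ]; [ simpl; lra | ].
    cbn [power_coef]. now apply Rmult_integral_contrapositive_currified. }
  destruct (INR_unbounded (2 * Rabs beta + 1)) as [N HN].
  pose proof (Rabs_pos beta) as Hb0.
  assert (HD : 0 <= D) by (unfold D; pose proof (pow2_ge_0 beta); lra).
  (* the logarithm of the normalised modulus, corrected by -D/n, increases *)
  set (u := fun n => ln (Rabs (power_coef alpha n)) + beta * ln (INR n) - D / INR n).
  assert (Hstep : forall n, (N <= n)%nat -> u n <= u (S n)).
  { intros n Hn. unfold u. cbn [power_coef].
    assert (Hnr : 2 * Rabs beta + 1 < INR n).
    { eapply Rlt_le_trans; [ apply HN | now apply le_INR ]. }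
    rewrite Rabs_mult, ln_mult by (apply Rabs_pos_lt; auto).
    rewrite S_INR. set (x := INR n) in *.
    replace ((x - alpha) / (x + 1)) with (1 - beta / (x + 1)) by (unfold beta; field; lra).
    set (e := beta / (x + 1)).
    assert (He : Rabs e <= 1 / 2).
    { unfold e, Rdiv. rewrite Rabs_mult, (Rabs_pos_eq (/ (x + 1)))
        by (apply Rlt_le, Rinv_0_lt_compat; lra).
      apply Rmult_le_reg_r with (x + 1); [ lra | ].
      replace (Rabs beta * / (x + 1) * (x + 1)) with (Rabs beta) by (field; lra). lra. }
    assert (Hln : - e - 2 * e ^ 2 <= ln (Rabs (1 - e))).
    { apply Rabs_le_between in He. rewrite Rabs_pos_eq by lra.
      rewrite <- (ln_exp (- e - 2 * e ^ 2)). apply ln_le; [ apply exp_pos | ].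
      pose proof (exp_ineq1_le (e + 2 * e ^ 2)) as H1.
      replace (- e - 2 * e ^ 2) with (- (e + 2 * e ^ 2)) by ring. rewrite exp_Ropp.
      pose proof (pow2_ge_0 e).
      apply Rmult_le_reg_l with (exp (e + 2 * e ^ 2)); [ apply exp_pos | ].
      rewrite Rinv_r by (apply Rgt_not_eq, exp_pos).
      apply Rle_trans with ((1 + (e + 2 * e ^ 2)) * (1 - e)); [ | apply Rmult_le_compat_r; lra ].
      replace ((1 + (e + 2 * e ^ 2)) * (1 - e)) with (1 + e ^ 2 * (1 - 2 * e)) by ring.
      nra. }
    assert (Hup : ln (x + 1) - ln x <= / x).
    { rewrite <- ln_div by lra.
      replace (/ x) with ((x + 1) / x - 1) by (field; lra).
      apply ln_le_sub_1, Rdiv_lt_0_compat; lra. }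
    assert (Hlow : / (x + 1) <= ln (x + 1) - ln x).
    { assert (ln x - ln (x + 1) <= - / (x + 1)); [ | lra ].
      rewrite <- ln_div by lra.
      replace (- / (x + 1)) with (x / (x + 1) - 1) by (field; lra).
      apply ln_le_sub_1, Rdiv_lt_0_compat; lra. }
    set (p := / (x * (x + 1))).
    assert (Hp : 0 < p) by (apply Rinv_0_lt_compat, Rmult_lt_0_compat; lra).
    assert (Ep : / x = / (x + 1) + p) by (unfold p; field; lra).
    assert (Hbl : e - Rabs beta * p <= beta * (ln (x + 1) - ln x)).
    { unfold e, Rdiv. destruct (Rle_lt_dec 0 beta) as [Hb | Hb].
      - rewrite Rabs_pos_eq by assumption.
        assert (beta * / (x + 1) <= beta * (ln (x + 1) - ln x))
          by now apply Rmult_le_compat_l.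
        assert (0 <= beta * p) by (apply Rmult_le_pos; lra). lra.
      - rewrite Rabs_left by assumption. rewrite Ep in Hup. nra. }
    assert (He2 : e ^ 2 <= beta ^ 2 * p).
    { unfold e, p. replace ((beta / (x + 1)) ^ 2) with (beta ^ 2 * / ((x + 1) * (x + 1)))
        by (field; lra).
      apply Rmult_le_compat_l; [ apply pow2_ge_0 | ].
      apply Rinv_le_contravar; [ apply Rmult_lt_0_compat; lra | ].
      apply Rmult_le_compat_r; lra. }
    assert (HDp : D / x - D / (x + 1) = D * p) by (unfold p; field; lra).
    assert (D * p = 2 * (beta ^ 2 * p) + Rabs beta * p) by (unfold D; ring).
    lra. }
  exists (exp (u N)), N. split; [ apply exp_pos | ].
  intros n Hn.
  assert (Hmono : u N <= u n).
  { induction Hn as [ | m Hm IH ]; [ lra | ].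
    eapply Rle_trans; [ exact IH | now apply Hstep ]. }
  assert (Hnr : 2 * Rabs beta + 1 < INR n).
  { eapply Rlt_le_trans; [ apply HN | now apply le_INR ]. }
  rewrite <- (exp_ln (Rabs (power_coef alpha n))) by (apply Rabs_pos_lt; auto).
  unfold Rpower. rewrite <- exp_plus. apply exp_le_mono.
  assert (0 <= D / INR n) by (apply Rdiv_le_0_compat; lra).
  unfold u in Hmono at 2. replace (- alpha - 1) with (- beta) by (unfold beta; ring). lra.
Qed.

(** * Transfer to coefficients *)

(** [y] is the Taylor series of [f] at 0, in the weak sense that suffices for
    [coef_taylor]. *)
Definition has_taylor (y : nat -> C) (f : C -> C) : Prop :=
  forall n, exists K, near 0 (fun v => Cmod (f v - taylor_poly y n v) <= K * Cmod v ^ S n).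

Lemma Cmod_2_pi_i : Cmod (0, 2 * PI)%R = 2 * PI.
Proof.
  pose proof PI_RGT_0.
  replace ((0, 2 * PI)%R : C) with (RtoC (2 * PI) * Ci)%C
    by (unfold Ci, RtoC, Cmult; simpl; f_equal; ring).
  rewrite Cmod_mult, Cmod_Ci, Cmod_R, Rabs_pos_eq; lra.
Qed.

(** The threshold [N] depends only on the sector, on alpha and on omega, hence is
    common to all the functions [f]: this is where uniformity in h comes from. *)
Lemma coefficient_transfer (delta phi alpha : R) (omega : R -> R) :
  0 < delta -> 0 < phi < PI / 2 -> small_at_0 omega ->
  forall eps, 0 < eps -> exists N, forall n, (N <= n)%nat ->
  forall (f df w dw : C -> C) (A : C) (y u : nat -> C),
    holomorphic (sector delta phi) f df -> holomorphic (sector delta phi) w dw ->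
    has_taylor y f -> has_taylor u w ->
    (forall v, sector delta phi v ->
       Cmod (f v - w v - A * Cpower (1 - v) alpha)
         <= omega (Cmod (1 - v)) * Rpower (Cmod (1 - v)) alpha) ->
    Cmod (y n - u n - A * RtoC (power_coef alpha n)) <= eps * Rpower (INR n) (- alpha - 1).
Proof.
  intros Hdelta Hphi Hom eps Heps.
  destruct (exists_admissible_slope delta phi Hdelta Hphi) as [c Hadm].
  pose proof Hadm as (Hc0 & _). apply Rlt_le in Hc0.
  destruct (curve_integral_small delta phi c alpha omega Hdelta Hphi Hadm Hom eps Heps)
    as [N HN].
  exists (Nat.max 2 N). intros n Hn f df w dw A y u Hf Hw Hy Hu Hb.
  assert (Hn2 : (2 <= n)%nat) by lia.
  pose proof (slope_lt_inner_radius delta phi c n Hadm Hn2) as Hca.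
  pose proof (inv_n_bounds n Hn2) as Hinv.
  assert (Hb1 : 1 < 1 + / INR n) by lra.
  pose proof (curve_in_sector delta phi c n Hphi Hadm Hn2) as Hin.
  pose proof (sector_open delta phi) as Hop.
  set (a := inner_radius n) in *. set (b := 1 + / INR n) in *.
  set (p := fun v => Cpower (1 - v) alpha).
  set (dp := fun v => (- RtoC alpha * Cpower (1 - v) alpha * / (1 - v))%C).
  assert (Hp : holomorphic (sector delta phi) p dp).
  { intros v Hv. apply strict_deriv_Cpower_1_minus. eapply sector_slit; eassumption. }
  assert (Hwp : holomorphic (sector delta phi) (fun v => - (1) * w v + - A * p v)%C
      (fun v => - (1) * dw v + - A * dp v)%C).
  { intros v Hv. apply (strict_deriv_plus (fun v => - (1) * w v)%C).
    - apply strict_deriv_scal. now apply Hw.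
    - apply strict_deriv_scal. now apply Hp. }
  assert (Hg : holomorphic (sector delta phi) (fun v => f v + (- (1) * w v + - A * p v))%C
      (fun v => df v + (- (1) * dw v + - A * dp v))%C).
  { intros v Hv. apply (strict_deriv_plus f); [ now apply Hf | now apply Hwp ]. }
  specialize (HN n ltac:(lia) _ _ Hg).
  assert (Ecoef : coef a c n (fun v => f v + (- (1) * w v + - A * p v))%C
    = ((y n - u n - A * RtoC (power_coef alpha n)) * (0, 2 * PI)%R)%C).
  { rewrite (coef_plus a c Hc0 Hca (sector delta phi) b Hb1 Hin n f df _ _ Hf Hwp).
    rewrite (coef_plus a c Hc0 Hca (sector delta phi) b Hb1 Hin n
       (fun v => - (1) * w v)%C (fun v => - (1) * dw v)%C
       (fun v => - A * p v)%C (fun v => - A * dp v)%C).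
    2: { intros v Hv. apply strict_deriv_scal. now apply Hw. }
    2: { intros v Hv. apply strict_deriv_scal. now apply Hp. }
    rewrite (coef_scal a c Hc0 Hca (sector delta phi) b Hb1 Hin n _ w dw Hw).
    rewrite (coef_scal a c Hc0 Hca (sector delta phi) b Hb1 Hin n _ p dp Hp).
    rewrite (coef_taylor a c Hc0 Hca (sector delta phi) b Hop Hb1 Hin n y f df Hf (Hy n)).
    rewrite (coef_taylor a c Hc0 Hca (sector delta phi) b Hop Hb1 Hin n u w dw Hw (Hu n)).
    unfold p. rewrite (coef_Cpower delta phi a c b alpha n Hdelta Hphi Hc0 Hca Hb1 Hin).
    ring. }
  fold a in HN. rewrite Ecoef, Cmod_mult, Cmod_2_pi_i in HN.
  assert (HB : Cmod (y n - u n - A * RtoC (power_coef alpha n)) * (2 * PI)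
     <= eps * Rpower (INR n) (- alpha - 1)).
  { apply HN. intros v Hv.
    replace (f v + (- (1) * w v + - A * p v))%C with (f v - w v - A * Cpower (1 - v) alpha)%C
      by (unfold p; ring).
    now apply Hb. }
  pose proof (Cmod_ge_0 (y n - u n - A * RtoC (power_coef alpha n))). pose proof PI2_1. nra.
Qed.

(** Cauchy's estimate on the circle of radius [R0]. *)
Lemma ball_coefficient_bound (R1 R0 M : R) (f df : C -> C) (u : nat -> C) (n : nat) :
  0 < R0 -> R0 < R1 ->
  holomorphic (fun v => Cmod v < R1) f df -> (forall v, Cmod v < R1 -> Cmod (f v) <= M) ->
  has_taylor u f -> Cmod (u n) <= 2 * M * / R0 ^ n.
Proof.
  intros HR0 HR1 Hf HM Hu.
  pose proof PI_RGT_0 as Hpi.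
  set (b := R1 / R0).
  assert (Hb : 1 < b).
  { apply Rmult_lt_reg_r with R0; [ assumption | ]. unfold b.
    replace (R1 / R0 * R0) with R1 by (field; lra). lra. }
  assert (Hrad : forall t, radius R0 0 t = R0) by (intros t; unfold radius; ring).
  assert (Hin : forall s t, 0 < s < b -> 0 <= t <= 2 * PI ->
     Cmod (RtoC s * polar R0 0 t) < R1).
  { intros s t Hs Ht. rewrite Cmod_mult, Cmod_R, Cmod_polar, Hrad, Rabs_pos_eq by lra.
    replace R1 with (b * R0) by (unfold b; field; lra). apply Rmult_lt_compat_r; lra. }
  assert (Hopen := is_open_ball R1).
  pose proof (coef_taylor R0 0 (Rle_refl 0) HR0 (fun v => Cmod v < R1) b Hopen Hb Hin
    n u f df Hf (Hu n)) as E.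
  assert (B : Cmod (coef R0 0 n f) <= 2 * ((2 * PI - 0) * (M * / R0 ^ n))).
  { apply (CInt_bound (2 * PI) _ (fun _ => M * / R0 ^ n)).
    - lra.
    - apply (continuous_along_integrand R0 0 (Rle_refl 0) HR0 (fun v => Cmod v < R1) b Hb Hin
        n f df Hf).
    - intros t Ht. rewrite !Cmod_mult, Cmod_pow, Cmod_inv by (apply polar_neq0; lra).
      rewrite Cmod_polar, Hrad by lra.
      pose proof (Cmod_polar_log R0 0 (Rle_refl 0) HR0 t Ht) as Hl.
      replace (0 / R0 + 1) with 1 in Hl by (field; lra).
      apply Rmult_le_compat; [ apply Cmod_ge_0 | | | ].
      + apply Rmult_le_pos; [ | apply Cmod_ge_0 ].
        apply pow_le, Rlt_le, Rinv_0_lt_compat; lra.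
      + apply HM. rewrite <- (Cmult_1_l (polar R0 0 t)). apply Hin; lra.
      + rewrite pow_inv. rewrite <- (Rmult_1_r (/ R0 ^ n)) at 2.
        apply Rmult_le_compat_l; [ | exact Hl ].
        apply Rlt_le, Rinv_0_lt_compat, pow_lt; lra.
    - apply (is_RInt_const (V := R_NormedModule)). }
  rewrite E, Cmod_mult, Cmod_2_pi_i in B.
  apply Rmult_le_reg_r with (2 * PI); [ lra | ].
  lra.
Qed.

Lemma geometric_negligible (R0 M beta : R) :
  1 < R0 -> 0 <= M -> forall eps, 0 < eps -> exists N, forall n, (N <= n)%nat ->
    M * / R0 ^ n <= eps * Rpower (INR n) beta.
Proof.
  intros HR HM eps Heps.
  assert (Hl : 0 < ln R0) by (rewrite <- ln_1; apply ln_increasing; lra).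
  destruct (Rpower_le_exp (1 - beta) (ln R0) Hl) as (K & HK & HKb).
  set (T := M * K * R0 / eps).
  destruct (INR_unbounded (Rmax 1 T)) as [N HN]. exists N. intros n Hn.
  assert (HnN : Rmax 1 T < INR n) by (eapply Rlt_le_trans; [ apply HN | now apply le_INR ]).
  pose proof (Rmax_l 1 T). pose proof (Rmax_r 1 T).
  set (x := INR n) in *.
  pose proof (HKb (x - 1) ltac:(lra)) as HB. replace (1 + (x - 1)) with x in HB by ring.
  assert (Hpw : exp (ln R0 * (x - 1)) = R0 ^ n / R0).
  { replace (ln R0 * (x - 1)) with (x * ln R0 + - ln R0) by ring.
    rewrite exp_plus, exp_Ropp, exp_ln by lra.
    change (exp (x * ln R0)) with (Rpower R0 x). unfold x. rewrite Rpower_pow by lra.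
    reflexivity. }
  rewrite Hpw in HB.
  assert (Hs : x = Rpower x (1 - beta) * Rpower x beta).
  { rewrite <- Rpower_plus. replace (1 - beta + beta) with 1 by ring.
    rewrite Rpower_1; lra. }
  assert (HRn : 0 < R0 ^ n) by (apply pow_lt; lra).
  assert (Hpb : 0 < Rpower x beta) by apply exp_pos.
  assert (HT : M * K * R0 <= eps * x).
  { replace (M * K * R0) with (T * eps) by (unfold T; field; lra).
    rewrite Rmult_comm. apply Rmult_le_compat_l; lra. }
  apply Rmult_le_reg_r with (R0 ^ n * (K / R0)).
  { apply Rmult_lt_0_compat; [ assumption | apply Rdiv_lt_0_compat; lra ]. }
  replace (M * / R0 ^ n * (R0 ^ n * (K / R0))) with (M * K * R0 * / (R0 * R0)) by (field; lra).
  apply Rle_trans with (eps * x).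
  - apply Rle_trans with (M * K * R0); [ | assumption ].
    rewrite <- (Rmult_1_r (M * K * R0)) at 2.
    apply Rmult_le_compat_l; [ apply Rmult_le_pos; [ apply Rmult_le_pos; lra | lra ] | ].
    rewrite <- Rinv_1. apply Rinv_le_contravar; nra.
  - rewrite Hs at 1. rewrite <- Rmult_assoc, (Rmult_comm eps), !Rmult_assoc.
    replace (eps * (Rpower x beta * (R0 ^ n * (K / R0)))) with
      (K * (R0 ^ n / R0) * (eps * Rpower x beta)) by (field; lra).
    apply Rmult_le_compat_r; [ apply Rmult_le_pos; lra | exact HB ].
Qed.

(** * Scaling the singularity to 1 *)

Lemma strict_deriv_choice (O : C -> Prop) (f : C -> C) :
  (forall v, O v -> exists l, strict_deriv f v l) -> exists df, holomorphic O f df.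
Proof.
  intros H. exists (fun v => epsilon (inhabits (RtoC 0)) (fun l => strict_deriv f v l)).
  intros v Hv. apply epsilon_spec. auto.
Qed.

Lemma near_scaled (rho : R) (D O : C -> Prop) (v : C) :
  0 < rho -> is_open O -> (forall v, O v -> D (RtoC rho * v)%C) -> O v ->
  near (RtoC rho * v)%C D.
Proof.
  intros Hr HO HD Hv.
  assert (Hr0 : RtoC rho <> 0) by (intros E; apply RtoC_inj in E; lra).
  destruct (HO v Hv) as (d & Hd & H).
  exists (rho * d). split; [ now apply Rmult_lt_0_compat | ]. intros x Hx.
  replace x with (RtoC rho * (x / RtoC rho))%C by (field; exact Hr0).
  apply HD, H.
  replace (x / RtoC rho - v)%C with (/ RtoC rho * (x - RtoC rho * v))%C by (field; exact Hr0).
  rewrite Cmod_mult, Cmod_inv, Cmod_R, Rabs_pos_eq by (auto; lra).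
  apply Rmult_lt_reg_l with rho; [ assumption | ].
  replace (rho * (/ rho * Cmod (x - rho * v))) with (Cmod (x - rho * v)) by (field; lra).
  exact Hx.
Qed.

Lemma scaled_holomorphic (rho : R) (D O : C -> Prop) (f : C -> C) :
  0 < rho -> is_open O -> (forall v, O v -> D (RtoC rho * v)%C) -> analytic_on D f ->
  exists df, holomorphic O (fun v => f (RtoC rho * v)%C) df.
Proof.
  intros Hr HO HD Hf. apply strict_deriv_choice. intros v Hv.
  destruct (analytic_at_strict_deriv D f (RtoC rho * v)%C) as [l Hl].
  - now apply near_scaled with O.
  - apply Hf, HD, Hv.
  - exists (l * (RtoC rho * 1))%C.
    apply (strict_deriv_comp f (fun v => RtoC rho * v)%C); [ exact Hl | ].
    apply (strict_deriv_scal _ (fun x => x)), strict_deriv_id.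
Qed.

Lemma taylor_poly_scaled (y : nat -> C) (rho : R) (n : nat) (v : C) :
  taylor_poly (fun k => y k * RtoC rho ^ k)%C n v = taylor_poly y n (RtoC rho * v)%C.
Proof.
  induction n as [ | n IH ].
  - simpl. ring.
  - cbn [taylor_poly]. rewrite IH, Cpow_mult_l. ring.
Qed.

Lemma scaled_has_taylor (rho : R) (D : C -> Prop) (f : C -> C) (y : nat -> C) :
  0 < rho -> near 0 D ->
  locally (RtoC 0) (fun x : C => D x ->
      @is_pseries C_AbsRing C_NormedModule y (x - 0)%C (f x)) ->
  has_taylor (fun k => y k * RtoC rho ^ k)%C (fun v => f (RtoC rho * v)%C).
Proof.
  intros Hr HD Hser n.
  destruct (analytic_at_taylor D f y n HD Hser) as (K & d & Hd & H).
  exists (K * rho ^ S n), (d / rho). split; [ now apply Rdiv_lt_0_compat | ].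
  intros v Hv. replace (v - 0)%C with v in Hv by ring.
  rewrite taylor_poly_scaled.
  assert (E : Cmod (RtoC rho * v) = rho * Cmod v)
    by (rewrite Cmod_mult, Cmod_R, Rabs_pos_eq; lra).
  eapply Rle_trans; [ apply H | ].
  - replace (RtoC rho * v - 0)%C with (RtoC rho * v)%C by ring. rewrite E.
    replace d with (rho * (d / rho)) by (field; lra). now apply Rmult_lt_compat_l.
  - rewrite E, Rpow_mult_distr. right. ring.
Qed.

Lemma error_modulus_small (omega : R -> R) : error_modulus omega -> small_at_0 omega.
Proof.
  intros [[M HM] Hlim]. split.
  - exists M. intros x Hx. apply HM. lra.
  - intros eps He.
    destruct (proj1 (filterlim_locally _ _) Hlim (mkposreal eps He)) as [d Hd].
    exists d. split; [ apply cond_pos | ]. intros x Hx.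
    assert (Hb : Rabs (omega x - 0) < eps).
    { apply (Hd x); [ | lra ]. change (Rabs (x - 0) < d).
      rewrite Rminus_0_r, Rabs_pos_eq; lra. }
    rewrite Rminus_0_r in Hb. pose proof (Rle_abs (omega x)). lra.
Qed.

Lemma small_at_0_add_power (omega : R -> R) (M beta : R) :
  0 <= M -> 0 < beta -> small_at_0 omega ->
  small_at_0 (fun x => omega x + M * Rpower x beta).
Proof.
  intros HM Hb [[B HB] Hs]. split.
  - exists (B + M * Rpower 6 beta). intros x Hx. pose proof (HB x Hx).
    assert (0 < Rpower x beta) by apply exp_pos.
    assert (Rpower x beta <= Rpower 6 beta) by (apply Rle_Rpower_l; lra).
    split; nra.
  - intros eps He.
    destruct (Hs (eps / 2) ltac:(lra)) as (eta & Heta & H).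
    set (e := eps / (2 * (M + 1))).
    assert (Hep : 0 < e) by (apply Rdiv_lt_0_compat; lra).
    exists (Rmin eta (Rpower e (/ beta))).
    split; [ apply Rmin_pos; [ assumption | apply exp_pos ] | ].
    intros x Hx. pose proof (Rmin_l eta (Rpower e (/ beta))).
    pose proof (Rmin_r eta (Rpower e (/ beta))).
    pose proof (H x ltac:(lra)).
    assert (Hpx : Rpower x beta <= e).
    { apply Rle_trans with (Rpower (Rpower e (/ beta)) beta).
      - apply Rle_Rpower_l; lra.
      - rewrite Rpower_mult, Rinv_l, Rpower_1; lra. }
    assert (M * Rpower x beta <= eps / 2).
    { apply Rle_trans with ((M + 1) * e).
      - apply Rmult_le_compat; try lra. apply Rlt_le, exp_pos.
      - right. unfold e. field. lra. }
    lra.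
Qed.

(** A point v outside the sector has |v|^2 >= 1 + 2 cos phi |v - 1|, so if |v| is
    close to 1 then v is close to 1. Hence the domain and the disc around the
    vertex together contain a full disc of radius greater than |rho_h|. *)
Lemma ball_in_domain_or_vertex (rho delta phi eta delta' : R) (v : C) :
  0 < rho -> 0 < phi < PI / 2 -> 0 < eta ->
  0 < delta' -> delta' <= 1 -> delta' <= delta -> delta' <= eta * cos phi / 2 ->
  Cmod v < 1 + delta' ->
  delta_domain rho delta phi (RtoC rho * v)%C \/
  Cmod (RtoC rho * v - RtoC rho)%C < eta * Rabs rho.
Proof.
  intros Hr Hphi Heta H0 H1 H2 H3 Hv.
  assert (Hcos : 0 < cos phi) by (apply cos_gt_0; lra).
  destruct (Rlt_le_dec (Re v - 1) (cos phi * Cmod (v - 1))) as [Hlt | Hge].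
  - left. apply delta_domain_scaled; auto. split; lra.
  - right. replace (RtoC rho * v - RtoC rho)%C with ((v - 1) * RtoC rho)%C by ring.
    rewrite Cmod_mult, Cmod_R. apply Rmult_lt_compat_r; [ apply Rabs_pos_lt; lra | ].
    pose proof (Cmod_ge_0 (v - 1)) as Hs. set (s := Cmod (v - 1)) in *.
    assert (E : Cmod v ^ 2 = 1 + 2 * (Re v - 1) + s ^ 2).
    { unfold s. rewrite !Cmod2_alt. unfold Re, Im; simpl. ring. }
    pose proof (Cmod_ge_0 v).
    assert (Cmod v ^ 2 < 1 + 3 * delta') by (simpl; nra).
    assert (2 * (s * cos phi) < 3 * delta') by (pose proof (pow2_ge_0 s); nra).
    apply Rmult_lt_reg_r with (cos phi); [ assumption | ]. nra.
Qed.

(** * Uniform coefficient asymptotics *)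

Section Uniform.

Variables (y : nat -> nat -> R) (rho_ : nat -> R) (delta phi alpha : R)
  (Y U : nat -> C -> C) (A_ : nat -> C).
Hypothesis delta_gt0 : 0 < delta.
Hypothesis phi_range : 0 < phi < PI / 2.
Hypothesis alpha_notin_N0 : forall k : nat, alpha <> INR k.
Hypothesis Y_series : forall h : nat,
  continues_series (y h) (delta_domain (rho_ h) delta phi) (Y h).
Hypothesis Y_expansion : exists omega : R -> R, error_modulus omega /\
  forall h : nat,
    singular_expansion (delta_domain (rho_ h) delta phi) (rho_ h) alpha
      omega (Y h) (U h) (A_ h).
Hypothesis U_bounded : exists M : R, forall (h : nat) (x : C),
  delta_domain (rho_ h) delta phi x -> Cmod (U h x) <= M.
Hypothesis U_vertex : 0 < alpha -> exists eta M : R, 0 < eta /\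
  forall h : nat,
    let B := fun x : C => Cmod (x - RtoC (rho_ h))%C < eta * Rabs (rho_ h) in
    analytic_on (fun x : C => delta_domain (rho_ h) delta phi x \/ B x) (U h)
    /\ (forall x : C, B x -> Cmod (U h x) <= M).

Lemma Y_scaled_holomorphic (h : nat) :
  0 < rho_ h -> exists df,
  holomorphic (sector delta phi) (fun v => Y h (RtoC (rho_ h) * v)%C) df.
Proof.
  intros Hr. apply scaled_holomorphic with (delta_domain (rho_ h) delta phi); auto.
  - apply sector_open.
  - intros v Hv. now apply delta_domain_scaled.
  - apply Y_series.
Qed.

Lemma Y_scaled_taylor (h : nat) :
  0 < rho_ h ->
  has_taylor (fun n => RtoC (y h n) * RtoC (rho_ h) ^ n)%C (fun v => Y h (RtoC (rho_ h) * v)%C).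
Proof.
  intros Hr. apply (scaled_has_taylor (rho_ h) (fun _ => True) (Y h) (fun n => RtoC (y h n))).
  - assumption.
  - exists 1. split; [ lra | auto ].
  - generalize (proj2 (Y_series h)). apply filter_imp. intros x Hx _.
    assert (E : forall z : C, (z - 0)%C = z) by (intros z; ring).
    rewrite (E x). exact Hx.
Qed.

Lemma scaled_expansion (h : nat) (omega : R -> R) (v : C) :
  0 < rho_ h ->
  singular_expansion (delta_domain (rho_ h) delta phi) (rho_ h) alpha
      omega (Y h) (U h) (A_ h) ->
  sector delta phi v ->
  Cmod (Y h (RtoC (rho_ h) * v)%C - U h (RtoC (rho_ h) * v)%C - A_ h * Cpower (1 - v) alpha)%C
    <= omega (Cmod (1 - v)) * Rpower (Cmod (1 - v)) alpha.
Proof.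
  intros Hr Hexp Hv.
  pose proof (Hexp _ (delta_domain_scaled (rho_ h) delta phi v Hr phi_range Hv)) as H.
  cbv zeta in H.
  replace (1 - RtoC (rho_ h) * v / RtoC (rho_ h))%C with (1 - v)%C in H; [ exact H | ].
  field. intros E. apply RtoC_inj in E. lra.
Qed.

(** Here M <= M |1-v|^(-alpha) |1-v|^alpha and the first power tends to 0 at 1, so
    the bounded U_h is part of the error term. *)
Lemma uniform_coefficients_negative :
  alpha < 0 -> forall eps, 0 < eps -> exists N, forall n, (N <= n)%nat ->
  forall h, 0 < rho_ h ->
  Cmod (RtoC (y h n) * RtoC (rho_ h) ^ n - A_ h * RtoC (power_coef alpha n))%C
    <= eps * Rpower (INR n) (- alpha - 1).
Proof.
  intros Ha eps Heps.
  destruct Y_expansion as (omega & Hom & Hexp). destruct U_bounded as [M HM].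
  set (M' := Rmax 0 M).
  assert (HM0 : 0 <= M') by apply Rmax_l. assert (HMM : M <= M') by apply Rmax_r.
  destruct (coefficient_transfer delta phi alpha (fun x => omega x + M' * Rpower x (- alpha)))
    with (eps := eps) as [N HN]; auto.
  { apply small_at_0_add_power; [ assumption | lra | now apply error_modulus_small ]. }
  exists N. intros n Hn h Hr.
  destruct (Y_scaled_holomorphic h Hr) as [df Hf].
  pose proof (HN n Hn _ df (fun _ => RtoC 0) (fun _ => RtoC 0) (A_ h) _ (fun _ => RtoC 0)
    Hf (fun v _ => strict_deriv_const 0 v) (Y_scaled_taylor h Hr)) as H.
  replace (RtoC (y h n) * RtoC (rho_ h) ^ n - A_ h * RtoC (power_coef alpha n))%C with
    (RtoC (y h n) * RtoC (rho_ h) ^ n - 0 - A_ h * RtoC (power_coef alpha n))%C by ring.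
  apply H.
  - intros k. exists 0, 1. split; [ lra | ]. intros v _.
    assert (E : taylor_poly (fun _ => RtoC 0) k v = 0).
    { induction k as [ | k IH ]; [ reflexivity | ]. cbn [taylor_poly]. rewrite IH. ring. }
    rewrite E. replace (RtoC 0 - RtoC 0)%C with (RtoC 0) by ring. rewrite Cmod_0. lra.
  - intros v Hv.
    pose proof (scaled_expansion h omega v Hr (Hexp h) Hv) as HE.
    pose proof (HM h _ (delta_domain_scaled (rho_ h) delta phi v Hr phi_range Hv)) as HU.
    set (f := Y h (RtoC (rho_ h) * v)%C) in *. set (w := U h (RtoC (rho_ h) * v)%C) in *.
    replace (f - 0 - A_ h * Cpower (1 - v) alpha)%C with
      ((f - w - A_ h * Cpower (1 - v) alpha) + w)%C by ring.
    eapply Rle_trans; [ apply Cmod_triangle | ].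
    rewrite Rmult_plus_distr_r, Rmult_assoc, <- Rpower_plus.
    replace (- alpha + alpha) with 0 by ring.
    rewrite Rpower_O; [ lra | ].
    apply Cmod_gt_0, slit_neq0. eapply sector_slit; eassumption.
Qed.

(** Here U_h is subtracted: it extends to a disc of radius 1 + delta', and its
    coefficients decay geometrically at a rate independent of h. *)
Lemma uniform_coefficients_positive :
  0 < alpha -> forall eps, 0 < eps -> exists N, forall n, (N <= n)%nat ->
  forall h, 0 < rho_ h ->
  Cmod (RtoC (y h n) * RtoC (rho_ h) ^ n - A_ h * RtoC (power_coef alpha n))%C
    <= eps * Rpower (INR n) (- alpha - 1).
Proof.
  intros Ha eps Heps.
  destruct Y_expansion as (omega & Hom & Hexp). destruct U_bounded as [M HM].
  destruct (U_vertex Ha) as (eta & M1 & Heta & HU).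
  assert (Hcos : 0 < cos phi) by (apply cos_gt_0; lra).
  set (M' := Rmax 0 (Rmax M M1)).
  assert (HM0 : 0 <= M') by apply Rmax_l.
  assert (HMM : M <= M' /\ M1 <= M').
  { pose proof (Rmax_r 0 (Rmax M M1)). pose proof (Rmax_l M M1). pose proof (Rmax_r M M1).
    fold M' in H. lra. }
  (* a disc of radius 1 + delta' on which U_h is analytic and bounded *)
  set (delta' := Rmin (Rmin 1 delta) (eta * cos phi / 2)).
  assert (Hd' : 0 < delta').
  { unfold delta'. repeat apply Rmin_pos; try lra.
    assert (0 < eta * cos phi) by now apply Rmult_lt_0_compat. lra. }
  assert (Hd1 : delta' <= 1 /\ delta' <= delta /\ delta' <= eta * cos phi / 2).
  { unfold delta'. pose proof (Rmin_l (Rmin 1 delta) (eta * cos phi / 2)).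
    pose proof (Rmin_r (Rmin 1 delta) (eta * cos phi / 2)).
    pose proof (Rmin_l 1 delta). pose proof (Rmin_r 1 delta). lra. }
  destruct Hd1 as (D1 & D2 & D3).
  destruct (coefficient_transfer delta phi alpha omega) with (eps := eps / 2)
    as [N1 HN1]; auto; [ now apply error_modulus_small | lra | ].
  destruct (geometric_negligible (1 + delta' / 2) (2 * M') (- alpha - 1)) with (eps := eps / 2)
    as [N2 HN2]; try lra.
  exists (Nat.max N1 N2). intros n Hn h Hr.
  destruct (HU h) as [HUan HUb].
  set (D := fun x : C => delta_domain (rho_ h) delta phi x \/
     Cmod (x - RtoC (rho_ h))%C < eta * Rabs (rho_ h)) in *.
  assert (HD : forall v, Cmod v < 1 + delta' -> D (RtoC (rho_ h) * v)%C).
  { intros v Hv. unfold D. apply ball_in_domain_or_vertex with delta'; auto. }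
  assert (Hopen := is_open_ball (1 + delta')).
  assert (HD0 : near 0 D).
  { replace (RtoC 0) with (RtoC (rho_ h) * 0)%C by ring.
    apply near_scaled with (fun v => Cmod v < 1 + delta'); auto. rewrite Cmod_0. lra. }
  assert (HDs : forall v, sector delta phi v -> D (RtoC (rho_ h) * v)%C).
  { intros v Hv. left. now apply delta_domain_scaled. }
  destruct (HUan 0) as [a0 Ha0].
  { destruct HD0 as (d & Hd & H). apply H.
    replace (RtoC 0 - RtoC 0)%C with (RtoC 0) by ring. rewrite Cmod_0. exact Hd. }
  pose proof (scaled_has_taylor (rho_ h) D (U h) a0 Hr HD0 Ha0) as Htay.
  destruct (scaled_holomorphic (rho_ h) D (fun v => Cmod v < 1 + delta') (U h) Hr Hopen HD HUan)
    as [dw1 Hw1].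
  destruct (scaled_holomorphic (rho_ h) D (sector delta phi) (U h) Hr
     (sector_open delta phi) HDs HUan) as [dw2 Hw2].
  destruct (Y_scaled_holomorphic h Hr) as [df Hf].
  pose proof (HN1 n ltac:(lia) _ df _ dw2 (A_ h) _ _ Hf Hw2 (Y_scaled_taylor h Hr) Htay
     (fun v Hv => scaled_expansion h omega v Hr (Hexp h) Hv)) as H1.
  pose proof (ball_coefficient_bound (1 + delta') (1 + delta' / 2) M' _ dw1
     (fun k => a0 k * RtoC (rho_ h) ^ k)%C n ltac:(lra) ltac:(lra) Hw1) as H2.
  specialize (H2 ltac:(intros v Hv; destruct (HD v Hv) as [HDv | HDv];
     [ pose proof (HM h _ HDv) | pose proof (HUb _ HDv) ]; lra) Htay).
  specialize (HN2 n ltac:(lia)). cbv beta in H1, H2.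
  set (u := (a0 n * RtoC (rho_ h) ^ n)%C) in *.
  replace (RtoC (y h n) * RtoC (rho_ h) ^ n - A_ h * RtoC (power_coef alpha n))%C with
    ((RtoC (y h n) * RtoC (rho_ h) ^ n - u - A_ h * RtoC (power_coef alpha n)) + u)%C by ring.
  eapply Rle_trans; [ apply Cmod_triangle | ]. lra.
Qed.

Lemma uniform_coefficients :
  forall eps, 0 < eps -> exists N, forall n, (N <= n)%nat ->
  power_coef alpha n <> 0 /\ forall h, 0 < rho_ h ->
  Cmod (RtoC (y h n * rho_ h ^ n / power_coef alpha n) - A_ h)%C <= eps.
Proof.
  intros eps Heps.
  destruct (power_coef_lower_bound alpha alpha_notin_N0) as (C0 & N0 & HC0 & Hlow).
  assert (HeC : 0 < eps * C0) by now apply Rmult_lt_0_compat.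
  assert (Hu : exists N, forall n, (N <= n)%nat -> forall h, 0 < rho_ h ->
    Cmod (RtoC (y h n) * RtoC (rho_ h) ^ n - A_ h * RtoC (power_coef alpha n))%C
      <= eps * C0 * Rpower (INR n) (- alpha - 1)).
  { destruct (Rtotal_order alpha 0) as [Ha | [Ha | Ha]].
    - now apply uniform_coefficients_negative.
    - exfalso. exact (alpha_notin_N0 0%nat Ha).
    - now apply uniform_coefficients_positive. }
  destruct Hu as [N1 HN1].
  exists (Nat.max N0 N1). intros n Hn.
  specialize (Hlow n ltac:(lia)). specialize (HN1 n ltac:(lia)).
  set (a := power_coef alpha n) in *.
  assert (Hp : 0 < Rpower (INR n) (- alpha - 1)) by apply exp_pos.
  assert (Ha0 : 0 < Rabs a) by (pose proof (Rmult_lt_0_compat _ _ HC0 Hp); lra).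
  assert (Ha : a <> 0) by (intros E; rewrite E, Rabs_R0 in Ha0; lra).
  split; [ exact Ha | ]. intros h Hr.
  specialize (HN1 h Hr).
  assert (Hac : RtoC a <> 0) by (intros E; apply RtoC_inj in E; auto).
  replace (RtoC (y h n) * RtoC (rho_ h) ^ n - A_ h * RtoC a)%C with
    ((RtoC (y h n * rho_ h ^ n / a) - A_ h) * RtoC a)%C in HN1.
  2: { rewrite RtoC_div, RtoC_mult, RtoC_pow by exact Ha. field. exact Hac. }
  rewrite Cmod_mult, Cmod_R in HN1.
  apply Rmult_le_reg_r with (Rabs a); [ assumption | ].
  eapply Rle_trans; [ exact HN1 | ].
  rewrite Rmult_assoc. apply Rmult_le_compat_l; [ lra | exact Hlow ].
Qed.

Variables (yoo : nat -> R) (rho : R) (A : C).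
Hypothesis rho_gt0 : 0 < rho.
Hypothesis rho_lim : is_lim_seq rho_ rho.
Hypothesis y_lim : forall n : nat, is_lim_seq (fun h => y h n) (yoo n).
Hypothesis A_lim : filterlim A_ eventually (locally A).
Hypothesis A_neq0 : A <> RtoC 0.

Lemma A_close (eps : R) : 0 < eps -> eventually (fun h => Cmod (A_ h - A)%C < eps).
Proof.
  intros He. apply (A_lim (fun x => Cmod (x - A)%C < eps)). apply locally_near.
  exists eps. auto.
Qed.

Lemma rho_eventually_pos : eventually (fun h => 0 < rho_ h).
Proof. apply (rho_lim (fun x => 0 < x)). apply (open_gt 0). exact rho_gt0. Qed.

(** For fixed n, let h tend to infinity in the uniform estimate. *)
Lemma limit_coefficients :
  forall eps, 0 < eps -> exists N, forall n, (N <= n)%nat ->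
  Cmod (RtoC (yoo n * rho ^ n / power_coef alpha n) - A)%C <= eps.
Proof.
  intros eps Heps. destruct (uniform_coefficients eps Heps) as [N HN].
  exists N. intros n Hn. destruct (HN n Hn) as [Ha H].
  apply Rle_of_eps. intros e He.
  assert (Hlim : is_lim_seq (fun h => y h n * rho_ h ^ n / power_coef alpha n)
     (yoo n * rho ^ n / power_coef alpha n)).
  { apply is_lim_seq_mult'; [ | apply is_lim_seq_const ].
    apply is_lim_seq_mult'; [ apply y_lim | ].
    apply (is_lim_seq_continuous (fun x => x ^ n)); [ | exact rho_lim ].
    apply derivable_continuous_pt, derivable_pt_pow. }
  assert (He2 : 0 < e / 2) by lra.
  pose proof (proj1 (filterlim_locally _ _) Hlim (mkposreal _ He2)) as HL.
  destruct (filter_ex _ (filter_and _ _ HL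
     (filter_and _ _ (A_close _ He2) rho_eventually_pos))) as (h & H1 & H2 & H3).
  specialize (H h H3).
  set (p := yoo n * rho ^ n / power_coef alpha n) in *.
  set (q := y h n * rho_ h ^ n / power_coef alpha n) in *.
  change (Rabs (q - p) < e / 2) in H1.
  replace (RtoC p - A)%C with
    (- (RtoC (q - p)) + ((RtoC q - A_ h) + (A_ h - A)))%C by (rewrite RtoC_minus; ring).
  eapply Rle_trans; [ apply Cmod_triangle | ].
  eapply Rle_trans; [ apply Rplus_le_compat_l, Cmod_triangle | ].
  rewrite Cmod_opp, Cmod_R. lra.
Qed.

(** y_{h,n} / y_n without the factor (rho / rho_h)^n that drives the theorem. *)
Definition reduced_ratio (n h : nat) : R := (y h n * rho_ h ^ n) / (yoo n * rho ^ n).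

Lemma reduced_ratio_close :
  forall eps, 0 < eps -> exists N H, forall n h, (N <= n)%nat -> (H <= h)%nat ->
  yoo n <> 0 /\ 0 < rho_ h /\ Rabs (reduced_ratio n h - 1) <= eps.
Proof.
  intros eps Heps.
  assert (HA : 0 < Cmod A) by now apply Cmod_gt_0.
  (* the limiting coefficient is then at least |A| / 2 in modulus, and the two
     normalised coefficients differ by at most 3 e *)
  set (e := Rmin (Cmod A / 2) (eps * Cmod A / 6)).
  assert (He : 0 < e).
  { apply Rmin_pos; [ lra | ]. pose proof (Rmult_lt_0_compat _ _ Heps HA). lra. }
  assert (He1 : e <= Cmod A / 2) by apply Rmin_l.
  assert (He2 : e <= eps * Cmod A / 6) by apply Rmin_r.
  destruct (uniform_coefficients e He) as [N1 HN1].
  destruct (limit_coefficients e He) as [N2 HN2].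
  destruct (A_close e He) as [H1 HH1]. destruct rho_eventually_pos as [H2 HH2].
  exists (Nat.max N1 N2), (Nat.max H1 H2). intros n h Hn Hh.
  destruct (HN1 n ltac:(lia)) as [Ha Hq]. specialize (Hq h (HH2 h ltac:(lia))).
  specialize (HN2 n ltac:(lia)). specialize (HH1 h ltac:(lia)).
  set (a := power_coef alpha n) in *.
  set (p := yoo n * rho ^ n / a) in *. set (q := y h n * rho_ h ^ n / a) in *.
  assert (Hp : Cmod A / 2 <= Rabs p).
  { rewrite <- Cmod_R. pose proof (Cmod_triangle_inv A (RtoC p)) as T.
    rewrite Cmod_minus_sym in T. lra. }
  assert (Hp0 : p <> 0) by (intros E; rewrite E, Rabs_R0 in Hp; lra).
  assert (Hy : yoo n <> 0).
  { intros E. apply Hp0. unfold p. rewrite E. field. exact Ha. }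
  split; [ exact Hy | split; [ apply HH2; lia | ] ].
  assert (Hqp : Rabs (q - p) <= 3 * e).
  { rewrite <- Cmod_R.
    replace (RtoC (q - p)) with ((RtoC q - A_ h) + ((A_ h - A) - (RtoC p - A)))%C
      by (rewrite RtoC_minus; ring).
    eapply Rle_trans; [ apply Cmod_triangle | ].
    eapply Rle_trans; [ apply Rplus_le_compat_l, Cmod_triangle | ].
    rewrite Cmod_opp. lra. }
  assert (Hrn : rho ^ n <> 0) by (apply pow_nonzero; lra).
  replace (reduced_ratio n h - 1) with ((q - p) / p)
    by (unfold reduced_ratio, q, p; field; auto).
  unfold Rdiv. rewrite Rabs_mult, Rabs_inv.
  apply Rmult_le_reg_r with (Rabs p); [ lra | ].
  rewrite Rmult_assoc, Rinv_l by lra. rewrite Rmult_1_r.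
  apply Rle_trans with (3 * e); [ exact Hqp | ].
  apply Rle_trans with (eps * (Cmod A / 2)); [ lra | ].
  apply Rmult_le_compat_l; lra.
Qed.

End Uniform.

(** * The singularities and the window *)

Lemma ln_near_1 (x eps : R) : Rabs (x - 1) <= Rmin (1 / 2) (eps / 4) -> 0 < eps ->
  Rabs (ln x) < eps.
Proof.
  intros Hx He. pose proof (Rmin_l (1 / 2) (eps / 4)). pose proof (Rmin_r (1 / 2) (eps / 4)).
  assert (H1 : Rabs (x - 1) <= 1 / 2) by lra. assert (H2 : Rabs (x - 1) <= eps / 4) by lra.
  apply Rabs_le_between in H1. apply Rabs_le_between in H2.
  pose proof (ln_le_sub_1 x ltac:(lra)) as U.
  pose proof (ln_le_sub_1 (/ x) ltac:(apply Rinv_0_lt_compat; lra)) as L.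
  rewrite ln_Rinv in L by lra.
  assert (/ x - 1 <= 2 * (eps / 4)).
  { replace (/ x - 1) with ((1 - x) * / x) by (field; lra).
    assert (0 < / x <= 2).
    { split; [ apply Rinv_0_lt_compat; lra | ].
      replace 2 with (/ (1 / 2)) by field. apply Rinv_le_contravar; lra. }
    nra. }
  apply Rabs_lt_between. lra.
Qed.

Lemma double_exponential_lim (zeta r : R) :
  0 < zeta < 1 -> 1 < r -> is_lim_seq (fun h => Rpower zeta (r ^ h)) 0.
Proof.
  intros Hz Hr.
  assert (Hl : ln zeta < 0) by (rewrite <- ln_1; apply ln_increasing; lra).
  apply is_lim_seq_spec. intros eps. simpl.
  pose proof (is_lim_seq_geom_p r Hr) as G. apply is_lim_seq_spec in G.
  specialize (G (ln eps / ln zeta)). revert G. apply filter_imp. intros h Hh.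
  rewrite Rminus_0_r, Rabs_pos_eq by apply Rlt_le, exp_pos.
  rewrite <- (exp_ln eps) by apply cond_pos.
  unfold Rpower. apply exp_increasing.
  apply Ropp_lt_cancel.
  replace (- ln eps) with (ln eps / ln zeta * - ln zeta) by (field; lra).
  replace (- (r ^ h * ln zeta)) with (r ^ h * - ln zeta) by ring.
  apply Rmult_lt_compat_r; lra.
Qed.

(** With x = rho_h / rho - 1, the hypothesis says that x / (kappa Z) -> 1, and
    x / (1 + x) <= ln (1 + x) <= x. *)
Lemma log_singularity_asymptotics (rho_ : nat -> R) (rho kappa : R) (Z : nat -> R) :
  0 < rho -> 0 < kappa -> (forall h, 0 < Z h) -> is_lim_seq Z 0 ->
  is_lim_seq (fun h => (rho_ h / rho - (1 + kappa * Z h)) / Z h) 0 ->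
  is_lim_seq rho_ rho /\
  is_lim_seq (fun h => ln (rho_ h / rho) / (kappa * Z h) - 1) 0.
Proof.
  intros Hr Hk HZ HZ0 Has.
  set (x := fun h => rho_ h / rho - 1).
  assert (HxZ : is_lim_seq (fun h => x h / (kappa * Z h)) 1).
  { apply is_lim_seq_ext with
      (fun h => / kappa * ((rho_ h / rho - (1 + kappa * Z h)) / Z h) + 1).
    - intros h. unfold x. specialize (HZ h). field. lra.
    - replace (Finite 1) with (Finite (/ kappa * 0 + 1)) by (f_equal; ring).
      apply is_lim_seq_plus'; [ | apply is_lim_seq_const ].
      apply is_lim_seq_mult'; [ apply is_lim_seq_const | exact Has ]. }
  assert (Hx : is_lim_seq x 0).
  { apply is_lim_seq_ext with (fun h => x h / (kappa * Z h) * (kappa * Z h)).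
    - intros h. specialize (HZ h). field. lra.
    - replace (Finite 0) with (Finite (1 * (kappa * 0))) by (f_equal; ring).
      apply is_lim_seq_mult'; [ exact HxZ | ].
      apply is_lim_seq_mult'; [ apply is_lim_seq_const | exact HZ0 ]. }
  assert (H1x : is_lim_seq (fun h => 1 + x h) 1).
  { replace (Finite 1) with (Finite (1 + 0)) by (f_equal; ring).
    apply is_lim_seq_plus'; [ apply is_lim_seq_const | exact Hx ]. }
  split.
  - apply is_lim_seq_ext with (fun h => rho * (1 + x h)).
    + intros h. unfold x. field. lra.
    + replace (Finite rho) with (Finite (rho * 1)) by (f_equal; ring).
      apply is_lim_seq_mult'; [ apply is_lim_seq_const | exact H1x ].
  - apply is_lim_seq_le_le_loc with
      (fun h => x h / (kappa * Z h) * / (1 + x h) - 1) (fun h => x h / (kappa * Z h) - 1).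
    + assert (Hpos : eventually (fun h => 0 < 1 + x h)).
      { apply (H1x (fun u => 0 < u)). apply (open_gt 0). lra. }
      revert Hpos. apply filter_imp. intros h Hh.
      replace (rho_ h / rho) with (1 + x h) by (unfold x; ring).
      set (u := x h) in *. pose proof (Rmult_lt_0_compat _ _ Hk (HZ h)) as HkZ.
      set (w := kappa * Z h) in *.
      pose proof (ln_le_sub_1 (1 + u) Hh) as Up.
      pose proof (ln_le_sub_1 (/ (1 + u)) (Rinv_0_lt_compat _ Hh)) as Lo.
      rewrite ln_Rinv in Lo by lra.
      assert (Lo' : u * / (1 + u) <= ln (1 + u)).
      { replace (u * / (1 + u)) with (- (/ (1 + u) - 1)) by (field; lra). lra. }
      assert (0 < / w) by now apply Rinv_0_lt_compat.
      split; apply Rplus_le_compat_r; unfold Rdiv.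
      * replace (u * / w * / (1 + u)) with (u * / (1 + u) * / w) by ring.
        apply Rmult_le_compat_r; lra.
      * apply Rmult_le_compat_r; lra.
    + replace (Finite 0) with (Finite (1 * / 1 - 1)) by (f_equal; field).
      apply is_lim_seq_minus'; [ | apply is_lim_seq_const ].
      apply is_lim_seq_mult'; [ exact HxZ | ].
      apply (is_lim_seq_inv (fun h => 1 + x h) 1); [ exact H1x | ].
      intros E. apply (f_equal real) in E. simpl in E. lra.
    + replace (Finite 0) with (Finite (1 - 1)) by (f_equal; ring).
      apply is_lim_seq_minus'; [ exact HxZ | apply is_lim_seq_const ].
Qed.

(** The centre of the window tends to infinity with n. *)
Lemma window_large (r d K : R) (H : nat) :
  1 < r -> 1 < d ->
  eventually (fun n => forall h, in_window r d K n h -> (H <= h)%nat).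
Proof.
  intros Hr Hd.
  assert (Hlr : 0 < ln r) by (rewrite <- ln_1; apply ln_increasing; lra).
  assert (Hld : 0 < ln d) by (rewrite <- ln_1; apply ln_increasing; lra).
  set (T := exp ((INR H + K) * ln r)).
  assert (HT : 0 < T) by apply exp_pos.
  destruct (INR_unbounded (exp (ln d * T))) as [N HN].
  exists N. intros n Hn h Hw.
  destruct (Nat.le_gt_cases H h) as [ | Hlt ]; [ assumption | exfalso ].
  apply lt_INR in Hlt.
  assert (Hn' : exp (ln d * T) < INR n) by (eapply Rlt_le_trans; [ apply HN | now apply le_INR ]).
  assert (Hln : ln d * T < ln (INR n)).
  { rewrite <- (ln_exp (ln d * T)). apply ln_increasing; [ apply exp_pos | exact Hn' ]. }
  assert (HTn : T < logb d (INR n)).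
  { unfold logb. apply Rmult_lt_reg_r with (ln d); [ assumption | ].
    replace (ln (INR n) / ln d * ln d) with (ln (INR n)) by (field; lra). lra. }
  assert (HH : INR H + K < logb r (logb d (INR n))).
  { apply Rmult_lt_reg_r with (ln r); [ assumption | ].
    replace (logb r (logb d (INR n)) * ln r) with (ln (logb d (INR n)))
      by (unfold logb; field; lra).
    rewrite <- (ln_exp ((INR H + K) * ln r)). apply ln_increasing; [ apply exp_pos | exact HTn ]. }
  unfold in_window in Hw. apply Rabs_le_between in Hw. lra.
Qed.

(** * The distribution of X_n *)

Theorem theorem1p3
  (* coefficients y_{h,n} and y_n *)
  (y : nat -> nat -> R) (yoo : nat -> R)
  (y_ge0 : forall h n : nat, 0 <= y h n)
  (y_mono : forall h n : nat, y h n <= y (S h) n)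
  (y_lim : forall n : nat, is_lim_seq (fun h => y h n) (yoo n))
  (* X_n is only defined when y_n <> 0 *)
  (X : nat -> nat_variable)
  (X_law : forall n h : nat, yoo n <> 0 -> prob_le (X n) h = y h n / yoo n)
  (* condition (1) *)
  (rho_ : nat -> R) (rho kappa zeta r : R)
  (rho_gt0 : 0 < rho) (kappa_gt0 : 0 < kappa)
  (zeta_01 : 0 < zeta < 1) (r_gt1 : 1 < r)
  (rho_asymp : is_lim_seq
     (fun h => (rho_ h / rho - (1 + kappa * Rpower zeta (r ^ h)))
               / Rpower zeta (r ^ h)) 0)
  (* condition (2) *)
  (delta phi alpha : R)
  (delta_gt0 : 0 < delta) (phi_range : 0 < phi < PI / 2)
  (alpha_notin_N0 : forall k : nat, alpha <> INR k)
  (Y U : nat -> C -> C) (A_ : nat -> C) (A : C)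
  (Y_series : forall h : nat,
     continues_series (y h) (delta_domain (rho_ h) delta phi) (Y h))
  (Y_singular : forall h : nat,
     singular_at (delta_domain (rho_ h) delta phi) (Y h) (RtoC (rho_ h)))
  (Y_expansion : exists omega : R -> R, error_modulus omega /\
     forall h : nat,
       singular_expansion (delta_domain (rho_ h) delta phi) (rho_ h) alpha
         omega (Y h) (U h) (A_ h))
  (U_analytic : forall h : nat,
     analytic_on (delta_domain (rho_ h) delta phi) (U h))
  (U_bounded : exists M : R, forall (h : nat) (x : C),
     delta_domain (rho_ h) delta phi x -> Cmod (U h x) <= M)
  (* for alpha > 0, "analytic and uniformly bounded" includes the vertex rho_h:
     otherwise U_h could itself carry the dominant singularity there *)
  (U_vertex : 0 < alpha -> exists eta M : R, 0 < eta /\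
     forall h : nat,
       let B := fun x : C => Cmod (x - RtoC (rho_ h))%C < eta * Rabs (rho_ h) in
       analytic_on (fun x : C => delta_domain (rho_ h) delta phi x \/ B x) (U h)
       /\ (forall x : C, B x -> Cmod (U h x) <= M))
  (A_lim : filterlim A_ eventually (locally A))
  (A_neq0 : A <> RtoC 0)
  (Yoo Uoo : C -> C)
  (Yoo_series : continues_series yoo (delta_domain rho delta phi) Yoo)
  (Yoo_expansion : exists omega : R -> R, error_modulus omega /\
     singular_expansion (delta_domain rho delta phi) rho alpha omega Yoo Uoo A)
  (Uoo_analytic : analytic_on (delta_domain rho delta phi) Uoo) :
  forall K : R, exists e1 e2 : nat -> nat -> R,
    little_o1 (in_window r (/ zeta) K) e1 /\
    little_o1 (in_window r (/ zeta) K) e2 /\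
    eventually (fun n => forall h : nat, in_window r (/ zeta) K n h ->
      prob_le (X n) h = y h n / yoo n /\
      y h n / yoo n
        = exp (- kappa * INR n * Rpower zeta (r ^ h) * (1 + e1 n h) + e2 n h)).
Proof.
  intros K.
  set (Z := fun h => Rpower zeta (r ^ h)).
  assert (HZ : forall h, 0 < Z h) by (intros h; apply exp_pos).
  destruct (log_singularity_asymptotics rho_ rho kappa Z rho_gt0 kappa_gt0 HZ
    (double_exponential_lim zeta r zeta_01 r_gt1) rho_asymp) as [Hrho Hlog].
  assert (Hd : 1 < / zeta).
  { rewrite <- Rinv_1. apply Rinv_lt_contravar; lra. }
  pose proof (reduced_ratio_close y rho_ delta phi alpha Y U A_ delta_gt0 phi_range
    alpha_notin_N0 Y_series Y_expansion U_bounded U_vertex yoo rho A rho_gt0 Hrho y_lim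
    A_lim A_neq0) as Hratio.
  assert (Hwin : forall eps, 0 < eps -> eventually (fun n => forall h,
     in_window r (/ zeta) K n h ->
     yoo n <> 0 /\ 0 < rho_ h /\ Rabs (reduced_ratio y rho_ yoo rho n h - 1) <= eps)).
  { intros eps Heps. destruct (Hratio eps Heps) as (N & H & HNH).
    destruct (window_large r (/ zeta) K H r_gt1 Hd) as [N' HN'].
    exists (Nat.max N N'). intros n Hn h Hw.
    apply HNH; [ lia | ]. apply (HN' n); [ lia | exact Hw ]. }
  (* the logarithm of the ratio is exactly - n ln (rho_h / rho) + ln reduced_ratio *)
  exists (fun _ h => ln (rho_ h / rho) / (kappa * Z h) - 1),
         (fun n h => ln (reduced_ratio y rho_ yoo rho n h)).
  split; [ | split ].
  - intros eps Heps.
    destruct (proj1 (filterlim_locally _ _) Hlog (mkposreal eps Heps)) as [H HH].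
    generalize (window_large r (/ zeta) K H r_gt1 Hd). apply filter_imp.
    intros n Hn h Hw. specialize (HH h (Hn h Hw)).
    change (Rabs (ln (rho_ h / rho) / (kappa * Z h) - 1 - 0) < eps) in HH.
    now rewrite Rminus_0_r in HH.
  - intros eps Heps.
    generalize (Hwin (Rmin (1 / 2) (eps / 4)) ltac:(apply Rmin_pos; lra)).
    apply filter_imp. intros n Hn h Hw.
    apply ln_near_1; [ | assumption ]. now apply Hn.
  - generalize (Hwin (1 / 2) ltac:(lra)). apply filter_imp. intros n Hn h Hw.
    destruct (Hn h Hw) as (Hy & Hr & Hq).
    split; [ now apply X_law | ].
    apply Rabs_le_between in Hq.
    set (q := reduced_ratio y rho_ yoo rho n h) in *.
    fold (Z h). specialize (HZ h).
    replace (- kappa * INR n * Z h * (1 + (ln (rho_ h / rho) / (kappa * Z h) - 1)) + ln q)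
      with (- (INR n * ln (rho_ h / rho)) + ln q) by (field; lra).
    assert (Hrr : 0 < rho_ h / rho) by (apply Rdiv_lt_0_compat; lra).
    rewrite exp_plus, exp_Ropp, exp_ln by lra.
    change (exp (INR n * ln (rho_ h / rho))) with (Rpower (rho_ h / rho) (INR n)).
    rewrite Rpower_pow by assumption.
    unfold q, reduced_ratio, Rdiv. rewrite Rpow_mult_distr, pow_inv.
    assert (rho ^ n <> 0) by (apply pow_nonzero; lra).
    assert (rho_ h ^ n <> 0) by (apply pow_nonzero; lra).
    field. auto.
Qed.
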